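(* Let $G$ be the step-two Carnot group defined by an $l$-dimensional subspace $W\subset\mathfrak{so}(d)$. For every $p\in G$ the space $\Omega_p$ of admissible curves joining the origin $e$ to $p$ is homotopy equivalent to $\Omega_e$, and is therefore contractible. Moreover, for a generic choice of $W\subset\mathfrak{so}(d)$ and a generic $p\in\Delta^2$, the space $\Omega_p$ is a Hilbert manifold.
   Context: Let $W\subset\mathfrak{so}(d)$ be an $l$-dimensional linear subspace with basis $A_1,\dots,A_l$, $A_k=(a^k_{ij})$. The step-two Carnot group $G$ defined by $W$ is $\mathbb{R}^{d+l}$ with coordinates $(x,y)$, $x\in\mathbb{R}^d$, $y\in\mathbb{R}^l$, with the distribution spanned by the vector fields $E_i=\frac{\partial}{\partial x_i}-\frac12\sum_{k=1}^l\sum_{j=1}^d a^k_{ij}x_j\frac{\partial}{\partial y_k}$, $i=1,\dots,d$, declared orthonormal. The origin is $e=0$ and $\Delta^2=\{0\}\times\mathbb{R}^l\simeq\mathbb{R}^l$ is the space of vertical points. An admissible curve starting at $e$ is an absolutely continuous $\gamma:[0,2\pi]\to G$ with $\gamma(0)=e$ and $\dot\gamma=\sum_i u_iE_i(\gamma)$ a.e. for some control $u\in L^2([0,2\pi],\mathbb{R}^d)$; curves are identified with their controls. The end-point map is $F(u)=\gamma_u(2\pi)=\left(\int_0^{2\pi}u\,dt,\ \frac12\int_0^{2\pi}\left\langle\int_0^t u(\tau)d\tau, A\,u(t)\right\rangle dt\right)$, $A=(A_1,\dots,A_l)$. For $p\in G$, $\Omega_p=F^{-1}(p)\subset L^2([0,2\pi],\mathbb{R}^d)$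 with the induced topology. Genericity: ''for generic $W$ and generic $p\in\Delta^2$'' means for all $W$ in the Grassmannian of $l$-planes of $\mathfrak{so}(d)$ outside a countable union of semialgebraic subsets of positive codimension and, for each such $W$, for all $p\in\Delta^2\simeq\mathbb{R}^l$ outside a countable union of semialgebraic subsets of positive codimension (depending on $W$). *)

(* Defs.v *)
From HB Require Import structures.
From mathcomp Require Import all_boot all_order all_algebra.
From mathcomp Require Import ring_quotient.
From mathcomp Require Import all_classical all_reals all_analysis.
From mathcomp Require Import measurable_realfun.
From mathcomp Require Import ring lra.
(* The notations of multinomials clash with those of mathcomp-analysis. *)
From mathcomp Require mpoly.
Import -(notations) mpoly.

Set Implicit Arguments.
Unset Strict Implicit.
Unset Printing Implicit Defensive.
Import Order.TTheory GRing.Theory Num.Theory.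
Import numFieldNormedType.Exports.

Local Open Scope classical_set_scope.
Local Open Scope ring_scope.
Local Open Scope quotient_scope.

(** * The Hilbert space L^2([0, 2 pi], R^d) *)

(* Lebesgue measure on [0, 2 pi], as a measure on R. *)
Definition leb02pi (R : realType) :
    {measure set (measurableTypeR R) -> \bar R} :=
  mrestr (@lebesgue_measure R) (measurable_itv `[0, 2 * pi]%R).

#[global] Instance leb02pi_ae_filter (R : realType) :
  Filter (nbhs (almost_everywhere (leb02pi R))).
Proof. exact: ae_filter_ringOfSetsType. Qed.

Section L2.
Context (R : realType) (d : nat).
Local Notation mu := (leb02pi R).

(* Square-integrable functions, before identification almost everywhere. *)
Definition sqint := LfunType mu (lee1n 2).
Definition vsqint := {ffun 'I_d -> sqint}.
HB.instance Definition _ := GRing.Lmodule.on sqint.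
HB.instance Definition _ := GRing.Lmodule.on vsqint.

Definition ae0 : {pred vsqint} :=
  fun u => `[< forall i, (u i : R -> R) = cst 0 %[ae mu] >].

Fact ae0_zmod_closed : zmod_closed ae0.
Proof.
split => [|u v /asboolP u0 /asboolP v0].
  apply/asboolP => i. apply: aeW => x _. by rewrite ffunE.
apply/asboolP => i.
apply: filterS2 (u0 i) (v0 i) => x ux vx _.
by rewrite !ffunE -[LHS]/(u i x - v i x) ux// vx//= subr0.
Qed.
HB.instance Definition _ := GRing.isZmodClosed.Build vsqint ae0 ae0_zmod_closed.

Definition L2 : Type := {ideal_quot ae0}.
HB.instance Definition _ := GRing.Zmodule.on L2.
HB.instance Definition _ := EqQuotient.on L2.

(* Components of (a representative of) u. *)
Definition L2fun (u : L2) (i : 'I_d) (t : R) : R := (repr u : vsqint) i t.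

Fact pi_L2D (f g : vsqint) : \pi_L2 (f + g) = \pi_L2 f + \pi_L2 g.
Proof. exact: Quotient.pi_add. Qed.

Fact pi_L2P (f g : vsqint) :
  \pi_L2 f = \pi_L2 g <-> forall i, (f i : R -> R) = g i %[ae mu].
Proof.
have -> : (\pi_L2 f = \pi_L2 g) <-> (f - g \in ae0).
  by rewrite Quotient.idealrBE; split => [/eqP|/eqP].
split=> [/asboolP h i|h].
  apply: filterS (h i) => x /(_ I); rewrite !ffunE.
  by rewrite -[LHS]/(f i x - g i x) => /eqP; rewrite subr_eq0 => /eqP.
apply/asboolP => i; apply: filterS (h i) => x /(_ I) fg _.
by rewrite !ffunE -[LHS]/(f i x - g i x) fg subrr.
Qed.

Fact L2fun_pi (f : vsqint) i : L2fun (\pi_L2 f) i = f i %[ae mu].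
Proof. by move: i; apply/pi_L2P; rewrite reprK. Qed.

Definition L2scale (a : R) (u : L2) : L2 := \pi_L2 (a *: (repr u : vsqint)).

Fact pi_L2Z a (f : vsqint) : \pi_L2 (a *: f) = L2scale a (\pi_L2 f).
Proof.
apply/pi_L2P => i; apply: filterS (L2fun_pi f i) => x /(_ I) h _.
by rewrite !ffunE -[LHS]/(a * f i x) -h.
Qed.

Fact L2scaleA a b u : L2scale a (L2scale b u) = L2scale (a * b) u.
Proof.
rewrite -[u]reprK -(pi_L2Z b (repr u)) -(pi_L2Z a (b *: repr u)).
by rewrite -pi_L2Z scalerA.
Qed.

Fact L2scale1 : left_id 1 L2scale.
Proof. by move=> u; rewrite -[u]reprK -!pi_L2Z scale1r. Qed.

Fact L2scaleDr : right_distributive L2scale +%R.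
Proof.
by move=> a u v; rewrite -[u]reprK -[v]reprK -pi_L2D -!pi_L2Z -pi_L2D scalerDr.
Qed.

Fact L2scaleDl u : {morph L2scale^~ u : a b / a + b}.
Proof. by move=> a b; rewrite -[u]reprK -!pi_L2Z -pi_L2D scalerDl. Qed.

HB.instance Definition _ := GRing.Zmodule_isLmodule.Build R L2
  L2scaleA L2scale1 L2scaleDr L2scaleDl.

Definition L2dot (u v : L2) : R :=
  \sum_i \int[mu]_t (L2fun u i t * L2fun v i t).

Fact sqintM (f g : sqint) : mu.-integrable setT (EFin \o (f \* g)).
Proof. apply/Lfun1_integrable/Lfun2_mul_Lfun1; exact: LfunP. Qed.

Fact L2dot_pi (f g : vsqint) :
  L2dot (\pi_L2 f) (\pi_L2 g) = \sum_i \int[mu]_t (f i t * g i t).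
Proof.
apply: eq_bigr => i _; congr fine; apply: ae_eq_integral => //.
- by have /integrableP[] := sqintM ((repr (\pi_L2 f) : vsqint) i) ((repr (\pi_L2 g) : vsqint) i).
- by have /integrableP[] := sqintM (f i) (g i).
by apply: filterS2 (L2fun_pi f i) (L2fun_pi g i) => x -> // ->.
Qed.

Fact L2dotC u v : L2dot u v = L2dot v u.
Proof.
by apply: eq_bigr => i _; apply: eq_Rintegral => t _; rewrite mulrC.
Qed.

Fact L2dotDl u v w : L2dot (u + v) w = L2dot u w + L2dot v w.
Proof.
rewrite -[u]reprK -[v]reprK -[w]reprK -pi_L2D !L2dot_pi -big_split/=.
apply: eq_bigr => i _; rewrite -RintegralD//; [|exact: sqintM|exact: sqintM].
by apply: eq_Rintegral => t _; rewrite -mulrDl ffunE.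
Qed.

Fact L2dotZl a u w : L2dot (a *: u) w = a * L2dot u w.
Proof.
rewrite -[u]reprK -[w]reprK -[_ *: _]pi_L2Z !L2dot_pi mulr_sumr.
apply: eq_bigr => i _; rewrite -RintegralZl//; last exact: sqintM.
by apply: eq_Rintegral => t _; rewrite mulrA ffunE.
Qed.

Fact L2dotDr u v w : L2dot w (u + v) = L2dot w u + L2dot w v.
Proof. by rewrite L2dotC L2dotDl !(L2dotC w). Qed.

Fact L2dotZr a u w : L2dot w (a *: u) = a * L2dot w u.
Proof. by rewrite L2dotC L2dotZl (L2dotC w). Qed.

Fact L2dot_ge0 u : 0 <= L2dot u u.
Proof. by apply: sumr_ge0 => i _; apply: Rintegral_ge0 => t _; rewrite -expr2 sqr_ge0. Qed.

Fact L2dot_eq0 u : L2dot u u = 0 -> u = 0.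
Proof.
move=> /eqP; rewrite psumr_eq0; last first.
  by move=> i _; apply: Rintegral_ge0 => t _; rewrite -expr2 sqr_ge0.
move=> /allP h.
have -> : 0 = \pi_L2 0 :> L2.
  by apply: (addrI (\pi_L2 0)); rewrite addr0 -pi_L2D addr0.
rewrite -[u]reprK; apply/pi_L2P => i.
have int_ii := sqintM ((repr u : vsqint) i) ((repr u : vsqint) i).
have ii0 : (\int[mu]_t `|(L2fun u i t * L2fun u i t)%:E| = 0)%E.
  have /eqP fi0 : \int[mu]_t (L2fun u i t * L2fun u i t) == 0.
    by have := h i (mem_index_enum i).
  have -> : (\int[mu]_t `|(L2fun u i t * L2fun u i t)%:E| =
             \int[mu]_t (L2fun u i t * L2fun u i t)%:E)%E.
    by apply: eq_integral => t _; rewrite gee0_abs// lee_fin -expr2 sqr_ge0.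
  by rewrite -[LHS]fineK ?[fine _]fi0//; exact: integrable_fin_num.
have /integrableP[mii _] := int_ii.
have /(ae_eq_integral_abs _ measurableT mii) := ii0.
apply: filterS => t /(_ I) [] /eqP; rewrite mulf_eq0 orbb => /eqP ut0 _.
by rewrite ffunE.
Qed.

Fact L2dot_CS u v : L2dot u v ^+ 2 <= L2dot u u * L2dot v v.
Proof.
have [vv0|vv_neq0] := eqVneq (L2dot v v) 0.
  rewrite (L2dot_eq0 vv0) -(scale0r (0 : L2)) !L2dotZr !mul0r mulr0.
  by rewrite expr0n.
have vv_gt0 : 0 < L2dot v v by rewrite lt0r vv_neq0 L2dot_ge0.
have := L2dot_ge0 (L2dot v v *: u + (- L2dot u v) *: v).
rewrite !(L2dotDl, L2dotZl, L2dotDr, L2dotZr) (L2dotC v u).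
set a := L2dot u u; set b := L2dot u v; set c := L2dot v v.
rewrite (_ : _ + _ = c * (a * c - b ^+ 2)); last by ring.
by rewrite pmulr_rge0// subr_ge0.
Qed.

Definition L2norm (u : L2) : R := Num.sqrt (L2dot u u).

Fact L2normD u v : L2norm (u + v) <= L2norm u + L2norm v.
Proof.
have uv : L2dot u v <= L2norm u * L2norm v.
  rewrite -sqrtrM ?L2dot_ge0//.
  by rewrite (le_trans (ler_norm _))// -sqrtr_sqr ler_wsqrtr// L2dot_CS.
rewrite -(@ler_pXn2r _ 2)// ?nnegrE ?addr_ge0 ?sqrtr_ge0//.
rewrite sqrrD !sqr_sqrtr ?L2dot_ge0// !(L2dotDl, L2dotDr) (L2dotC v u).
by move: uv; rewrite /L2norm; lra.
Qed.

Fact L2normZ a u : L2norm (a *: u) = `|a| * L2norm u.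
Proof.
rewrite /L2norm L2dotZl L2dotZr mulrA -expr2 sqrtrM ?sqr_ge0//.
by rewrite sqrtr_sqr.
Qed.

Fact L2norm_eq0 u : L2norm u = 0 -> u = 0.
Proof.
move=> /eqP; rewrite sqrtr_eq0 => uu; apply: L2dot_eq0; apply/eqP.
by rewrite eq_le uu L2dot_ge0.
Qed.

HB.instance Definition _ := Lmodule_isNormed.Build R L2
  L2normD L2normZ L2norm_eq0.

Lemma L2normE (u : L2) : `|u| = Num.sqrt (L2dot u u).
Proof. by []. Qed.

End L2.

(** * Admissible curves and the end-point map *)

Section Carnot.
Context (R : realType) (d l : nat).
Implicit Types (A : l.-tuple 'M[R]_d) (u : L2 R d) (t : R).
Local Notation mu := (leb02pi R).
Local Notation G := ('rV[R]_d * 'rV[R]_l)%type.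

(* The vector field E_i of the step-two Carnot group with structure matrices
   A, in the coordinates (x, y). *)
Definition horizontal_field A (i : 'I_d) (g : G) : G :=
  (delta_mx 0 i,
   \row_k (- (1 / 2) * \sum_j tnth A k i j * g.1 0 j)).

Definition control u t : 'rV[R]_d := \row_i L2fun u i t.

Definition position u t : 'rV[R]_d :=
  \row_i \int[mu]_(s in `[0, t]) L2fun u i s.

(* The admissible curve gamma_u starting at the origin. *)
Definition trajectory A u t : G :=
  (position u t,
   \row_k (1 / 2 * \int[mu]_(s in `[0, t])
             (position u s *m (tnth A k *m (control u s)^T)) 0 0)).

Fact leb02piT_fin : mu [set: R] \is a fin_num.
Proof.
rewrite /leb02pi /= /mrestr setTI lebesgue_measure_itv/=.
by case: ifP => _.
Qed.

Fact L2fun_integrable u i : mu.-integrable setT (EFin \o L2fun u i).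
Proof.
by apply/Lfun1_integrable/Lfun_subset12; [exact: leb02piT_fin|exact: LfunP].
Qed.

Fact position_bounded u i : [bounded position u t 0 i | t in [set: R]].
Proof.
have intu := L2fun_integrable u i.
exists (\int[mu]_t `|L2fun u i t|); split; first exact: num_real.
move=> M ltM t _ /=; rewrite mxE; apply: le_trans (ltW ltM).
have intut : mu.-integrable `[0, t] (EFin \o L2fun u i).
  exact: integrableS intu.
apply: le_trans (le_normr_Rintegral _ intut) _ => //.
have intn := integrable_abse intu.
apply: fine_le.
- by apply: integrable_fin_num => //; exact: integrableS intn.
- exact: integrable_fin_num.
apply: ge0_subset_integral => //.
by have /integrableP[] := intn.
Qed.

Fact measurable_position u i : measurable_fun [set: R] (fun t => position u t 0 i).
Proof.
have intu := L2fun_integrable u i.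
have nd (f : R -> \bar R) : mu.-integrable setT f -> (forall x, 0 <= f x)%E ->
    measurable_fun [set: R] (fun t => fine (\int[mu]_(s in `[0%R, t]) f s)%E).
  move=> intf f0; apply: nondecreasing_measurable => // s t st.
  have intft r : mu.-integrable `[0, r] f by exact: integrableS intf.
  apply: fine_le; [exact: integrable_fin_num|exact: integrable_fin_num|].
  apply: ge0_subset_integral => //.
    by have /integrableP[] := intft t.
  by apply: subset_itvl; rewrite bnd_simp.
pose f := EFin \o L2fun u i.
rewrite (_ : (fun t => _) = (fun t => fine (\int[mu]_(s in `[0%R, t]) f^\+ s)%E)
    \- (fun t => fine (\int[mu]_(s in `[0%R, t]) f^\- s)%E)).
  by apply: measurable_funB; apply: nd => //;
    [exact: integrable_funepos|exact: integrable_funeneg].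
apply/funext => t; rewrite mxE /Rintegral integralE fineB//.
  by apply: integrable_fin_num => //; apply: integrable_funepos => //;
    exact: integrableS intu.
by apply: integrable_fin_num => //; apply: integrable_funeneg => //;
  exact: integrableS intu.
Qed.

(* gamma_u solves gamma' = \sum_i u_i E_i(gamma), gamma(0) = 0, in integral
   form. *)
Lemma trajectory_horizontal A u t (skewA : forall k, (tnth A k)^T = - tnth A k)
    (v := fun s =>
       \sum_i L2fun u i s *: horizontal_field A i (trajectory A u s)) :
  trajectory A u t = (\row_j \int[mu]_(s in `[0, t]) (v s).1 0 j,
                      \row_k \int[mu]_(s in `[0, t]) (v s).2 0 k).
Proof.
have v1 s : (v s).1 = \sum_i L2fun u i s *: (delta_mx 0 i : 'rV_d).
  by rewrite /v (big_morph fst (id1 := 0) (op1 := +%R)).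
have v2 s : (v s).2 =
    \sum_i L2fun u i s *: (horizontal_field A i (trajectory A u s)).2.
  by rewrite /v (big_morph snd (id1 := 0) (op1 := +%R)).
have quadE s k : (position u s *m (tnth A k *m (control u s)^T)) 0 0 =
    \sum_i \sum_j L2fun u i s * position u s 0 j * tnth A k j i.
  rewrite mxE exchange_big; apply: eq_bigr => j _.
  rewrite [(_ *m _) j 0]mxE mulr_sumr; apply: eq_bigr => i _.
  by rewrite [_^T _ _]mxE [control _ _ 0 i]mxE; ring.
congr pair; apply/rowP => k; rewrite !mxE.
  apply: eq_Rintegral => s _; rewrite v1 summxE (bigD1 k)//= big1 ?addr0.
    by rewrite !mxE !eqxx mulr1.
  by move=> j jk; rewrite !mxE eq_sym (negbTE jk) andbF mulr0.
rewrite -RintegralZl//.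
  apply: eq_Rintegral => s _; rewrite quadE v2 summxE mulr_sumr.
  apply: eq_bigr => i _; rewrite [in RHS]mxE [X in _ = _ * X]mxE !mulr_sumr.
  apply: eq_bigr => j _.
  have := congr1 (fun M : 'M[R]_d => M j i) (skewA k); rewrite !mxE => ->.
  by rewrite /=; ring.
have intG : mu.-integrable setT (fun s => (\sum_i \sum_j
    ((L2fun u i s)%:E * (position u s 0 j)%:E) * (tnth A k j i)%:E)%E).
  apply: integrable_sum => // i _; apply: integrable_sum => // j _.
  apply: integrableZr => //; apply: integrableMl => //.
  - exact: L2fun_integrable.
  - exact: measurable_position.
  - exact: position_bounded.
apply: (@integrableS _ _ _ _ setT) => //.
apply: eq_integrable intG => // s _.
rewrite /= quadE -sumEFin; apply: eq_bigr => i _.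
by rewrite -sumEFin; apply: eq_bigr => j _.
Qed.

Definition endpoint A u : G := trajectory A u (2 * pi).

Definition Omega A (p : G) : set (L2 R d) := [set u | endpoint A u = p].

End Carnot.

(** * Homotopy *)

Section Homotopy.
Context (R : realType).

Definition homotopic (X Y : topologicalType) (f g : X -> Y) :=
  exists H : X * R -> Y,
    [/\ {within [set: X] `*` `[0, 1], continuous H},
        forall x, H (x, 0) = f x & forall x, H (x, 1) = g x].

Definition homotopy_equivalent (X Y : topologicalType) :=
  exists (f : X -> Y) (g : Y -> X),
    [/\ continuous f, continuous g, homotopic (g \o f) id
      & homotopic (f \o g) id].

Definition contractible (X : topologicalType) :=
  exists x0 : X, homotopic id (cst x0).

End Homotopy.

(** * Hilbert manifolds *)

Section HilbertManifold.
Context (R : realType).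

(* f is of class C^k on the open set U, in the sense of the tangent map: f is
   Frechet differentiable and its differential, seen as the map
   (x, v) |-> df_x(v) on U x E, is of class C^(k-1).  Only C^oo maps are used
   below, and for these there is no difference with the definition through the
   operator norm of the successive differentials. *)
Fixpoint Ck (k : nat) (E F : normedModType R) (U : set E) (f : E -> F) : Prop :=
  if k is k'.+1 then
    (forall x, U x -> differentiable f x) /\
    Ck k' (E := (E * E)%type) (U `*` [set: E]) (fun z => 'd f (z.1) z.2)
  else forall x, U x -> {for x, continuous f}.

Definition smooth_on (E F : normedModType R) (U : set E) (f : E -> F) :=
  forall k, Ck k U f.

Definition hilbertian (E : normedModType R) :=
  exists dot : E -> E -> R,
    [/\ forall x y, dot x y = dot y x,
        forall a x y z, dot (a *: x + y) z = a * dot x z + dot y z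
      & forall x, dot x x = `|x| ^+ 2].

(* A subset X of a normed space H is a Hilbert manifold, for the induced
   topology and smooth structure, if each of its points has an open
   neighbourhood X `&` U in X that is diffeomorphic to an open subset V of a
   Hilbert space E.  A map on X `&` U is smooth when it extends to a smooth map
   on U; in particular the changes of charts phi' \o psi are smooth. *)
Definition hilbert_manifold (H : normedModType R) (X : set H) :=
  exists2 E : completeNormedModType R, hilbertian E &
  forall x, X x ->
  exists (U : set H) (V : set E) (phi : H -> E) (psi : E -> H),
    [/\ open U, U x & open V] /\
    [/\ smooth_on U phi, smooth_on V psi,
        forall y, (X `&` U) y -> V (phi y) /\ psi (phi y) = y
      & forall v, V v -> (X `&` U) (psi v) /\ phi (psi v) = v].

End HilbertManifold.

(** * Semialgebraic sets and genericity *)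

Section Semialgebraic.
Context (R : realType).

Inductive semialgebraic (n : nat) : set 'rV[R]_n -> Prop :=
| sa_pos (P : mpoly n R) : semialgebraic [set x | 0 < meval (fun i => x 0 i) P]
| sa_setC S : semialgebraic S -> semialgebraic (~` S)
| sa_setU S T : semialgebraic S -> semialgebraic T -> semialgebraic (S `|` T).

Definition rinit n (z : 'rV[R]_n.+1) : 'rV[R]_n :=
  \row_i z 0 (widen_ord (leqnSn n) i).
Definition rlast n (z : 'rV[R]_n.+1) : R := z 0 ord_max.

Definition graph_on n (D : set 'rV[R]_n) (f : 'rV[R]_n -> R) :
    set 'rV[R]_n.+1 :=
  [set z | D (rinit z) /\ rlast z = f (rinit z)].

(* f = None stands for -oo and g = None for +oo. *)
Definition band n (D : set 'rV[R]_n) (f g : option ('rV[R]_n -> R)) :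
    set 'rV[R]_n.+1 :=
  [set z | [/\ D (rinit z),
               if f is Some f then f (rinit z) < rlast z else True
             & if g is Some g then rlast z < g (rinit z) else True]].

Definition sa_continuous n (D : set 'rV[R]_n) (f : 'rV[R]_n -> R) :=
  {within D, continuous f} /\ semialgebraic (graph_on D f).

(* C is a semialgebraic cell of dimension k in R^n: the graph of a continuous
   semialgebraic function over a cell of R^(n-1), which keeps the dimension, or
   the band between two such functions, which raises it by one. *)
Fixpoint cell (n k : nat) : set 'rV[R]_n -> Prop :=
  match n return set 'rV[R]_n -> Prop with
  | 0 => fun C => k = 0%N /\ C = setT
  | n'.+1 => fun C => exists D : set 'rV[R]_n',
      (exists f, [/\ cell k D, sa_continuous D f & C = graph_on D f]) \/
      (exists k' (f g : option ('rV[R]_n' -> R)),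
        [/\ k = k'.+1, cell k' D & C = band D f g] /\
        [/\ if f is Some f then sa_continuous D f else True,
            if g is Some g then sa_continuous D g else True
          & forall x, D x ->
              match f, g with
              | Some f, Some g => (f x < g x : Prop)
              | _, _ => True
              end])
  end.

Definition has_cell n (S : set 'rV[R]_n) (k : nat) :=
  exists2 C, cell k C & C `<=` S.

(* The dimension of a semialgebraic set is the largest dimension of a cell it
   contains, hence the last condition is dim S < dim M. *)
Definition positive_codim n (M S : set 'rV[R]_n) :=
  [/\ semialgebraic S, S `<=` M &
      exists2 k, has_cell M k & forall j, has_cell S j -> (j < k)%N].

(* P holds on M outside a countable union of semialgebraic subsets of positive
   codimension, M being embedded in R^n by c. *)
Definition generic (T : Type) n (c : T -> 'rV[R]_n) (M : set T)
    (P : T -> Prop) :=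
  exists (I : set nat) (B : nat -> set T),
    (forall i, I i -> B i `<=` M /\ positive_codim (c @` M) (c @` B i)) /\
    (forall x, M x -> ~ (\bigcup_(i in I) B i) x -> P x).

Definition grassmannian (d l : nat) : set {vspace 'M[R]_d} :=
  [set W | \dim W = l /\ forall A, A \in W -> A^T = - A].

(* The standard realisation of the Grassmannian as a real algebraic set: W is
   represented by the matrix B^T (B B^T)^-1 B of the orthogonal projection of
   'M_d = R^(d * d) onto W, where the rows of B form a basis of W. *)
Definition grassmannian_coord (d : nat) (W : {vspace 'M[R]_d}) :
    'rV[R]_(d * d * (d * d)) :=
  let B := \matrix_(i < \dim W) mxvec (tnth (vbasis W) i) in
  mxvec (B^T *m invmx (B *m B^T) *m B).

End Semialgebraic.
Arguments grassmannian : clear implicits.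
Arguments grassmannian_coord : clear implicits.

(* Main.v *)
From HB Require Import structures.
Require Import Defs.
From mathcomp Require Import all_boot all_order all_algebra.
From mathcomp Require mpoly.
Import -(notations) mpoly.
From mathcomp Require Import all_classical all_reals all_analysis.
From mathcomp Require Import measurable_realfun.
From mathcomp Require Import ring lra.
Set Implicit Arguments.
Unset Strict Implicit.
Unset Printing Implicit Defensive.
Import Order.TTheory GRing.Theory Num.Theory.
Import numFieldNormedType.Exports.
Local Open Scope classical_set_scope.
Local Open Scope ring_scope.
Local Open Scope quotient_scope.

(** Fibres are contractible: keep a control u up to time t and join gamma_u(t) to
    the end point p by a polygon on [t, 2 pi] made of one segment for the
    horizontal displacement and of one commutator loop for each pair (i, j).
    The number of sides does not depend on (u, t) and the norm of the polygon is
    at most a multiple of that of u on [t, 2 pi], so that this deformation is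
    continuous; at t = 2 pi it is the identity and at t = 0 it forgets u.

    Regular fibres: u is a critical point of the end-point map over (0, y), in
    the direction eta, exactly when \sum_k eta_k A_k annihilates the curve.  The
    skew matrix S of iterated integrals of u then satisfies
    (\sum_k eta_k A_k) S = 0 and y_k = tr (A_k^T S).  This is impossible unless
    the coordinates of y satisfy one of countably many polynomial equations with
    coefficients in Z[A], hence no condition on W is needed.

    Charts: at a regular point, the missing directions are spanned by controls
    v_j, each made of a spike at some time b_j and of a compensating spike near 0.
    Nested supports make the span of the v_j isotropic for the area forms, so the
    equation endpoint (u + k + \sum_j s_j v_j) = (0, y) is linear in s and Cramer's
    rule gives an explicit smooth chart.  Its source is the orthogonal of the
    constants and of auxiliary controls on which the v_j are independent, a closed
    subspace of L^2 that is the same at all points. *)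

(** * Extension of derivations *)

(** Scaling is what makes the contraction continuous at 2 pi. A control of norm D on an interval of
    length tau moves x by O(sqrt(tau) D) and y, relative to the group law, by O(tau D^2). A loop of
    area r has sides of length sqrt |r|, and covering a length L in time tau costs a norm of order L
    / sqrt(tau): the powers of tau cancel, so the polygon is no larger than the piece of curve that
    it replaces.

    Critical values are values of a quadratic-type map on finite-dimensional skew matrices.
    Coefficients in Z[A] keep the excluded polynomials countable; with real coefficients every point
    would be a zero of one of them. A point y outside the excluded sets behaves as a generic point:
    its coordinates can be differentiated independently with A held fixed, by a derivation of the
    whole field R that Zorn's lemma provides.

    [hilbert_manifold] asks for one model space E for all points. The kernel of the chart projection
    may vary with the point, its image may not: hence auxiliary controls fixed beforehand, to which
    the directions v_j found at each point must be transversal. *)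

Section Derivation.
Context (F : numFieldType).
Implicit Types (G : set (F * F)) (x b : F) (p q pD qD : {poly F}).

(* The graph of a derivation defined on a subring of F: equivalently, a subring
   of the dual numbers F[e], on which the projection to F is injective. *)
Definition partial_derivation G :=
  [/\ G (1, 0),
      forall u v, G u -> G v -> G (u.1 - v.1, u.2 - v.2),
      forall u v, G u -> G v -> G (u.1 * v.1, u.1 * v.2 + u.2 * v.1)
    & forall b, G (0, b) -> b = 0].

Definition coefs_in G p pD := forall i, G (p`_i, pD`_i).

Section Extend.
Variable G : set (F * F).
Hypothesis derG : partial_derivation G.

Let G0 : G (0, 0).
Proof. by case: derG => G1 GB _ _; have := GB _ _ G1 G1; rewrite /= !subrr. Qed.

Let GD u v : G u -> G v -> G (u.1 + v.1, u.2 + v.2).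
Proof.
case: derG => G1 GB _ _ Gu Gv; have /(GB _ _ Gu) := GB _ _ G0 Gv.
by rewrite /= !sub0r !opprK.
Qed.

Let Gsum (I : eqType) (r : seq I) (f g : I -> F) :
  (forall i, G (f i, g i)) -> G (\sum_(i <- r) f i, \sum_(i <- r) g i).
Proof.
move=> Gfg; elim: r => [|i r IH]; first by rewrite !big_nil.
by rewrite !big_cons; exact: GD (Gfg i) IH.
Qed.

Let coefs_inB p pD q qD :
  coefs_in G p pD -> coefs_in G q qD -> coefs_in G (p - q) (pD - qD).
Proof. by case: derG => _ GB _ _ Gp Gq i; rewrite !coefB; exact: (GB _ _ (Gp i) (Gq i)). Qed.

Let coefs_inM p pD q qD :
  coefs_in G p pD -> coefs_in G q qD -> coefs_in G (p * q) (p * qD + pD * q).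
Proof.
case: derG => _ _ GM _ Gp Gq i; rewrite coefD !coefM -big_split/=.
by apply: Gsum => j; exact: (GM _ _ (Gp j) (Gq _)).
Qed.

Let coefs_inC u : G u -> coefs_in G u.1%:P u.2%:P.
Proof. by move=> Gu i; rewrite !coefC; case: eqP => // _; rewrite -surjective_pairing. Qed.

Let coefs_inXn n : coefs_in G 'X^n 0.
Proof. by case: derG => G1 _ _ _ i; rewrite coefXn coef0; case: eqP. Qed.

Let coefs_in0 pD : coefs_in G 0 pD -> pD = 0.
Proof.
case: derG => _ _ _ Ginj GpD; apply/polyP => i; rewrite coef0.
by apply: Ginj; have := GpD i; rewrite coef0.
Qed.

(* The value forced on x by a polynomial of minimal size that vanishes at x;
   if there is none, any value will do. *)
Lemma derivation_value x : exists b, forall p pD, coefs_in G p pD ->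
  p.[x] = 0 -> p^`().[x] * b + pD.[x] = 0.
Proof.
have [[n [[m [mD [Gm mx m0 nE]]] minm]]|nopoly] :=
    pselect (exists n, (exists m mD,
      [/\ coefs_in G m mD, m.[x] = 0, m != 0 & size m = n]) /\
      forall m mD, coefs_in G m mD -> m.[x] = 0 -> m != 0 -> (n <= size m)%N).
  (* In characteristic 0 the derivative of m is non-zero, shorter than m and has its coefficients in
     the same subring, so by minimality it cannot vanish at x; the value b is then obtained by a
     division. *)
  have m'x : m^`().[x] != 0.
    apply/eqP => m'x.
    have Gm' : coefs_in G m^`() mD^`().
      case: derG => _ _ GM _ i; rewrite !coef_deriv -(mulr_natr m`_i.+1) -(mulr_natr mD`_i.+1).
      have Gn : G (i.+1%:R, 0).
        elim: (i.+1) => [|k]; first exact: G0.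
        case: derG => G1 _ _ _; rewrite -[k.+1]addn1 natrD => Gk.
        by have := GD Gk G1; rewrite /= addr0.
      by have := GM _ _ (Gm i.+1) Gn; rewrite /= mulr0 add0r.
    have size_m : (1 < size m)%N.
      rewrite ltnNge; apply: contra m0 => /size1_polyC m_cst.
      by move: mx; rewrite m_cst hornerC => ->.
    have m'0 : m^`() != 0.
      have : lead_coef m != 0 by rewrite lead_coef_eq0.
      apply: contraNneq => m'0; have := coef_deriv m (size m).-2.
      rewrite m'0 coef0 lead_coefE; case: (size m) size_m => [|[|k]]//= _.
      by move=> /esym/eqP; rewrite mulrn_eq0.
    have := minm _ _ Gm' m'x m'0.
    by rewrite -nE leqNgt lt_size_deriv.
  have [b mb] : exists b, m^`().[x] * b + mD.[x] = 0.
    by exists (- mD.[x] / m^`().[x]); field.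
  exists b => p pD.
  have [k] := ubnP (size p); elim: k p pD => // k IH p pD.
  rewrite ltnS => size_p Gp px.
  have [p0|p0] := eqVneq p 0.
    by move: Gp; rewrite p0 => /coefs_in0 ->; rewrite deriv0 !horner0 mul0r addr0.
  have size_mp : (size m <= size p)%N by rewrite nE; exact: minm Gp px p0.
  (* Pseudo-division, since leading coefficients need not be invertible in the subring: lead(m) p -
     lead(p) X^j m vanishes at x and is shorter than p, and the identity for it and for m gives
     lead(m) times the identity for p. *)
  pose j := (size p - size m)%N.
  pose u := (m`_(size m).-1, mD`_(size m).-1).
  pose w := (p`_(size p).-1, pD`_(size p).-1).
  have := coefs_inB (coefs_inM (coefs_inC (Gm _ : G u)) Gp)
    (coefs_inM (coefs_inC (Gp _ : G w)) (coefs_inM (coefs_inXn j) Gm)).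
  set p1 := (X in coefs_in G X _); set p1D := (X in coefs_in G _ X) => Gp1.
  have p1x : p1.[x] = 0.
    by rewrite /p1 !hornerE /= px mx !mulr0 subr0.
  have size_p1 : (size p1 < k)%N.
    apply: leq_trans size_p; rewrite ltnNge; apply/negP => sp.
    have szpos : (0 < size p)%N by rewrite size_poly_gt0.
    have p1top : p1`_(size p).-1 = 0.
      rewrite /p1 coefB !coefCM coefXnM ltnNge.
      have -> : (j <= (size p).-1)%N.
        rewrite /j -subn1 leq_sub2l//; rewrite lt0n size_poly_eq0 //.
      rewrite /= (_ : ((size p).-1 - j)%N = (size m).-1); first by rewrite /u/w/=; ring.
      rewrite /j -!subn1 -subnDA addnC subnDA subKn//.
    have : (size p1 <= (size p).-1)%N.
      apply/leq_sizeP => i; rewrite leq_eqVlt => /orP[/eqP <-//|hi].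
      have {}hi : (size p <= i)%N by rewrite prednK in hi.
      rewrite /p1 coefB !coefCM coefXnM (nth_default _ hi) mulr0.
      have -> : m`_(i - j) = 0 by rewrite nth_default// -(subKn size_mp) leq_sub2r.
      by rewrite if_same mulr0 subr0.
    by move=> /(leq_trans sp); rewrite -ltnS prednK// ltnn.
  have h := IH _ _ size_p1 Gp1 p1x.
  have u0 : u.1 != 0 by rewrite /u/= -lead_coefE lead_coef_eq0.
  rewrite /p1 /p1D !(poly.derivE, hornerE) /= px mx in h.
  suff /eqP : u.1 * (p^`().[x] * b + pD.[x]) = 0.
    by rewrite mulf_eq0 (negbTE u0) => /eqP.
  transitivity (u.1 * (p^`().[x] * b + pD.[x])
      - w.1 * x ^+ j * (m^`().[x] * b + mD.[x])).
    by rewrite mb mulr0 subr0.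
  rewrite -[RHS]h /u /w /=; ring.
exists 0 => p pD Gp px.
suff p0 : p = 0.
  by move: Gp; rewrite p0 => /coefs_in0 ->; rewrite deriv0 !horner0 mul0r addr0.
apply: contrapT => /eqP p0; apply: nopoly.
pose Q n := `[< exists m mD, [/\ coefs_in G m mD, m.[x] = 0, m != 0 & size m = n] >].
have exQ : exists n, Q n by exists (size p); apply/asboolP; exists p, pD.
case: (ex_minnP exQ) => n /asboolP Qn minn; exists n; split => // m mD Gm mx m0.
by apply: minn; apply/asboolP; exists m, mD.
Qed.

(** G' is the image of the polynomials with dual-number coefficients under evaluation at the dual
    number x + b e. [derivation_value] is exactly the condition under which the projection of G' to
    [F] stays injective. *)
Lemma partial_derivation_extend x : exists G',
  [/\ partial_derivation G', G `<=` G' & exists b, G' (x, b)].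
Proof.
have [b bP] := derivation_value x.
exists [set u | exists p pD, [/\ coefs_in G p pD, u.1 = p.[x] &
                  u.2 = p^`().[x] * b + pD.[x]]].
split; first split.
- case: derG => G1 _ _ _; exists 1%:P, 0%:P; split; first exact: (coefs_inC G1).
    by rewrite hornerC.
  by rewrite /= derivC !(hornerC, horner0) mul0r addr0.
- move=> [? ?] [? ?] [p [pD [Gp /= -> ->]]] [q [qD [Gq /= -> ->]]].
  exists (p - q), (pD - qD); split; first exact: coefs_inB.
    by rewrite /= !hornerE.
  by rewrite /= !(poly.derivE, hornerE) /=; ring.
- move=> [? ?] [? ?] [p [pD [Gp /= -> ->]]] [q [qD [Gq /= -> ->]]].
  exists (p * q), (p * qD + pD * q); split; first exact: coefs_inM.
    by rewrite /= !hornerE.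
  by rewrite /= !(poly.derivE, hornerE) /=; ring.
- by move=> c [p [pD [Gp /= p0 ->]]]; exact: bP.
- move=> u Gu; exists u.1%:P, u.2%:P; split; first exact: coefs_inC.
    by rewrite hornerC.
  by rewrite derivC !(hornerC, horner0) mul0r add0r.
- exists b; exists 'X, 0; split; first by rewrite -['X]expr1; exact: coefs_inXn.
    by rewrite hornerX.
  by rewrite /= derivX hornerC horner0 mul1r addr0.
Qed.

End Extend.

(** A maximal partial derivation is total by the one-step extension, and injectivity of the
    projection makes it a function. Zorn's lemma is applied to sets whose union with [G] is a
    partial derivation, so that the empty chain is bounded as well. *)
Theorem derivation_extension G : partial_derivation G ->
  exists D : F -> F,
    [/\ forall x y, D (x + y) = D x + D y,
        forall x y, D (x * y) = x * D y + D x * y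
      & forall u, G u -> D u.1 = u.2].
Proof.
move=> derG.
have [A [derA maxA]] : exists A, partial_derivation (G `|` A) /\
    forall B, A `<` B -> ~ partial_derivation (G `|` B).
  apply: (@Zorn_bigcup _ (fun A => partial_derivation (G `|` A))) => C derC totC.
  pose U := G `|` \bigcup_(X in C) X.
  have common u v : U u -> U v -> exists Y,
      [/\ partial_derivation Y, Y u, Y v & Y `<=` U].
    have CU X : C X -> G `|` X `<=` U.
      by move=> CX; apply: setUS; exact: bigcup_sup.
    move=> [Gu|[X CX Xu]] [Gv|[Z CZ Zv]].
    - by exists G; split => // w; left.
    - by exists (G `|` Z); split; [exact: derC|left|right|exact: CU].
    - by exists (G `|` X); split; [exact: derC|right|left|exact: CU].
    - have [XZ|ZX] := totC _ _ CX CZ.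
        by exists (G `|` Z); split; [exact: derC|right; exact: XZ|right|exact: CU].
      by exists (G `|` X); split; [exact: derC|right|right; exact: ZX|exact: CU].
  rewrite -/U; split.
  - by left; case: derG.
  - move=> u v /common /[apply] -[Y [[_ YB _ _] Yu Yv]]; apply; exact: YB.
  - move=> u v /common /[apply] -[Y [[_ _ YM _] Yu Yv]]; apply; exact: YM.
  - by move=> b Ub; have [Y [[_ _ _ Yinj] Yb _ _]] := common _ _ Ub Ub; exact: Yinj.
have tot x : exists b, (G `|` A) (x, b).
  have [G' [derG' AG' [b G'b]]] := partial_derivation_extend derA x.
  have GG' : G `|` G' = G' by apply/setUidr => u Gu; apply: AG'; left.
  have [AsubG'|] := pselect (G' `<=` A); first by exists b; right; exact: AsubG'.
  move=> nsub; case: (maxA G'); last by rewrite GG'.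
  by split => // u Au; apply: AG'; right.
have [D DP] : exists D, forall x, (G `|` A) (x, D x).
  by have [D DP] := choice tot; exists D.
case: (derA) => H1 HB HM Hinj.
have Duniq u : (G `|` A) u -> D u.1 = u.2.
  move=> Hu; apply/eqP; rewrite -subr_eq0; apply/eqP/Hinj.
  by have := HB _ _ (DP u.1) Hu; rewrite /= subrr.
have H0 : (G `|` A) (0, 0) by have := HB _ _ H1 H1; rewrite /= !subrr.
exists D; split => [x y|x y|u Gu].
- have := HB _ _ (DP x) (HB _ _ H0 (DP y)); rewrite /= !sub0r !opprK.
  exact: Duniq (_, _).
- exact: Duniq (_, _) (HM _ _ (DP x) (DP y)).
- by apply: Duniq; left.
Qed.

End Derivation.

(** * Cells and zero sets of polynomials *)

Section Cells.
Context (R : realType).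

Lemma rinit_continuous n : continuous (@rinit R n).
Proof.
move=> z A /nbhs_ballP[e e0 eA]; apply/nbhs_ballP; exists e => // w zw.
by apply: eA; split=> // i j; rewrite !mxE; apply: zw.2.
Qed.

Lemma rlast_continuous n : continuous (@rlast R n).
Proof. by move=> z; exact: coord_continuous. Qed.

Lemma rinit_surj n (x : 'rV[R]_n) t : exists z, rinit z = x /\ rlast z = t.
Proof.
exists (\row_i if insub (i : nat) is Some j then x 0 j else t); split.
  apply/rowP => i; rewrite !mxE /= insubT//= => ilt; congr (x 0 _); exact/val_inj.
by rewrite /rlast mxE insubF// ltnn.
Qed.

Lemma within_open_continuous n (D : set 'rV[R]_n) (f : 'rV[R]_n -> R) :
  open D -> {within D, continuous f} -> {in D, continuous f}.
Proof. by move=> oD; rewrite continuous_open_subspace. Qed.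

Lemma open_band_half n (D : set 'rV[R]_n) (h : 'rV[R]_n -> R) (b : bool) :
  open D -> {within D, continuous h} ->
  open [set z | D (rinit z) /\
    (if b then h (rinit z) < rlast z else rlast z < h (rinit z))].
Proof.
move=> oD /(within_open_continuous oD) ch; rewrite openE => z [Dz hz].
have nD : \forall w \near z, D (rinit w) by apply: rinit_continuous; exact: open_nbhs_nbhs.
have cd : {for z, continuous (fun w => rlast w - h (rinit w))}.
  apply: continuousB; first exact: rlast_continuous.
  by apply: continuous_comp; [exact: rinit_continuous|apply: ch; exact/mem_set].
case: b hz => hz.
  have : \forall w \near z, 0 < rlast w - h (rinit w).
    by apply: (cvgr_gt _ cd); rewrite subr_gt0.
  by apply: filterS2 nD => w Dw; rewrite subr_gt0.
have : \forall w \near z, rlast w - h (rinit w) < 0.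
  by apply: (cvgr_lt _ cd); rewrite subr_lt0.
by apply: filterS2 nD => w Dw; rewrite subr_lt0.
Qed.

(** A graph never has top dimension, its base having one coordinate less. A top-dimensional cell is
    thus a band over a top-dimensional cell, between functions continuous on an open set. Hence a
    set with empty interior contains no cell of full dimension. *)
Lemma cell_top n k (C : set 'rV[R]_n) : cell k C ->
  [/\ (k <= n)%N, C !=set0 & k = n -> open C].
Proof.
elim: n k C => [|n IH] k C /=.
  by move=> [-> ->]; split => // [|_]; [exists 0|exact: openT].
move=> [D [[f [/IH [kn [x Dx] oD] [cf _] ->]]|]].
  split; first exact: leqW.
    by have [z [zx zt]] := rinit_surj x (f x); exists z; rewrite /graph_on/= zx zt.
  by move=> kE; move: kn; rewrite kE ltnn.
move=> [k' [f [g [[-> /IH [kn [x Dx] oD] ->] [cf cg fg]]]]].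
split => //.
  have [t [ft gt]] : exists t : R, (if f is Some f then f x < t else True : Prop) /\
      (if g is Some g then t < g x else True : Prop).
    case: f g {cf cg} fg => [f|] [g|] fg.
    - by exists ((f x + g x) / 2); have := fg x Dx; split; lra.
    - by exists (f x + 1); split => //; lra.
    - by exists (g x - 1); split => //; lra.
    - by exists 0.
  have [z [zx zt]] := rinit_surj x t; exists z; rewrite /band/= zx zt.
  by split.
move=> [/oD {}oD]; rewrite (_ : band D f g =
    [set z | D (rinit z) /\ if f is Some f then f (rinit z) < rlast z else True : Prop] `&`
    [set z | D (rinit z) /\ if g is Some g then rlast z < g (rinit z) else True : Prop]).
  have oD' : open [set z : 'rV_n.+1 | D (rinit z) /\ True].
    rewrite (_ : [set _ | _] = @rinit R n @^-1` D).
      by apply: open_comp => // z _; exact: rinit_continuous.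
    by apply/seteqP; split => [z []|].
  apply: openI.
    by case: f cf {fg} => // f [cf _]; exact: (@open_band_half _ _ _ true).
  by case: g cg {fg} => // g [cg _]; exact: (@open_band_half _ _ _ false).
apply/seteqP; split => z /=.
  by case=> Dz hf hg.
by case=> -[Dz hf] [_ hg].
Qed.

Lemma cell_setT n : @cell R n n setT.
Proof.
elim: n => [|n IH] //=; exists setT; right; exists n, None, None.
by do 2 split => //; apply/seteqP; split.
Qed.

Lemma semialgebraic_zeros n (P : mpoly n R) :
  semialgebraic [set x : 'rV[R]_n | meval (fun i => x 0 i) P = 0].
Proof.
have -> : [set x : 'rV[R]_n | meval (fun i => x 0 i) P = 0] =
    ~` ([set x | 0 < meval (fun i => x 0 i) P] `|`
        [set x | 0 < meval (fun i => x 0 i) (- P)]).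
  apply/seteqP; split => x /=; first by move=> Px; rewrite mevalN Px oppr0 ltxx => -[].
  move=> /not_orP[/negP]; rewrite -leNgt => P0 /negP.
  by rewrite -leNgt mevalN oppr_le0 => P0'; apply/eqP; rewrite eq_le P0.
by apply: sa_setC; apply: sa_setU; exact: sa_pos.
Qed.

Definition nowhere_open (n : nat) (Z : set 'rV[R]_n) :=
  forall U, open U -> U !=set0 -> ~ (U `<=` Z).

Lemma positive_codim_zeros n (P : mpoly n R) (Z : set 'rV[R]_n) :
  Z = [set x | meval (fun i => x 0 i) P = 0] ->
  nowhere_open Z -> positive_codim setT Z.
Proof.
move=> ZE Z0; split=> //; first by rewrite ZE; exact: semialgebraic_zeros.
exists n; first by exists setT => //; exact: cell_setT.
move=> j [C /cell_top[jn C0 oC] CZ]; rewrite ltn_neqAle jn andbT.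
by apply/eqP => /oC oC'; exact: (Z0 C).
Qed.

End Cells.

(** * Critical values of the vertical end-point map *)

Section IntegerPolynomials.
Context (G : finType).

(* Integer polynomials in the indeterminates G, as lists of monomials; unlike
   {mpoly int[n]} this type is countable by construction. *)
Definition intpoly : Type := seq (int * seq G).

Definition intpoly_eval (K : comNzRingType) (g : G -> K) (c : intpoly) : K :=
  \sum_(m <- c) m.1%:~R * \prod_(i <- m.2) g i.

Definition intpoly_opp (c : intpoly) : intpoly := [seq (- m.1, m.2) | m <- c].

Definition intpoly_mul (c c' : intpoly) : intpoly :=
  [seq (m.1 * m'.1, m.2 ++ m'.2) | m <- c, m' <- c'].

Context (K : comNzRingType) (g : G -> K).

Lemma intpoly_eval1 : intpoly_eval g [:: (1, [::])] = 1.
Proof. by rewrite /intpoly_eval big_seq1 big_nil mulr1. Qed.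

Lemma intpoly_evalX i : intpoly_eval g [:: (1, [:: i])] = g i.
Proof. by rewrite /intpoly_eval !big_seq1 mul1r. Qed.

Lemma intpoly_evalB c c' :
  intpoly_eval g (c ++ intpoly_opp c') = intpoly_eval g c - intpoly_eval g c'.
Proof.
rewrite /intpoly_eval big_cat/= big_map -sumrN; congr (_ + _).
by apply: eq_bigr => m _; rewrite /= mulrNz mulNr.
Qed.

Lemma intpoly_evalM c c' :
  intpoly_eval g (intpoly_mul c c') = intpoly_eval g c * intpoly_eval g c'.
Proof.
rewrite /intpoly_eval big_allpairs_dep/= mulr_suml; apply: eq_bigr => m _.
rewrite mulr_sumr; apply: eq_bigr => m' _ /=.
by rewrite big_cat/= intrM; ring.
Qed.

Lemma intpoly_eval_morph (K' : comNzRingType) (f : {rmorphism K -> K'}) c :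
  f (intpoly_eval g c) = intpoly_eval (f \o g) c.
Proof.
rewrite /intpoly_eval rmorph_sum; apply: eq_bigr => m _.
by rewrite rmorphM rmorph_int rmorph_prod.
Qed.

End IntegerPolynomials.

Lemma poly_eq0_near0 (R : realType) (p : {poly R}) (e : R) : 0 < e ->
  (forall t, `|t| < e -> p.[t] = 0) -> p = 0.
Proof.
move=> e0 pe; apply/eqP; apply: contraT => p0.
(* These are [size p] distinct roots, one too many for a non-zero [p]; the shift by 2 keeps them
   strictly inside the interval. *)
pose rs := [seq e / (i.+2)%:R | i <- iota 0 (size p)].
have := @max_poly_roots _ p rs p0; rewrite size_map size_iota ltnn; apply.
  apply/allP => _ /mapP[i _ ->]; apply/rootP/pe.
  rewrite ger0_norm ?divr_ge0 ?ltW// ltr_pdivrMr// ltr_pMr//.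
  by rewrite ltr1n.
rewrite map_inj_in_uniq ?iota_uniq// => i j _ _ /mulfI.
move=> /(_ (lt0r_neq0 e0))/invr_inj/eqP.
by rewrite eqr_nat => /eqP[].
Qed.

Section CriticalValues.
Context (R : realType) (d l : nat) (A : l.-tuple 'M[R]_d).

Let gens : finType := ('I_l * 'I_d * 'I_d + 'I_l)%type.

Let gR (y : 'rV[R]_l) (x : gens) : R :=
  match x with inl u => tnth A u.1.1 u.1.2 u.2 | inr k => y 0 k end.

Let gM (x : gens) : mpoly l R :=
  match x with inl u => mpolyC l (tnth A u.1.1 u.1.2 u.2) | inr k => mpolyX R (mnm1 k) end.

(** The generators along the line y + t v, as polynomials in t: evaluation at 0 gives the value at
    y, and the derivative at 0 is the directional derivative along v. *)
Let gL (y v : 'rV[R]_l) (x : gens) : {poly R} :=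
  match x with
  | inl u => (tnth A u.1.1 u.1.2 u.2)%:P
  | inr k => (y 0 k)%:P + v 0 k *: 'X
  end.

Let gL_eval y v t c :
  (intpoly_eval (gL y v) c).[t] = intpoly_eval (gR (y + t *: v)) c.
Proof.
rewrite -[LHS]/(horner_eval t _) intpoly_eval_morph.
apply: eq_bigr => m _; congr (_ * _); apply: eq_bigr => -[u|k] _ /=.
  by rewrite /horner_eval hornerC.
by rewrite /horner_eval !mxE !hornerE mulrC.
Qed.

Let gM_eval (y : 'rV[R]_l) c : meval (fun i => y 0 i) (intpoly_eval gM c) = intpoly_eval (gR y) c.
Proof.
rewrite intpoly_eval_morph.
apply: eq_bigr => m _; congr (_ * _); apply: eq_bigr => -[u|k] _ /=.
  by rewrite mevalC.
by rewrite mevalXU.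
Qed.

Let zeros (c : intpoly gens) : set 'rV[R]_l := [set y | intpoly_eval (gR y) c = 0].

(** A polynomial that vanishes on a non-empty open set vanishes on every line through one of its
    points, hence everywhere. *)
Let zeros_open c : ~ nowhere_open (zeros c) -> forall y v, intpoly_eval (gL y v) c = 0.
Proof.
move=> /existsNP[U /not_implyP[oU /not_implyP[[u0 Uu] /contrapT Uc]]].
pose u : 'rV[R]_l := u0.
have c0 y : intpoly_eval (gR y) c = 0.
  have : nbhs (0 : R) [set t : R | U (u + t *: (y - u))].
    have cu : {for (0 : R), continuous (fun t : R => u + t *: (y - u) : 'rV[R]_l)}.
      by apply: continuousD; [exact: cst_continuous|apply: cvgZr_tmp; exact: cvg_id].
    by apply: cu; rewrite scale0r addr0; exact: open_nbhs_nbhs.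
  move=> /nbhs_ballP[e e0 eU].
  have p0 : intpoly_eval (gL u (y - u)) c = 0.
    apply: (poly_eq0_near0 e0) => t te; rewrite gL_eval; apply: Uc; apply: eU.
    by rewrite /ball/= sub0r normrN.
  by have := gL_eval u (y - u) 1 c; rewrite p0 horner0 scale1r addrC subrK.
by move=> y v; apply: (@poly_eq0_near0 _ _ 1) => // t _; rewrite gL_eval.
Qed.

Let derM (D : R -> R) n m p (M : 'M[R]_(m, n)) (N : 'M[R]_(n, p)) :
  (forall x y, D (x + y) = D x + D y) -> (forall x y, D (x * y) = x * D y + D x * y) ->
  map_mx D (M *m N) = M *m map_mx D N + map_mx D M *m N.
Proof.
move=> DD DM; have D0 : D 0 = 0 by apply: (addrI (D 0)); rewrite -DD !addr0.
apply/matrixP => i j; rewrite !mxE (big_morph D DD D0) -big_split/=.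
by apply: eq_bigr => k _; rewrite DM !mxE.
Qed.

(* Sard's theorem for the quadratic map S |-> (tr (A_k^T S))_k: outside the zero
   sets of the polynomials over Z[A], the coordinates of y are algebraically
   independent over Q(A), hence there is a derivation of R that kills A and maps
   y_k to 1 and the other coordinates to 0.  Differentiating y along it gives
   eta_k = 0 if y is the value at a point that is critical in direction eta. *)
Lemma generic_not_critical : generic id [set: 'rV[R]_l] (fun y =>
  forall (S : 'M[R]_d) (eta : 'rV[R]_l),
    (forall k, (tnth A k)^T = - tnth A k) ->
    S^T = - S -> (forall k, y 0 k = \tr ((tnth A k)^T *m S)) ->
    (\sum_k eta 0 k *: tnth A k) *m S = 0 -> eta = 0).
Proof.
pose Z n := if unpickle n is Some c then zeros c else set0.
exists [set n | (exists c : intpoly gens, unpickle n = Some c) /\ nowhere_open (Z n)], Z.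
split.
  move=> n [[c cn]]; rewrite /Z cn => Z0; split => //.
  rewrite !image_id; apply: (@positive_codim_zeros _ _ (intpoly_eval gM c)) => //.
  by apply/seteqP; split=> y /=; rewrite gM_eval.
move=> y _ Zy S eta skewA skewS yE etaS.
(* As y avoids every zero set with empty interior, a relation over Z[A] that holds at y holds
   identically. *)
have indep c : intpoly_eval (gR y) c = 0 -> forall v, intpoly_eval (gL y v) c = 0.
  move=> cy v; apply: zeros_open => c0; apply: Zy; exists (pickle c).
    by split; [exists c; rewrite pickleK|rewrite /Z pickleK].
  by rewrite /Z pickleK.
pose Aeta := \sum_k eta 0 k *: tnth A k.
have skewAeta : Aeta^T = - Aeta.
  by rewrite /Aeta linear_sum -sumrN; apply: eq_bigr => k _; rewrite linearZ/= skewA scalerN.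
(* P fixes the row vectors in the left kernel of [Aeta^T], among them the rows of S, and takes its
   values there. As S is skew, S = P^T S P. *)
pose P := pinvmx (kermx Aeta^T) *m kermx Aeta^T.
have PAeta : P *m Aeta^T = 0 by rewrite -mulmxA mulmx_ker mulmx0.
have SP : S *m P = S.
  have : (S <= kermx Aeta^T)%MS.
    apply/sub_kermxP; apply: trmx_inj.
    by rewrite trmx_mul trmxK skewS mulmxN etaS trmx0 oppr0.
  by move=> /mulmxKpV; rewrite -mulmxA.
have SE : S = P^T *m (S *m P).
  by rewrite SP -[S in RHS]opprK -skewS mulmxN -trmx_mul SP skewS opprK.
apply/rowP => i; rewrite mxE.
pose e : 'rV[R]_l := delta_mx 0 i.
(* Values and derivatives at t = 0 of integer polynomials along y + t e_i. By [indep], value 0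
   forces the polynomial in t to be 0, so this is the graph of a derivation of Z[A, y]. *)
pose G := [set u : R * R | exists c, u.1 = (intpoly_eval (gL y e) c).[0] /\
             u.2 = (intpoly_eval (gL y e) c)^`().[0]].
have derG : partial_derivation G.
  split.
  - by exists [:: (1, [::])]; rewrite intpoly_eval1 /= derivC hornerC horner0.
  - move=> [? ?] [? ?] [c [/= -> ->]] [c' [/= -> ->]].
    exists (c ++ intpoly_opp c') => /=; rewrite intpoly_evalB.
    by rewrite derivB !hornerD !hornerN.
  - move=> [? ?] [? ?] [c [/= -> ->]] [c' [/= -> ->]].
    exists (intpoly_mul c c') => /=; rewrite intpoly_evalM.
    by rewrite derivM hornerD !hornerM; split => //; rewrite addrC.
  - move=> b [c [/= c0 ->]]; move: c0; rewrite gL_eval scale0r addr0 => c0.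
    by rewrite indep// deriv0 horner0.
have [D [DD DM DG]] := derivation_extension derG.
have D0 : D 0 = 0 by apply: (addrI (D 0)); rewrite -DD !addr0.
have DA k : map_mx D (tnth A k)^T = 0.
  apply/matrixP => a b; rewrite !mxE.
  apply: (DG (tnth A k b a, 0)); exists [:: (1, [:: inl (k, b, a)])].
  by rewrite intpoly_evalX /= derivC hornerC horner0.
have Dy k : D (y 0 k) = (k == i)%:R.
  apply: (DG (y 0 k, (k == i)%:R)); exists [:: (1, [:: inr k])].
  rewrite intpoly_evalX /= derivD derivC derivZ derivX !hornerE /e mxE eqxx.
  by rewrite eq_sym.
have trD (M : 'M[R]_d) : D (\tr M) = \tr (map_mx D M).
  by rewrite /mxtrace (big_morph D DD D0); apply: eq_bigr => a _; rewrite mxE.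
(* [D] is applied to each y_k = tr (A_k^T S) separately and the results are then combined with eta,
   because [D] may fail to kill eta. The sum of the eta_k D y_k collapses to eta_i. *)
transitivity (\tr (Aeta^T *m map_mx D S)).
  transitivity (\sum_k eta 0 k * D (y 0 k)).
    rewrite (bigD1 i)//= Dy eqxx mulr1 big1 ?addr0// => k ki.
    by rewrite Dy (negbTE ki) mulr0.
  rewrite /Aeta linear_sum mulmx_suml linear_sum; apply: eq_bigr => k _.
  rewrite linearZ/= -scalemxAl linearZ/= {1}yE trD derM// DA mul0mx addr0.
  by [].
(* In the derivative of P^T (S P), each term keeps one undifferentiated P that meets [Aeta^T]: P^T
   directly, P by cyclicity of the trace. Both products vanish. *)
rewrite SE derM// mulmxDr mulmxA.
have -> : Aeta^T *m P^T = 0.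
  by rewrite skewAeta mulNmx -[Aeta]trmxK -trmx_mul PAeta trmx0 oppr0.
rewrite mul0mx add0r mulmxA mxtrace_mulC -mulmxA (mulmxA P) PAeta mul0mx mulmx0.
by rewrite mxtrace0.
Qed.

End CriticalValues.

(** * Calculus of smooth maps *)

Section DiffNear.
Context (R : realType) (E F : normedModType R).

Lemma diff_near0 (h : E -> F) x : (\forall y \near x, h y = 0) ->
  differentiable h x /\ 'd h x = (\0 : E -> F) :> (E -> F).
Proof.
move=> h0.
pose z : {linear E -> F} := \0.
have cz : continuous z by exact: cst_continuous.
have hx : h x = 0 by exact: nbhs_singleton h0.
have h0' : \forall y \near (0 : E), h (y + x) = 0.
  have c : (fun y : E => y + x) @ (0 : E) --> 0 + x by apply: cvgD; [exact: cvg_id|exact: cvg_cst].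
  by move: c; rewrite add0r => /(_ _ h0).
have hE : h \o shift x = cst (h x) + z +o_ 0 id.
  apply/eqaddoP => _ /posnumP[e]; near=> y.
  rewrite !fctE hx add0r subr0 /=.
  by rewrite [h _](near h0' y)// normr0 mulr_ge0.
split; last exact: (diff_unique cz hE).
by apply/diff_locallyP; rewrite (diff_unique cz hE).
Unshelve. all: by end_near. Qed.

Lemma near_eq_diff (f g : E -> F) x : (\forall y \near x, f y = g y) ->
  differentiable f x -> differentiable g x /\ 'd g x = 'd f x :> (E -> F).
Proof.
move=> fg df; have [dh hE] : differentiable (g - f) x /\ 'd (g - f) x = (\0 : E -> F) :> (E -> F).
  by apply: diff_near0; apply: filterS fg => y fgy; rewrite !fctE fgy subrr.
have -> : g = f + (g - f) by rewrite addrC subrK.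
split; first exact: differentiableD.
by rewrite diffD// hE; apply/funext => v; rewrite /= addr0.
Qed.

End DiffNear.

Section CkTheory.
Context (R : realType).
Implicit Types (E F : normedModType R) (k : nat).

Lemma open_setXT E (U : set E) : open U -> open (U `*` [set: E]).
Proof.
move=> oU; rewrite (_ : U `*` setT = fst @^-1` U).
  by apply: open_comp => // z _; exact: cvg_fst.
by apply/seteqP; split => [z []|z Uz]//; split.
Qed.

(** Formulas for the differential, such as the product rule, hold on [U] only, while [Ck] speaks of
    total functions; as [U] is open, the formula may replace the differential at every order. *)
Lemma Ck_eq k E F (U : set E) (f g : E -> F) : open U ->
  (forall x, U x -> f x = g x) -> Ck k U f -> Ck k U g.
Proof.
elim: k E F U f g => [|k IH] E F U f g oU fg /=.
  move=> cf x Ux; have fgx : \forall y \near x, f y = g y.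
    by apply: filterS (open_nbhs_nbhs (conj oU Ux)).
  rewrite -[{for x, _}]/(g @ x --> g x) -(fg x Ux); apply: cvg_trans (cf x Ux).
  exact: near_eq_cvg.
move=> [df Cf].
have fgx x : U x -> \forall y \near x, f y = g y.
  by move=> Ux; apply: filterS (open_nbhs_nbhs (conj oU Ux)).
split=> [x Ux|]; first by have [] := near_eq_diff (fgx x Ux) (df x Ux).
apply: IH Cf; first exact: open_setXT.
by move=> [x v] [/= Ux _]; have [_ ->] := near_eq_diff (fgx x Ux) (df x Ux).
Qed.

Lemma CkS k E F (U : set E) (f : E -> F) : Ck k.+1 U f -> Ck k U f.
Proof.
elim: k E F U f => [|k IH] E F U f /=.
  by move=> [df _] x /df/differentiable_continuous.
by move=> [df [d2f Cf]]; split => //; apply: IH.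
Qed.

Lemma Ck_lin k E F (U : set E) (f : {linear E -> F}) : continuous f -> Ck k U f.
Proof.
elim: k E U f => [|k IH] E U f cf /=; first by move=> x _; exact: cf.
split=> [x _|]; first exact: linear_differentiable.
have -> : (fun z : E * E => 'd f (z.1) z.2) = (f \o snd : {linear (E * E)%type -> F}).
  by apply/funext => z; rewrite diff_lin.
by apply: IH => z; apply: continuous_comp; [exact: cvg_snd|exact: cf].
Qed.

Lemma Ck_cst k E F (U : set E) (a : F) : Ck k U (cst a).
Proof.
elim: k E F U a => [|k IH] E F U a /=; first by move=> x _; exact: cst_continuous.
split=> [x _|]; first exact: differentiable_cst.
have -> : (fun z : E * E => 'd (@cst E F a) (z.1) z.2) = cst 0.
  by apply/funext => z; rewrite diff_cst.
exact: IH.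
Qed.

Lemma CkD k E F (U : set E) (f g : E -> F) : open U ->
  Ck k U f -> Ck k U g -> Ck k U (f + g).
Proof.
elim: k E F U f g => [|k IH] E F U f g oU /=.
  by move=> cf cg x Ux; apply: continuousD; [exact: cf|exact: cg].
move=> [df Cf] [dg Cg]; split=> [x Ux|].
  by apply: differentiableD; [exact: df|exact: dg].
have oUT : open (U `*` [set: E]) by exact: open_setXT.
apply: (Ck_eq oUT _ (IH _ _ _ _ _ oUT Cf Cg)) => -[x v] [/= Ux _].
by rewrite diffD//; [exact: df|exact: dg].
Qed.

(** The tangent map of f \o h is that of f precomposed with the linear map h x h, so the induction
    stays within composites with linear maps and no general chain rule of order k is involved. *)
Lemma Ck_comp_lin k E E' F (U : set E) (f : E -> F) (h : {linear E' -> E}) :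
  open U -> continuous h -> Ck k U f -> Ck k (h @^-1` U) (f \o h).
Proof.
elim: k E E' F U f h => [|k IH] E E' F U f h oU ch /=.
  by move=> cf x Ux; apply: continuous_comp; [exact: ch|exact: cf].
move=> [df Cf]; split=> [x Ux|].
  by apply: differentiable_comp; [exact: linear_differentiable|exact: df].
pose hh (z : E' * E') : E * E := (h z.1, h z.2).
have lin_hh : linear hh.
  by move=> a z w; rewrite /hh /= !linearP.
pose HH : {linear (E' * E')%type -> (E * E)%type} := HB.pack hh
  (GRing.isLinear.Build _ _ _ _ _ lin_hh).
have cHH : continuous HH.
  move=> z; apply: cvg_pair.
    by apply: continuous_comp; [exact: cvg_fst|exact: ch].
  by apply: continuous_comp; [exact: cvg_snd|exact: ch].
have := IH _ _ _ _ _ HH (open_setXT oU) cHH Cf.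
have -> : HH @^-1` (U `*` setT) = (h @^-1` U) `*` setT by apply/seteqP; split.
apply: Ck_eq.
  by apply: open_setXT; apply: open_comp => // z _; exact: ch.
move=> [x v] [/= Ux _]; rewrite (@diff_comp _ _ _ _ h f)//; last exact: df.
  by rewrite /= diff_lin.
exact: linear_differentiable.
Qed.

Lemma Ck_lin_comp k E F F' (U : set E) (f : E -> F) (h : {linear F -> F'}) :
  open U -> continuous h -> Ck k U f -> Ck k U (h \o f).
Proof.
elim: k E U f => [|k IH] E U f oU ch /=.
  by move=> cf x Ux; apply: continuous_comp; [exact: cf|exact: ch].
move=> [df Cf]; split=> [x Ux|].
  by apply: differentiable_comp; [exact: df|exact: linear_differentiable].
have oUT := open_setXT oU.
apply: (Ck_eq oUT _ (IH _ _ _ oUT ch Cf)) => -[x v] [/= Ux _].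
rewrite (@diff_comp _ _ _ _ f h)//; last exact: linear_differentiable.
  by rewrite /= diff_lin.
exact: df.
Qed.

Lemma Ck_fst k E F (U : set E) (f : E -> F) : Ck k U f ->
  open U -> Ck k (U `*` [set: E]) (f \o fst).
Proof.
move=> Cf oU; have cfst : continuous (fst : {linear (E * E)%type -> E}).
  by move=> z; exact: cvg_fst.
have := Ck_comp_lin oU cfst Cf; congr Ck.
by apply/seteqP; split => [z|z []].
Qed.

Lemma CkM k E (U : set E) (f g : E -> R) : open U ->
  Ck k U f -> Ck k U g -> Ck k U (f * g).
Proof.
elim: k E U f g => [|k IH] E U f g oU.
  by move=> cf cg x Ux; apply: continuousM; [exact: cf|exact: cg].
move=> Cf1 Cg1; have [Cf0 Cg0] := (CkS Cf1, CkS Cg1).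
move: Cf1 Cg1 => [df Cf] [dg Cg]; split=> [x Ux|].
  by apply: differentiableM; [exact: df|exact: dg].
have oUT := open_setXT oU.
apply: (Ck_eq oUT _ (CkD oUT (IH _ _ _ _ oUT (Ck_fst Cf0 oU) Cg)
                             (IH _ _ _ _ oUT (Ck_fst Cg0 oU) Cf))).
by move=> [x v] [/= Ux _]; rewrite diffM//; [exact: df|exact: dg].
Qed.

Lemma CkV k E (U : set E) (f : E -> R) : open U -> (forall x, U x -> f x != 0) ->
  Ck k U f -> Ck k U (fun x => (f x)^-1).
Proof.
elim: k E U f => [|k IH] E U f oU f0.
  by move=> cf x Ux; apply: continuousV; [exact: f0|exact: cf].
move=> Cf1; have Cf0 := CkS Cf1; move: Cf1 => [df Cf]; split=> [x Ux|].
  by apply: differentiableV; [exact: df|exact: f0].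
have oUT := open_setXT oU.
have Ci := Ck_fst (IH _ _ _ oU f0 Cf0) oU.
have Cm : Ck k (U `*` [set: E]) (cst (-1) : E * E -> R) by exact: Ck_cst.
have Cd := CkM oUT (CkM oUT Cm (CkM oUT Ci Ci)) Cf.
apply: Ck_eq oUT _ Cd.
move=> [x v] [/= Ux _]; rewrite diffV//; [|exact: df|exact: f0].
by rewrite !fctE /= mulN1r -exprVn expr2.
Qed.

(** The differential (x, v) -> b x v + b v x is again the diagonal of a continuous bilinear form,
    now on E x E, which closes the induction. *)
Lemma Ck_quad k E (U : set E) (b : {bilinear E -> E -> R}) :
  continuous (fun z : E * E => b z.1 z.2) -> Ck k U (fun x => b x x).
Proof.
elim: k E U b => [|k IH] E U b cb.
  move=> x _; apply: (@continuous_comp _ _ _ (fun x => (x, x)) (fun z => b z.1 z.2)); last exact: cb.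
  by apply: cvg_pair; exact: cvg_id.
pose diag (x : E) := (x, x).
have lin_diag : linear diag by [].
pose dg : {linear E -> (E * E)%type} := HB.pack diag
  (GRing.isLinear.Build _ _ _ _ _ lin_diag).
have cdg : continuous dg by move=> x; apply: cvg_pair; exact: cvg_id.
have -> : (fun x => b x x) = (fun z => b z.1 z.2) \o dg by [].
split=> [x _|].
  by apply: differentiable_comp; [exact: linear_differentiable|exact: differentiable_bilin].
pose b' (z w : E * E) := b z.1 w.2 + b z.2 w.1.
have lin_b' : bilinear_for (GRing.Scale.Law.clone _ _ *:%R _) (GRing.Scale.Law.clone _ _ *:%R _) b'.
  split=> z a w w'.
    by rewrite /b' /= !linearDl !linearZl_LR scalerDr addrACA.
  by rewrite /b' /= !linearDr !linearZr_LR scalerDr addrACA.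
pose B' : {bilinear (E * E)%type -> (E * E)%type -> R} := HB.pack b'
  (bilinear_isBilinear.Build R (E * E)%type (E * E)%type R _ _ b' lin_b').
have -> : (fun z : E * E => 'd ((fun z => b z.1 z.2) \o dg) (z.1) z.2) = (fun z => B' z z).
  apply/funext => -[x v].
  have dgE : 'd dg x = dg :> (E -> E * E) by exact: diff_lin.
  rewrite (@diff_comp _ _ _ _ dg (fun z => b z.1 z.2)); last exact: differentiable_bilin.
    rewrite -[LHS]/('d (fun z => b z.1 z.2) (dg x) ('d dg x v)) dgE.
    by rewrite (@diff_bilin _ _ _ _ b).
  exact: linear_differentiable.
apply: IH => z; apply: (@continuousD _ _ _ (fun z : (E * E) * (E * E) => b z.1.1 z.2.2)
  (fun z : (E * E) * (E * E) => b z.1.2 z.2.1)).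
  apply: (@continuous_comp _ _ _ (fun z : (E * E) * (E * E) => (z.1.1, z.2.2)) (fun z => b z.1 z.2)); last exact: cb.
  apply: cvg_pair; apply: continuous_comp; do ?[exact: cvg_fst|exact: cvg_snd].
apply: (@continuous_comp _ _ _ (fun z : (E * E) * (E * E) => (z.1.2, z.2.1)) (fun z => b z.1 z.2)); last exact: cb.
apply: cvg_pair; apply: continuous_comp; do ?[exact: cvg_fst|exact: cvg_snd].
Qed.

Lemma Ck_sum k E F (U : set E) (I : Type) (r : seq I) (P : pred I) (f : I -> E -> F) :
  open U -> (forall i, Ck k U (f i)) -> Ck k U (fun x => \sum_(i <- r | P i) f i x).
Proof.
move=> oU Cf; elim: r => [|i r IH].
  rewrite (_ : (fun _ => _) = cst 0); first exact: Ck_cst.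
  by apply/funext => x; rewrite big_nil.
have [Pi|Pi] := boolP (P i).
  rewrite (_ : (fun _ => _) = f i + (fun x => \sum_(i <- r | P i) f i x)).
    exact: CkD.
  by apply/funext => x; rewrite big_cons Pi.
by move: IH; congr Ck; apply/funext => x; rewrite big_cons (negbTE Pi).
Qed.

Lemma Ck_prod k E (U : set E) (I : Type) (r : seq I) (P : pred I) (f : I -> E -> R) :
  open U -> (forall i, Ck k U (f i)) -> Ck k U (fun x => \prod_(i <- r | P i) f i x).
Proof.
move=> oU Cf; elim: r => [|i r IH].
  rewrite (_ : (fun _ => _) = cst 1); first exact: Ck_cst.
  by apply/funext => x; rewrite big_nil.
have [Pi|Pi] := boolP (P i).
  rewrite (_ : (fun _ => _) = f i * (fun x => \prod_(i <- r | P i) f i x)).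
    exact: CkM.
  by apply/funext => x; rewrite big_cons Pi.
by move: IH; congr Ck; apply/funext => x; rewrite big_cons (negbTE Pi).
Qed.

Lemma Ck_det k E (U : set E) n (M : E -> 'M[R]_n) : open U ->
  (forall i j, Ck k U (fun x => M x i j)) -> Ck k U (fun x => \det (M x)).
Proof.
move=> oU CM; apply: Ck_sum => // s; apply: CkM => //; first exact: Ck_cst.
by apply: Ck_prod => // i; exact: CM.
Qed.

Lemma Ck_invmx k E (U : set E) n (M : E -> 'M[R]_n) i j : open U ->
  (forall x, U x -> M x \in unitmx) ->
  (forall i j, Ck k U (fun x => M x i j)) -> Ck k U (fun x => invmx (M x) i j).
Proof.
move=> oU uM CM.
pose f x := (\det (M x))^-1 * ((-1) ^+ (j + i) * \det (row' j (col' i (M x)))).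
apply: (@Ck_eq _ _ _ _ f) => //.
  by move=> x Ux; rewrite /invmx uM// !mxE /cofactor.
apply: CkM => //.
  apply: CkV => //; last exact: Ck_det.
  by move=> x /uM; rewrite unitmxE unitfE.
apply: CkM => //; first exact: Ck_cst.
apply: Ck_det => // a b; have := CM (lift j a) (lift i b); congr Ck.
by apply/funext => x; rewrite !mxE.
Qed.

End CkTheory.

(** * Operations on square-integrable controls *)

Section FiniteMeasure.
Context (R : realType).

Fact leb02pi_fin_num : fin_num_fun (leb02pi R).
Proof.
move=> U mU; rewrite ge0_fin_numE ?measure_ge0//.
apply: le_lt_trans (_ : (leb02pi R setT < +oo)%E).
  by apply: le_measure; rewrite ?inE.
by rewrite -ge0_fin_numE ?measure_ge0//; exact: leb02piT_fin.
Qed.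

(* Convertible to leb02pi, but known to be a finite measure. *)
Definition fleb02pi : set (measurableTypeR R) -> \bar R :=
  mrestr (@lebesgue_measure R) (measurable_itv `[0, 2 * pi]%R).
HB.instance Definition _ := Measure.on fleb02pi.
HB.instance Definition _ :=
  Measure_isFinite.Build _ _ _ fleb02pi leb02pi_fin_num.

Local Notation mu := (leb02pi R).

Lemma leb02pi_itv (a b : R) : a <= b -> (mu `[a, b]%classic <= (b - a)%:E)%E.
Proof.
move=> ab; apply: le_trans (_ : (lebesgue_measure `[a, b]%classic <= _)%E).
  by apply: le_measure; rewrite ?inE//; exact: measurableI.
rewrite lebesgue_measure_itv/= lte_fin; case: ifP => [_|]//.
by move=> _; rewrite lee_fin subr_ge0.
Qed.

Lemma leb02pi_sub_itv (a b : R) : 0 <= a -> a <= b -> b <= 2 * pi ->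
  mu `[a, b]%classic = (b - a)%:E.
Proof.
move=> a0 ab b2; rewrite /leb02pi/= /mrestr setIidl.
  rewrite lebesgue_measure_itv/= lte_fin; case: ltP => // ba.
  by congr EFin; apply/eqP; rewrite eq_sym subr_eq0 eq_le ba.
by apply: subset_itv; rewrite bnd_simp.
Qed.

Lemma ae_in02pi : {ae mu, forall t : R, 0 <= t <= 2 * pi}.
Proof.
exists (~` `[0, 2 * pi]%classic); split => //; first exact: measurableC.
by rewrite /leb02pi/= /mrestr setICl measure0.
Qed.

Lemma eq_Rintegral_ae (f g : R -> R) : measurable_fun setT f ->
  measurable_fun setT g -> f = g %[ae mu] -> \int[mu]_t f t = \int[mu]_t g t.
Proof.
move=> mf mg fg; congr fine; apply: ae_eq_integral => //.
- exact/measurable_EFinP.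
- exact/measurable_EFinP.
- by apply: filterS fg => t ft Dt; rewrite /= ft.
Qed.

Definition S2 (f : R -> R) : Prop := f \in Lfun mu 2%:E.

Lemma S2P (f : R -> R) : measurable_fun setT f ->
  mu.-integrable setT (EFin \o (fun t => f t ^+ 2)) -> S2 f.
Proof.
move=> mf /integrableP[_ intf]; rewrite /S2 inE; apply/andP; split; rewrite inE//=.
rewrite /finite_norm unlock/= poweR_lty//; apply: le_lt_trans intf.
rewrite le_eqVlt; apply/orP; left; apply/eqP; apply: eq_integral => t _ /=.
by rewrite powR_mulrn// -normrX.
Qed.

Lemma S2_measurable f : S2 f -> measurable_fun setT f.
Proof. by rewrite /S2 inE => /andP[]; rewrite inE. Qed.

Lemma S2_sqr f : S2 f -> mu.-integrable setT (EFin \o (fun t => f t ^+ 2)).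
Proof. exact: Lfun2_integrable_sqr. Qed.

Lemma S2M f g : S2 f -> S2 g -> mu.-integrable setT (EFin \o (fun t => f t * g t)).
Proof. by move=> Sf Sg; apply/Lfun1_integrable/Lfun2_mul_Lfun1. Qed.

Lemma S2_integrable f : S2 f -> mu.-integrable setT (EFin \o f).
Proof. by move=> Sf; apply/Lfun1_integrable/Lfun_subset12 => //; exact: leb02piT_fin. Qed.

Lemma S2_dominated (f g : R -> R) : measurable_fun setT f -> S2 g ->
  (forall t, `|f t| <= `|g t|) -> S2 f.
Proof.
move=> mf Sg fg; apply: S2P => //; apply: le_integrable (S2_sqr Sg) => //.
  by apply/measurable_EFinP; exact: measurable_funX.
by move=> t _; rewrite /= lee_fin !normrX lerXn2r// nnegrE.
Qed.

Lemma S2_cst (c : R) : S2 (cst c).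
Proof. exact: (@Lfun_cst _ _ _ fleb02pi). Qed.

Lemma S2_bounded (f : R -> R) M : measurable_fun setT f ->
  (forall t, `|f t| <= M) -> S2 f.
Proof.
by move=> mf fM; apply: S2_dominated mf (S2_cst M) _ => t; exact: le_trans (ler_norm _).
Qed.

Lemma S2_restrict D (f : R -> R) : measurable D -> S2 f -> S2 (f \_ D).
Proof.
move=> mD Sf; apply: S2_dominated (Sf) _.
  by apply/(measurable_restrictT _ mD); apply: measurable_funS (S2_measurable Sf).
by move=> t; rewrite patchE; case: ifP => // _; rewrite normr0.
Qed.

Lemma S2D f g : S2 f -> S2 g -> S2 (f \+ g).
Proof.
by move=> Sf Sg; have [_ H] := @Lfun_addr_closed _ _ _ mu 2%:E (lee1n 2); exact: H.
Qed.

Lemma S2Z a f : S2 f -> S2 (fun t => a * f t).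
Proof.
move=> Sf; rewrite (_ : (fun t => a * f t) = a \o* f).
  by apply: Lfun_scale => //; rewrite ler1n.
by apply/funext => t; rewrite /= mulrC.
Qed.

Definition mksq (f : R -> R) : sqint R :=
  if pselect (S2 f) is left Sf then Lfun_Sub (lee1n 2) Sf else 0.

Lemma mksqE f : S2 f -> mksq f = f :> (R -> R).
Proof. by rewrite /mksq; case: pselect. Qed.

End FiniteMeasure.

(** * Vector-valued controls: representatives, rank-one controls and cut-offs *)

Section Controls.
Context (R : realType) (d : nat).
Local Notation mu := (leb02pi R).
Local Notation H := (L2 R d).
Implicit Types (u v : H) (i j : 'I_d) (w : 'rV[R]_d) (f g : R -> R) (t s : R).

Lemma S2_L2fun u i : S2 (L2fun u i).
Proof. exact: LfunP. Qed.
Hint Resolve S2_L2fun : core.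

Lemma measurable_L2fun u i : measurable_fun setT (L2fun u i).
Proof. exact: S2_measurable. Qed.
Hint Resolve measurable_L2fun : core.

Lemma eq_L2 u v : (forall i, L2fun u i = L2fun v i %[ae mu]) -> u = v.
Proof. by move=> uv; rewrite -[u]reprK -[v]reprK; apply/pi_L2P => i; exact: uv. Qed.

Definition mkL2 (F : 'I_d -> R -> R) : H := \pi_(L2 R d) [ffun i => mksq (F i)].

Lemma L2fun_mk F i : (forall i, S2 (F i)) -> L2fun (mkL2 F) i = F i %[ae mu].
Proof.
move=> SF; apply: filterS (L2fun_pi [ffun i => mksq (F i)] i) => t h Dt.
by rewrite (h Dt) ffunE mksqE.
Qed.

Lemma L2funD u v i : L2fun (u + v) i = (L2fun u i \+ L2fun v i) %[ae mu].
Proof.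
have uvE : \pi_(L2 R d) (repr u + repr v) = u + v by rewrite pi_L2D !reprK.
by apply: filterS (L2fun_pi (repr u + repr v) i) => t h Dt; rewrite -uvE (h Dt) ffunE.
Qed.

Lemma L2funZ a u i : L2fun (a *: u) i = (fun t => a * L2fun u i t) %[ae mu].
Proof.
by apply: filterS (L2fun_pi (a *: (repr u : vsqint R d)) i) => t h Dt; rewrite (h Dt) ffunE.
Qed.

Lemma L2dot_mk F v : (forall i, S2 (F i)) ->
  L2dot (mkL2 F) v = \sum_i \int[mu]_t (F i t * L2fun v i t).
Proof.
move=> SF; apply: eq_bigr => i _; apply: eq_Rintegral_ae.
- exact: measurable_funM.
- by apply: measurable_funM => //; exact: S2_measurable.
by apply: filterS (L2fun_mk i SF) => t h Dt; rewrite h.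
Qed.

Lemma L2dot_sumr (I : Type) (r : seq I) (P : pred I) (F : I -> H) u :
  L2dot u (\sum_(a <- r | P a) F a) = \sum_(a <- r | P a) L2dot u (F a).
Proof.
have L0 : L2dot u 0 = 0 by rewrite -(scale0r (0 : H)) L2dotZr mul0r.
by elim/big_rec2: _ => // a x y _ <-; rewrite L2dotDr.
Qed.

Lemma L2norm_sqr u : `|u| ^+ 2 = L2dot u u.
Proof. by rewrite L2normE sqr_sqrtr// L2dot_ge0. Qed.

Lemma L2dot_le u v : `|L2dot u v| <= `|u| * `|v|.
Proof.
rewrite !L2normE -sqrtrM ?L2dot_ge0// -sqrtr_sqr; apply: ler_wsqrtr.
exact: L2dot_CS.
Qed.

Definition tens f w : H := mkL2 (fun i t => w 0 i * f t).

Lemma L2fun_tens f w i : S2 f -> L2fun (tens f w) i = (fun t => w 0 i * f t) %[ae mu].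
Proof. by move=> Sf; apply: (@L2fun_mk (fun i t => w 0 i * f t)) => j; exact: S2Z. Qed.

Lemma L2dot_tens f w v : S2 f ->
  L2dot (tens f w) v = \sum_i w 0 i * \int[mu]_t (f t * L2fun v i t).
Proof.
move=> Sf; rewrite L2dot_mk => [|i]; last exact: S2Z.
apply: eq_bigr => i _; rewrite -RintegralZl//; last exact: S2M.
by apply: eq_Rintegral => t _; rewrite mulrA.
Qed.

Lemma L2dot_tens_delta f j v : S2 f ->
  L2dot (tens f (delta_mx 0 j)) v = \int[mu]_t (f t * L2fun v j t).
Proof.
move=> Sf; rewrite L2dot_tens// (bigD1 j)//= !mxE !eqxx mul1r big1 ?addr0// => i ij.
by rewrite mxE (negbTE ij) mul0r.
Qed.

Lemma L2dot_tens2 f g w w' : S2 f -> S2 g ->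
  L2dot (tens f w) (tens g w') = (\sum_i w 0 i * w' 0 i) * \int[mu]_t (f t * g t).
Proof.
move=> Sf Sg; rewrite L2dot_tens// mulr_suml; apply: eq_bigr => i _.
rewrite -mulrA; congr (_ * _); rewrite -RintegralZl//; last exact: S2M.
apply: eq_Rintegral_ae.
- by apply: measurable_funM => //; exact: S2_measurable.
- by apply: measurable_funM => //; apply: measurable_funM; exact: S2_measurable.
by apply: filterS (L2fun_tens w' i Sg) => t h Dt; rewrite h// mulrCA.
Qed.

Lemma tensD f g w : S2 f -> S2 g -> tens (f \+ g) w = tens f w + tens g w.
Proof.
move=> Sf Sg; apply: eq_L2 => i.
apply: filterS (filterI (filterI (L2fun_tens w i (S2D Sf Sg)) (L2funD (tens f w) (tens g w) i))
  (filterI (L2fun_tens w i Sf) (L2fun_tens w i Sg))) => t [[h1 h2] [h3 h4]] Dt.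
by rewrite h1// h2// /= h3// h4// mulrDr.
Qed.

Lemma tensZ a f w : S2 f -> tens (fun t => a * f t) w = a *: tens f w.
Proof.
move=> Sf; apply: eq_L2 => i.
apply: filterS3 (L2fun_tens w i (S2Z a Sf)) (L2funZ a (tens f w) i)
  (L2fun_tens w i Sf) => t h1 h2 h3 Dt.
by rewrite h1// h2// h3// mulrCA.
Qed.

Lemma tens_linear f a w w' : S2 f ->
  tens f (a *: w + w') = a *: tens f w + tens f w'.
Proof.
move=> Sf; apply: eq_L2 => i.
apply: filterS (filterI (filterI (L2fun_tens (a *: w + w') i Sf)
    (L2funD (a *: tens f w) (tens f w') i)) (filterI (L2funZ a (tens f w) i)
  (filterI (L2fun_tens w i Sf) (L2fun_tens w' i Sf)))) => t [[h1 h2] [h3 [h4 h5]]] Dt.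
by rewrite h1// h2// !mxE mulrDl -mulrA /= h3// h4// h5.
Qed.

(** ** Cut-offs *)

Definition cutoff t u : H := mkL2 (fun i => L2fun u i \_ `[0, t]).

Lemma L2fun_cutoff t u i : L2fun (cutoff t u) i = (L2fun u i \_ `[0, t]) %[ae mu].
Proof. by apply: (@L2fun_mk (fun i => L2fun u i \_ `[0, t])) => j; exact: S2_restrict. Qed.

Lemma L2dot_cutoff t u v :
  L2dot (cutoff t u) v = \sum_i \int[mu]_(s in `[0, t]) (L2fun u i s * L2fun v i s).
Proof.
rewrite L2dot_mk => [|i]; last exact: S2_restrict.
apply: eq_bigr => i _; rewrite [RHS]Rintegral_mkcond; apply: eq_Rintegral => s _.
by rewrite !patchE; case: ifP => //; rewrite mul0r.
Qed.

Lemma L2dot_cutoffC t u v : L2dot (cutoff t u) v = L2dot u (cutoff t v).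
Proof.
rewrite [RHS]L2dotC !L2dot_cutoff; apply: eq_bigr => i _.
by apply: eq_Rintegral => s _; rewrite mulrC.
Qed.

Lemma cutoff_is_linear t : linear (cutoff t).
Proof.
move=> a u v; apply: eq_L2 => i.
apply: filterS (filterI (filterI (L2fun_cutoff t (a *: u + v) i)
  (filterI (L2funD (a *: cutoff t u) (cutoff t v) i) (L2funZ a (cutoff t u) i)))
  (filterI (filterI (L2fun_cutoff t u i) (L2fun_cutoff t v i))
  (filterI (L2funD (a *: u) v i) (L2funZ a u i)))).
move=> s [[h1 [h2 h3]] [[h4 h5] [h6 h7]]] Ds.
rewrite h1// h2//= h3// h4// h5// !patchE; case: ifP => _; last by rewrite mulr0 addr0.
by rewrite h6//= h7.
Qed.
HB.instance Definition _ t := GRing.isLinear.Build R H H _ (cutoff t) (cutoff_is_linear t).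

Lemma cutoff_cutoff s t u : cutoff s (cutoff t u) = cutoff (Num.min s t) u.
Proof.
apply: eq_L2 => i.
apply: filterS3 (L2fun_cutoff s (cutoff t u) i) (L2fun_cutoff t u i)
  (L2fun_cutoff (Num.min s t) u i) => r /(_ I) h1 /(_ I) h2 /(_ I) h3 _.
rewrite h1 h3 !patchE h2 patchE !mem_setE !in_itv/= le_min.
by case: (0 <= r); case: (r <= s); case: (r <= t).
Qed.

Lemma cutoff_id t u : 2 * pi <= t -> cutoff t u = u.
Proof.
move=> t2; apply: eq_L2 => i.
apply: filterS2 (L2fun_cutoff t u i) (ae_in02pi R) => s /(_ I) -> /andP[s0 s2] _.
by rewrite patchE ifT// mem_setE in_itv/= s0 (le_trans s2).
Qed.

Lemma cutoff_le0 t u : t <= 0 -> cutoff t u = 0.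
Proof.
move=> t0; apply: L2dot_eq0; rewrite L2dot_cutoff big1// => i _.
rewrite /Rintegral null_set_integral//.
  by apply: measurable_funTS; apply/measurable_EFinP; exact: measurable_funM.
apply/eqP; rewrite eq_le measure_ge0 andbT.
apply: le_trans (_ : (lebesgue_measure `[0%R, t]%classic <= _)%E).
  by apply: le_measure; rewrite ?inE//; exact: measurableI.
by rewrite lebesgue_measure_itv/= lte_fin ltNge t0.
Qed.

End Controls.

Section Controls2.
Context (R : realType) (d : nat).
Local Notation mu := (leb02pi R).
Local Notation H := (L2 R d).
Implicit Types (u v : H) (i j : 'I_d) (w : 'rV[R]_d) (f g : R -> R) (t s : R).
Local Hint Resolve S2_L2fun measurable_L2fun S2_cst : core.

Lemma integrable_EFinB f g : mu.-integrable setT (EFin \o f) ->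
  mu.-integrable setT (EFin \o g) ->
  mu.-integrable setT (EFin \o (fun r => f r - g r)).
Proof.
move=> fi gi; have := integrableB measurableT fi gi.
by congr integrable; apply/funext.
Qed.

Lemma integrable_EFinZ c f : mu.-integrable setT (EFin \o f) ->
  mu.-integrable setT (EFin \o (fun r => c * f r)).
Proof.
move=> fi; have := integrableZl measurableT c fi.
by congr integrable; apply/funext.
Qed.

Lemma L2dot0r u : L2dot u 0 = 0.
Proof. by rewrite -(scale0r (0 : H)) L2dotZr mul0r. Qed.

Lemma L2dotNr u v : L2dot u (- v) = - L2dot u v.
Proof. by rewrite -scaleN1r L2dotZr mulN1r. Qed.

Lemma L2dotBr u v v' : L2dot u (v - v') = L2dot u v - L2dot u v'.
Proof. by rewrite L2dotDr L2dotNr. Qed.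

Lemma cutoff_tens t f w : S2 f -> cutoff t (tens f w) = tens (f \_ `[0, t]%classic) w.
Proof.
move=> Sf; apply: eq_L2 => i.
have Sft : S2 (f \_ `[0, t]%classic) by exact: S2_restrict.
apply: filterS (filterI (L2fun_cutoff t (tens f w) i)
  (filterI (L2fun_tens w i Sf) (L2fun_tens w i Sft))) => s [h1 [h2 h3]] Ds.
by rewrite h1// h3// !patchE; case: ifP => _; rewrite ?mulr0// h2.
Qed.

Definition tail t u := u - cutoff t u.

Lemma tail_is_linear t : linear (tail t).
Proof. by move=> a u v; rewrite /tail linearP scalerBr opprD addrACA. Qed.
HB.instance Definition _ t := GRing.isLinear.Build R H H _ (tail t) (tail_is_linear t).

Lemma tail_tail t u : tail t (tail t u) = tail t u.
Proof. by rewrite /tail linearB/= cutoff_cutoff minxx subrr subr0. Qed.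

Lemma L2dot_tailC t u v : L2dot (tail t u) v = L2dot u (tail t v).
Proof. by rewrite L2dotC L2dotBr L2dotBr -[L2dot u (cutoff _ _)]L2dotC L2dotC L2dot_cutoffC L2dotC -L2dot_cutoffC L2dotC. Qed.

Lemma cutoff_tail s t u : cutoff s (tail t u) = tail t (cutoff s u).
Proof. by rewrite /tail linearB/= !cutoff_cutoff minC. Qed.

Lemma tail0 u : tail 0 u = u.
Proof. by rewrite /tail cutoff_le0// subr0. Qed.

Lemma norm_cutoff t u : `|cutoff t u| <= `|u|.
Proof.
have [->|cu0] := eqVneq (cutoff t u) 0; first by rewrite normr0.
rewrite -(@ler_pM2l _ `|cutoff t u|) ?normr_gt0// -expr2 L2norm_sqr L2dot_cutoffC cutoff_cutoff minxx.
by rewrite L2dotC (le_trans (ler_norm _))// L2dot_le.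
Qed.

Lemma tail_sqr t u : `|tail t u| ^+ 2 = L2dot u u - L2dot (cutoff t u) u.
Proof. by rewrite L2norm_sqr L2dot_tailC tail_tail L2dotBr [L2dot u (cutoff _ _)]L2dotC. Qed.

Lemma L2dot_cutoff_idem t u : L2dot (cutoff t u) (cutoff t u) = L2dot (cutoff t u) u.
Proof. by rewrite [LHS]L2dot_cutoffC cutoff_cutoff minxx L2dotC. Qed.

Lemma cutoff_sub_sqr s t u : s <= t ->
  `|cutoff t u - cutoff s u| ^+ 2 = L2dot (cutoff t u) u - L2dot (cutoff s u) u.
Proof.
move=> st; have -> : cutoff t u - cutoff s u = tail s (cutoff t u).
  by rewrite /tail cutoff_cutoff (min_idPl st).
rewrite tail_sqr L2dot_cutoff_idem cutoff_cutoff (min_idPl st); congr (_ - _).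
by rewrite -L2dot_cutoffC cutoff_cutoff minC (min_idPl st).
Qed.

(** Absolute continuity of the integral of |u|^2: the difference is an integral over ]s, t], small
    uniformly in the position of the interval. *)
Lemma cutoff_right_small u (e : R) : 0 < e -> exists2 dlt : R, 0 < dlt &
  forall s t, s <= t -> t - s < dlt -> L2dot (cutoff t u) u - L2dot (cutoff s u) u < e.
Proof.
move=> e0; pose g r := \sum_i L2fun u i r * L2fun u i r.
have intg : mu.-integrable setT (EFin \o g).
  rewrite (_ : EFin \o g = fun r => (\sum_i (L2fun u i r * L2fun u i r)%:E)%E).
    by apply: integrable_sum => // i _; exact: S2M.
  by apply/funext => r /=; rewrite sumEFin.
have dotE t : L2dot (cutoff t u) u = \int[mu]_r (g \_ `[0, t]%classic) r.
  have int0 i : mu.-integrable `[0, t] (fun r => (L2fun u i r * L2fun u i r)%:E).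
    by apply: (@integrableS _ _ _ _ setT) => //; exact: S2M.
  rewrite L2dot_cutoff -Rintegral_mkcond; apply: EFin_inj.
  rewrite -sumEFin [RHS]fineK; last first.
    by apply: integrable_fin_num => //; exact: integrableS intg.
  rewrite (_ : (fun r => (g r)%:E) = fun r => (\sum_i (L2fun u i r * L2fun u i r)%:E)%E).
    rewrite integral_sum//; apply: eq_bigr => i _.
    by rewrite fineK//; exact: integrable_fin_num.
  by apply/funext => r /=; rewrite sumEFin.
have [dlt [dlt0 small]] := integral_normr_continuous intg e0.
exists dlt => // s t st tsd; rewrite !dotE.
have intr D : measurable D -> mu.-integrable setT (EFin \o (g \_ D)).
  by move=> mD; rewrite -restrict_EFin; apply/integrable_restrict => //; rewrite setTI; exact: integrableS intg.
rewrite -RintegralB//; [|exact: intr|exact: intr].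
apply: le_lt_trans (small `[s, t]%classic _ _) => //.
  rewrite [leRHS]Rintegral_mkcond; apply: le_Rintegral => //.
  - by apply: integrable_EFinB; exact: intr.
  - rewrite -restrict_EFin; apply/integrable_restrict => //; rewrite setTI.
    by apply: (@integrableS _ _ _ _ setT) => //; exact: integrable_abse intg.
  move=> r _; rewrite !patchE !mem_setE !in_itv/=.
  have g0 : 0 <= g r by apply: sumr_ge0 => i _; rewrite -expr2 sqr_ge0.
  rewrite (ger0_norm g0).
  case: (ltP r s) => [rs|sr].
    by rewrite (ltW rs) (le_trans (ltW rs) st) andbT/= subrr.
  case: (leP 0 r) => [r0|r0] /=; last by rewrite subr0; case: ifP.
  case: (leP r t) => rt /=; last by rewrite sub0r; case: ifP; rewrite ?oppr0// oppr_le0.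
  by case: ifP => _; rewrite ?subrr// subr0.
by apply: le_lt_trans (leb02pi_itv st) _; rewrite lte_fin.
Qed.

(** [cutoff t] is not continuous in t for the operator norm. The variation in t is therefore
    estimated at the fixed control u, and the variation in u by the fact that cut-offs are
    contractions. *)
Lemma cutoff_continuous : continuous (fun z : H * R => cutoff z.2 z.1).
Proof.
move=> [u t]; apply/cvgrPdist_lt => e e0.
have e20 : 0 < (e / 2) ^+ 2 by rewrite exprn_gt0// divr_gt0.
have [dlt dlt0 small] := cutoff_right_small u e20.
have e2 : 0 < e / 2 by rewrite divr_gt0.
have nt : \forall z \near (u, t), `|t - z.2| < dlt.
  have /cvgrPdist_lt/(_ _ dlt0) : (fun z : H * R => z.2) @ (u, t) --> t by exact: cvg_snd.
  by [].
have nu : \forall z \near (u, t), `|u - z.1| < e / 2.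
  have /cvgrPdist_lt/(_ _ e2) : (fun z : H * R => z.1) @ (u, t) --> u by exact: cvg_fst.
  by [].
near=> z => /=.
have -> : cutoff t u - cutoff z.2 z.1 = (cutoff t u - cutoff z.2 u) + cutoff z.2 (u - z.1).
  by rewrite linearB/= addrA subrK.
apply: le_lt_trans (ler_normD _ _) _; rewrite [e]splitr; apply: ltrD.
  rewrite -(@ltr_pXn2r _ 2)// ?nnegrE ?normr_ge0 ?(ltW e2)//.
  have tz : `|t - z.2| < dlt by near: z.
  have [zt|tz'] := leP z.2 t.
    rewrite cutoff_sub_sqr//; apply: small => //.
    by rewrite -(ger0_norm (_ : 0 <= t - z.2))// subr_ge0.
  rewrite distrC cutoff_sub_sqr; last exact: ltW.
  apply: small; first exact: ltW.
  by rewrite -(gtr0_norm (_ : 0 < z.2 - t)) ?subr_gt0// distrC.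
apply: le_lt_trans (norm_cutoff _ _) _.
by near: z.
Unshelve. all: by end_near. Qed.

(** ** First integrals and their pairing *)

Definition Lint u : 'rV[R]_d := \row_i \int[mu]_t L2fun u i t.

Lemma LintE u i : Lint u 0 i = L2dot (tens (cst 1) (delta_mx 0 i)) u.
Proof.
by rewrite mxE L2dot_tens_delta//; apply: eq_Rintegral => t _; rewrite mul1r.
Qed.

Lemma Lint_is_linear : linear Lint.
Proof.
move=> a u v; apply/rowP => i; rewrite ![RHS]mxE !LintE L2dotDr L2dotZr.
by rewrite -!LintE !mxE.
Qed.
HB.instance Definition _ := GRing.isLinear.Build R H 'rV[R]_d _ Lint Lint_is_linear.

Lemma positionE u t : position u t = Lint (cutoff t u).
Proof.
apply/rowP => i; rewrite !mxE [LHS]Rintegral_mkcond; apply: eq_Rintegral_ae.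
- by apply: S2_measurable; exact: S2_restrict.
- exact: S2_measurable.
by apply: filterS (L2fun_cutoff t u i) => s h Ds; rewrite h.
Qed.

Lemma position_linear a u v t : position (a *: u + v) t = a *: position u t + position v t.
Proof. by rewrite !positionE !linearP. Qed.

Lemma position2pi u : position u (2 * pi) = Lint u.
Proof. by rewrite positionE cutoff_id. Qed.

Definition prim u i t := position u t 0 i.

Lemma S2_prim u i : S2 (prim u i).
Proof.
have [M [Mr Mb]] := position_bounded u i.
apply: (@S2_bounded _ _ (M + 1)); first exact: measurable_position.
by move=> t; apply: (Mb (M + 1)) => //; rewrite ltrDl.
Qed.
Hint Resolve S2_prim : core.

(** The iterated integral of u_i(s) v_j(t) over s <= t; everything about the vertical coordinates is
    a linear combination of these. *)
Definition pairing i j u v : R := \int[mu]_t (prim u i t * L2fun v j t).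

Lemma pairingE i j u v : pairing i j u v = L2dot (tens (prim u i) (delta_mx 0 j)) v.
Proof. by rewrite L2dot_tens_delta. Qed.

Lemma primP i a u v t : prim (a *: u + v) i t = a * prim u i t + prim v i t.
Proof. by rewrite /prim position_linear !mxE. Qed.

Lemma pairingPl i j a u u' v :
  pairing i j (a *: u + u') v = a * pairing i j u v + pairing i j u' v.
Proof.
rewrite !pairingE -L2dotZl -L2dotDl; congr (L2dot _ v).
rewrite -tensZ// -tensD//; last exact: S2Z.
by congr tens; apply/funext => t; rewrite primP.
Qed.

Lemma pairingPr i j a u v v' :
  pairing i j u (a *: v + v') = a * pairing i j u v + pairing i j u v'.
Proof. by rewrite !pairingE L2dotDr L2dotZr. Qed.

Lemma tail_cst_sqr t i : 0 <= t -> t <= 2 * pi ->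
  `|tail t (tens (cst 1) (delta_mx 0 i))| ^+ 2 = 2 * pi - t.
Proof.
move=> t0 t2; rewrite tail_sqr cutoff_tens// !L2dot_tens2//; last exact: S2_restrict.
have -> : \sum_k (delta_mx 0 i : 'rV[R]_d) 0 k * (delta_mx 0 i : 'rV[R]_d) 0 k = 1.
  rewrite (bigD1 i)//= big1 => [|k ki]; rewrite !mxE ?eqxx ?mulr1 ?addr0//.
  by rewrite (negbTE ki) mulr0.
rewrite !mul1r; congr (_ - _).
  rewrite (@eq_Rintegral _ _ _ _ _ (cst 1))// => [|s _]; last by rewrite mulr1.
  rewrite Rintegral_cst// mul1r.
  have -> : mu setT = mu `[0, 2 * pi]%classic.
    by rewrite /leb02pi/= /mrestr setTI setIid.
  by rewrite leb02pi_sub_itv ?mulr_ge0 ?pi_ge0//= subr0.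
transitivity (\int[mu]_(s in `[0, t]) 1).
  rewrite [RHS]Rintegral_mkcond; apply: eq_Rintegral => s _.
  by rewrite !patchE; case: ifP; rewrite ?mulr1 ?mulr0 ?mul0r.
by rewrite Rintegral_cst// mul1r leb02pi_sub_itv//= subr0.
Qed.

Lemma Lint_tail_le t u i : 0 <= t -> t <= 2 * pi ->
  `|Lint (tail t u) 0 i| <= Num.sqrt (2 * pi - t) * `|tail t u|.
Proof.
move=> t0 t2; rewrite LintE -(tail_tail t u) -L2dot_tailC (le_trans (L2dot_le _ _))//.
rewrite tail_tail -(tail_cst_sqr i t0 t2) sqrtr_sqr normr_id //.
Qed.

(** By Cauchy-Schwarz the primitive of the tail is at most sqrt(2 pi - t) |tail t u|, and pairing it
    with v on an interval of length 2 pi - t gives a second factor sqrt(2 pi - t). *)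
Lemma pairing_tail_le t u v i j : 0 <= t -> t <= 2 * pi ->
  `|pairing i j (tail t u) (tail t v)| <= (2 * pi - t) * `|tail t u| * `|tail t v|.
Proof.
move=> t0 t2; set M := Num.sqrt (2 * pi - t) * `|tail t u|.
have pM s : `|prim (tail t u) i s| <= M.
  rewrite /prim positionE cutoff_tail (le_trans (Lint_tail_le _ _ t0 t2))//.
  by rewrite ler_wpM2l ?sqrtr_ge0// -cutoff_tail norm_cutoff.
rewrite pairingE -(tail_tail t v) -L2dot_tailC (le_trans (L2dot_le _ _))//.
rewrite tail_tail ler_wpM2r//.
set p := prim _ _ in pM *.
have Sp : S2 p by exact: S2_prim.
rewrite -(@ler_pXn2r _ 2)// ?nnegrE ?mulr_ge0 ?subr_ge0//.
rewrite tail_sqr cutoff_tens// !L2dot_tens_delta//; last exact: S2_restrict.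
have Spt : S2 (p \_ `[0, t]%classic) by exact: S2_restrict.
have tE f : S2 f -> \int[mu]_s (f s * L2fun (tens p (delta_mx 0 j)) j s) = \int[mu]_s (f s * p s).
  move=> Sf; apply: eq_Rintegral_ae.
  - by apply: measurable_funM => //; exact: S2_measurable.
  - by apply: measurable_funM; exact: S2_measurable.
  by apply: filterS (L2fun_tens (delta_mx 0 j) j Sp) => s h Ds; rewrite h// mxE !eqxx mul1r.
rewrite !tE//.
have -> : ((2 * pi - t) * `|tail t u|) ^+ 2 = M ^+ 2 * (2 * pi - t).
  have q2 : Num.sqrt (2 * pi - t) ^+ 2 = 2 * pi - t by rewrite sqr_sqrtr ?subr_ge0.
  by rewrite /M !exprMn q2; ring.
rewrite -(tail_cst_sqr j t0 t2) tail_sqr cutoff_tens// !L2dot_tens2//; last exact: S2_restrict.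
have -> : \sum_k (delta_mx 0 j : 'rV[R]_d) 0 k * (delta_mx 0 j : 'rV[R]_d) 0 k = 1.
  rewrite (bigD1 j)//= big1 => [|k ki]; rewrite !mxE ?eqxx ?mulr1 ?addr0//.
  by rewrite (negbTE ki) mulr0.
have S1t : S2 ((cst 1 : R -> R) \_ `[0, t]%classic) by exact: S2_restrict.
have S1 : S2 (cst 1 : R -> R) by [].
have S11 := S2M S1 S1; have S1t1 := S2M S1t S1.
rewrite !mul1r -!RintegralB//; [|exact: S2M|exact: S2M].
rewrite -RintegralZl//; last exact: integrable_EFinB.
apply: le_Rintegral => //.
- by apply: integrable_EFinB; exact: S2M.
- by apply: integrable_EFinZ; exact: integrable_EFinB.
move=> s _; rewrite !patchE; case: ifP => _; rewrite ?subrr ?mulr0// !mul0r !subr0 !mulr1.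
by rewrite -expr2 -(real_normK (num_real (p s))) lerXn2r// nnegrE (le_trans _ (pM s)).
Qed.

(** Where [tail t v] lives, the primitive of [cutoff t u] has already reached its final value. *)
Lemma pairing_cutoff_tail i j t u v : 0 <= t ->
  pairing i j (cutoff t u) (tail t v) = Lint (cutoff t u) 0 i * Lint (tail t v) 0 j.
Proof.
move=> t0; rewrite [Lint (tail t v) 0 j]mxE -RintegralZl//; last exact: S2_integrable.
apply: eq_Rintegral_ae.
- by apply: measurable_funM => //; exact: S2_measurable.
- by apply: measurable_funM => //; exact: S2_measurable.
apply: filterS (filterI (ae_in02pi R) (filterI (L2funD v (- 1 *: cutoff t v) j)
  (filterI (L2funZ (-1) (cutoff t v) j) (L2fun_cutoff t v j)))) => s [/andP[s0 _] [h1 [h2 h3]]] Ds.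
rewrite /tail -scaleN1r h1//= h2// h3// patchE mem_setE in_itv/= s0/=.
have [st|ts] := leP s t; first by rewrite mulN1r subrr !mulr0.
by rewrite /prim positionE cutoff_cutoff (min_idPr (ltW ts)).
Qed.

Lemma pairing_tail_cutoff i j t u v : 0 <= t -> pairing i j (tail t u) (cutoff t v) = 0.
Proof.
move=> t0; transitivity (\int[mu]_s (cst 0 s : R)); last first.
  by rewrite Rintegral_cst// mul0r.
apply: eq_Rintegral_ae => //.
- by apply: measurable_funM => //; exact: S2_measurable.
apply: filterS (filterI (ae_in02pi R) (L2fun_cutoff t v j)) => s [/andP[s0 _] h] Ds.
rewrite h// patchE mem_setE in_itv/= s0/=.
have [st|ts] := leP s t; last by rewrite mulr0.
by rewrite /prim positionE cutoff_tail /tail cutoff_cutoff minC (min_idPl st) subrr linear0 mxE mul0r.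
Qed.

End Controls2.

(** * Integration by parts for iterated integrals *)

Section ByParts.
Context (R : realType) (d : nat).
Local Notation mu := (leb02pi R).
Local Notation fmu := (@fleb02pi R).
Local Notation H := (L2 R d).
Implicit Types (u v : H) (i j : 'I_d) (w : 'rV[R]_d) (f g : R -> R) (t s : R).
Local Hint Resolve S2_L2fun measurable_L2fun S2_cst S2_prim : core.

Let K f g : R * R -> \bar R := fun z => (if z.1 <= z.2 then f z.1 * g z.2 else 0)%:E.

Let measurable_K f g : S2 f -> S2 g ->
  measurable_fun setT (K f g : measurableTypeR R * measurableTypeR R -> \bar R).
Proof.
move=> Sf Sg; apply/measurable_EFinP; apply: measurable_fun_ifT => //=.
- by apply: measurable_fun_ler; [exact: measurable_fst|exact: measurable_snd].
- apply: measurable_funM.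
    by apply: measurableT_comp; [exact: S2_measurable|exact: measurable_fst].
  by apply: measurableT_comp; [exact: S2_measurable|exact: measurable_snd].
Qed.

Let integrable_K f g : S2 f -> S2 g ->
  (fmu \x fmu)%E.-integrable setT (K f g : measurableTypeR R * measurableTypeR R -> \bar R).
Proof.
move=> Sf Sg; have mK := measurable_K Sf Sg.
apply: (@integrable12ltyP _ _ _ _ R fmu fmu _ mK).2.
have /integrableP[mf intf] := S2_integrable Sf.
have /integrableP[mg intg] := S2_integrable Sg.
apply: (@le_lt_trans _ _ (\int[fmu]_s (`|(f s)%:E| * \int[mu]_t `|(g t)%:E|))%E).
  apply: ge0_le_integral => //.
  - by move=> s _; exact: integral_ge0.
  - have mKa : measurable_fun setT (abse \o (K f g : measurableTypeR R * measurableTypeR R -> \bar R)).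
      exact: measurableT_comp.
    exact: (@measurable_fun_fubini_tonelli_F _ _ _ _ R fmu _ mKa (fun z => abse_ge0 _)).
  - by apply: emeasurable_funM => //; exact: measurableT_comp.
  move=> s _; rewrite -ge0_integralZl//; last exact: measurableT_comp.
  apply: ge0_le_integral => //.
  - apply: measurableT_comp => //.
    exact: (measurableT_comp mK (measurable_pair1 s)).
  - by apply: measurable_funeM; exact: measurableT_comp.
  by move=> t _; rewrite /K/=; case: ifP => _; rewrite ?normrM// normr0 lee_fin mulr_ge0.
rewrite ge0_integralZr//; [|exact: measurableT_comp|exact: integral_ge0].
rewrite lte_mul_pinfty// ?integral_ge0// ge0_fin_numE ?integral_ge0//.
Qed.

Let measurable_leR t : measurable_fun setT (fun s : R => s <= t).
Proof. exact: (@measurable_fun_ler _ _ _ _ id (cst t)). Qed.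

Let measurable_leL t : measurable_fun setT (fun s : R => t <= s).
Proof. exact: (@measurable_fun_ler _ _ _ _ (cst t) id). Qed.

Let measurable_heaviside u i t :
  measurable_fun setT (fun s => if s <= t then L2fun u i s else 0).
Proof.
apply: measurable_fun_ifT; [exact: measurable_leR|exact: measurable_L2fun|].
exact: measurable_cst.
Qed.

Let measurable_coheaviside u i t :
  measurable_fun setT (fun s => if t <= s then L2fun u i s else 0).
Proof.
apply: measurable_fun_ifT; [exact: measurable_leL|exact: measurable_L2fun|].
exact: measurable_cst.
Qed.

Lemma prim_heaviside u i t :
  \int[mu]_s (if s <= t then L2fun u i s else 0) = prim u i t.
Proof.
rewrite /prim /position mxE [RHS]Rintegral_mkcond; apply: eq_Rintegral_ae.
- exact: measurable_heaviside.
- by apply: S2_measurable; exact: S2_restrict.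
apply: filterS (ae_in02pi R) => s /andP[s0 _] _.
by rewrite patchE mem_setE in_itv/= s0.
Qed.

Lemma prim_coheaviside u i s :
  \int[mu]_t (if s <= t then L2fun u i t else 0) = Lint u 0 i - prim u i s.
Proof.
rewrite -prim_heaviside mxE -RintegralB//; last 2 first.
- exact: S2_integrable.
- apply: S2_integrable; apply: S2_dominated (S2_L2fun u i) _.
    first [exact: measurable_heaviside|exact: measurable_coheaviside].
  by move=> t; case: ifP; rewrite ?normr0.
apply: eq_Rintegral_ae.
- first [exact: measurable_heaviside|exact: measurable_coheaviside].
- by apply: measurable_funB; [exact: measurable_L2fun|exact: measurable_heaviside].
(* The half-lines t <= s and s <= t overlap at s, a null set. *)
have ns : {ae mu, forall t : R, t != s}.
  exists [set s]; split => //.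
    apply/eqP; rewrite eq_le measure_ge0 andbT.
    by have := leb02pi_itv (lexx s); rewrite subrr set_itv1.
  by move=> t /= /negP/negPn/eqP.
apply: filterS ns => t ts _.
have [st|ts'] := leP s t; first by rewrite leNgt lt_neqAle st eq_sym ts/= subr0.
by rewrite (ltW ts') subrr.
Qed.

(** Fubini for u_i(s) v_j(t) on the triangle s <= t: integrating first in s gives [pairing i j u v],
    integrating first in t gives the product of the total integrals minus [pairing j i v u]. *)
Lemma pairing_by_parts i j u v :
  pairing i j u v + pairing j i v u = Lint u 0 i * Lint v 0 j.
Proof.
set f := L2fun u i; set g := L2fun v j.
have Sf : S2 f by exact: S2_L2fun.
have Sg : S2 g by exact: S2_L2fun.
have := Fubini (integrable_K Sf Sg).
have Kl s : (\int[fmu]_t K f g (s, t) = (f s * (Lint v 0 j - prim v j s))%:E)%E.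
  rewrite -prim_coheaviside -RintegralZl//; last first.
    apply: S2_integrable; apply: S2_dominated Sg _.
      first [exact: measurable_heaviside|exact: measurable_coheaviside].
    by move=> t; case: ifP; rewrite ?normr0.
  rewrite fineK; last first.
    apply: integrable_fin_num => //; apply: S2_integrable.
    apply: S2Z; apply: S2_dominated Sg _.
      first [exact: measurable_heaviside|exact: measurable_coheaviside].
    by move=> t; case: ifP; rewrite ?normr0.
  by apply: eq_integral => t _; rewrite /K/=; case: ifP; rewrite ?mulr0.
have Kr t : (\int[fmu]_s K f g (s, t) = (prim u i t * g t)%:E)%E.
  rewrite mulrC -prim_heaviside -RintegralZl//; last first.
    apply: S2_integrable; apply: S2_dominated Sf _.
      first [exact: measurable_heaviside|exact: measurable_coheaviside].
    by move=> s; case: ifP; rewrite ?normr0.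
  rewrite fineK; last first.
    apply: integrable_fin_num => //; apply: S2_integrable.
    apply: S2Z; apply: S2_dominated Sf _.
      first [exact: measurable_heaviside|exact: measurable_coheaviside].
    by move=> s; case: ifP; rewrite ?normr0.
  by apply: eq_integral => s _; rewrite /K/=; case: ifP; rewrite ?mulr0// mulrC.
rewrite (funext Kl) (funext Kr).
move=> /(congr1 fine) Hf.
have {Hf}<- : \int[mu]_s (f s * (Lint v 0 j - prim v j s)) = pairing i j u v := Hf.
rewrite [LHS](_ : _ = \int[mu]_s (f s * Lint v 0 j - f s * prim v j s) + pairing j i v u); last first.
  by congr (_ + _); apply: eq_Rintegral => s _; rewrite mulrBr.
rewrite RintegralB//; last 2 first.
- by apply: S2M => //; exact: (S2_cst (Lint v 0 j)).
- exact: S2M.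
have -> : pairing j i v u = \int[mu]_s (f s * prim v j s).
  by apply: eq_Rintegral => s _; rewrite mulrC.
rewrite subrK RintegralZr//; last exact: S2_integrable.
by rewrite [Lint u 0 i]mxE.
Qed.

End ByParts.

(** * The end-point map *)

Section Area.
Context (R : realType) (d : nat).
Local Notation mu := (leb02pi R).
Local Notation H := (L2 R d).
Implicit Types (u v : H) (i j : 'I_d) (w x y : 'rV[R]_d) (f g : R -> R) (t s : R).
Implicit Types (M : 'M[R]_d).
Local Hint Resolve S2_L2fun measurable_L2fun S2_cst S2_prim : core.

Definition omega M x y : R := \sum_i \sum_j M i j * (x 0 i * y 0 j).

(** A bilinear, in general not symmetric, form whose diagonal is a vertical coordinate of the
    end-point map. On concatenations it produces the cocycle [omega] of the group law. *)
Definition area M u v : R := 1 / 2 * \sum_i \sum_j M i j * pairing i j u v.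

Lemma omegaPl M a x x' y : omega M (a *: x + x') y = a * omega M x y + omega M x' y.
Proof.
rewrite /omega mulr_sumr -big_split; apply: eq_bigr => i _ /=.
rewrite mulr_sumr -big_split; apply: eq_bigr => j _ /=.
by rewrite !mxE; ring.
Qed.

Lemma omegaDl M x x' y : omega M (x + x') y = omega M x y + omega M x' y.
Proof. by have := omegaPl M 1 x x' y; rewrite scale1r mul1r. Qed.

Lemma omega0r M x : omega M x 0 = 0.
Proof. by rewrite /omega big1// => i _; rewrite big1// => j _; rewrite mxE !mulr0. Qed.

Lemma omegaE M x y : omega M x y = (x *m (M *m y^T)) 0 0.
Proof.
rewrite mxE; apply: eq_bigr => i _; rewrite [(_ *m _) i 0]mxE mulr_sumr.
by apply: eq_bigr => j _; rewrite mxE; ring.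
Qed.

Lemma omega_delta M i j a b :
  omega M (a *: delta_mx 0 i) (b *: delta_mx 0 j) = a * b * M i j.
Proof.
rewrite omegaE linearZ/= -!scalemxAr -scalemxAl trmx_delta -colE -rowE !mxE.
by ring.
Qed.

Section Skew.
Variable M : 'M[R]_d.
Hypothesis skewM : M^T = - M.

Let skewE i j : M j i = - M i j.
Proof. by have := congr1 (fun N : 'M[R]_d => N i j) skewM; rewrite !mxE. Qed.

Lemma skew_sum (F : 'I_d -> 'I_d -> R) :
  \sum_i \sum_j M i j * F i j = - \sum_i \sum_j M i j * F j i.
Proof.
rewrite exchange_big/= -sumrN; apply: eq_bigr => j _; rewrite -sumrN.
by apply: eq_bigr => i _; rewrite skewE mulNr.
Qed.

Lemma skew_sum_sym (F : 'I_d -> 'I_d -> R) : (forall i j, F i j = F j i) ->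
  \sum_i \sum_j M i j * F i j = 0.
Proof.
move=> symF; set S := \sum_i _; suff : S = - S by lra.
rewrite {1}/S skew_sum; congr (- _); apply: eq_bigr => i _.
by apply: eq_bigr => j _; rewrite symF.
Qed.

Lemma omega_skew x y : omega M y x = - omega M x y.
Proof.
rewrite /omega skew_sum; congr (- _); apply: eq_bigr => i _.
by apply: eq_bigr => j _; rewrite [y 0 _ * _]mulrC.
Qed.

Lemma area_by_parts u v : Lint v = 0 ->
  area M v u = 1 / 2 * \sum_i \sum_j M i j * pairing i j u v.
Proof.
move=> v0; rewrite /area skew_sum; congr (_ * _).
rewrite -sumrN; apply: eq_bigr => i _; rewrite -sumrN; apply: eq_bigr => j _.
have := pairing_by_parts i j u v; rewrite v0 [(0 : 'rV_d) 0 j]mxE mulr0 => /eqP.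
by rewrite addr_eq0 => /eqP ->; rewrite mulrN.
Qed.

(** The curve stays on the line spanned by w, so its iterated integrals are symmetric in i and j,
    and M is skew. *)
Lemma area_tens f w : S2 f -> area M (tens f w) (tens f w) = 0.
Proof.
move=> Sf; rewrite /area.
have mt i t : prim (tens f w) i t = w 0 i * \int[mu]_(s in `[0, t]) f s.
  rewrite /prim mxE -RintegralZl//; last first.
    by apply: (@integrableS _ _ _ _ setT) => //; exact: S2_integrable.
  rewrite [LHS]Rintegral_mkcond [RHS]Rintegral_mkcond; apply: eq_Rintegral_ae.
  - by apply: S2_measurable; exact: S2_restrict.
  - by apply: S2_measurable; apply: S2_restrict => //; exact: S2Z.
  by apply: filterS (L2fun_tens w i Sf) => s h Ds; rewrite !patchE h.
have pE i j : pairing i j (tens f w) (tens f w) =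
    \int[mu]_t (w 0 i * (w 0 j * (\int[mu]_(s in `[0, t]) f s * f t))).
  apply: eq_Rintegral_ae.
  - by apply: measurable_funM => //; exact: S2_measurable.
  - rewrite (_ : (fun t => _) = (fun t => prim (tens f w) i t * (w 0 j * f t))).
      by apply: measurable_funM; apply: S2_measurable => //; exact: S2Z.
    by apply/funext => t; rewrite mt; ring.
  by apply: filterS (L2fun_tens w j Sf) => s h Ds; rewrite h// mt; ring.
rewrite skew_sum_sym ?mulr0// => i j; rewrite !pE.
by apply: eq_Rintegral => t _; ring.
Qed.

End Skew.

Lemma areaPl M a u u' v : area M (a *: u + u') v = a * area M u v + area M u' v.
Proof.
rewrite /area mulrCA -mulrDr; congr (_ * _); rewrite mulr_sumr -big_split.
apply: eq_bigr => i _ /=; rewrite mulr_sumr -big_split; apply: eq_bigr => j _ /=.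
by rewrite pairingPl; ring.
Qed.

Lemma areaPr M a u v v' : area M u (a *: v + v') = a * area M u v + area M u v'.
Proof.
rewrite /area mulrCA -mulrDr; congr (_ * _); rewrite mulr_sumr -big_split.
apply: eq_bigr => i _ /=; rewrite mulr_sumr -big_split; apply: eq_bigr => j _ /=.
by rewrite pairingPr; ring.
Qed.

Lemma areaDl M u u' v : area M (u + u') v = area M u v + area M u' v.
Proof. by have := areaPl M 1 u u' v; rewrite scale1r mul1r. Qed.

Lemma areaDr M u v v' : area M u (v + v') = area M u v + area M u v'.
Proof. by have := areaPr M 1 u v v'; rewrite scale1r mul1r. Qed.

Lemma area0l M v : area M 0 v = 0.
Proof. by have := areaDl M 0 0 v; rewrite addr0 => /eqP; rewrite -subr_eq0 opprD addrA subrr sub0r oppr_eq0 => /eqP. Qed.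

Lemma area0r M u : area M u 0 = 0.
Proof. by have := areaDr M u 0 0; rewrite addr0 => /eqP; rewrite -subr_eq0 opprD addrA subrr sub0r oppr_eq0 => /eqP. Qed.

Lemma areaZl M a u v : area M (a *: u) v = a * area M u v.
Proof. by rewrite -[a *: u]addr0 areaPl area0l addr0. Qed.

Lemma areaZr M a u v : area M u (a *: v) = a * area M u v.
Proof. by rewrite -[a *: v]addr0 areaPr area0r addr0. Qed.

Lemma area_cutoff_tail M t u v : 0 <= t ->
  area M (cutoff t u) (tail t v) = 1 / 2 * omega M (Lint (cutoff t u)) (Lint (tail t v)).
Proof.
move=> t0; congr (_ * _); apply: eq_bigr => i _; apply: eq_bigr => j _.
by rewrite pairing_cutoff_tail.
Qed.

Lemma area_tail_cutoff M t u v : 0 <= t -> area M (tail t u) (cutoff t v) = 0.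
Proof.
move=> t0; rewrite /area big1 ?mulr0// => i _; rewrite big1// => j _.
by rewrite pairing_tail_cutoff ?mulr0.
Qed.

(* The group law of the Carnot group: concatenation of the curve of u up to time
   t with the curve of v from time t on. *)
Lemma area_concat M t u v : 0 <= t ->
  area M (cutoff t u + tail t v) (cutoff t u + tail t v) =
  area M (cutoff t u) (cutoff t u) + area M (tail t v) (tail t v) +
  1 / 2 * omega M (Lint (cutoff t u)) (Lint (tail t v)).
Proof.
move=> t0; rewrite (areaDl M (cutoff t u) (tail t v)).
rewrite !(areaDr M _ (cutoff t u) (tail t v)) area_cutoff_tail// area_tail_cutoff//.
by rewrite add0r [RHS]addrAC.
Qed.

Definition mx_norm1 M := \sum_i \sum_j `|M i j|.

Lemma area_tail_le M t u v : 0 <= t -> t <= 2 * pi ->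
  `|area M (tail t u) (tail t v)| <= mx_norm1 M * ((2 * pi - t) * `|tail t u| * `|tail t v|).
Proof.
move=> t0 t2; rewrite /area normrM.
have -> : `|1 / 2 : R| = 1 / 2 by rewrite ger0_norm// divr_ge0.
set c := _ * `|tail t v|.
have c0 : 0 <= c by rewrite !mulr_ge0// subr_ge0.
have le1 : `|\sum_i \sum_j M i j * pairing i j (tail t u) (tail t v)| <= mx_norm1 M * c.
  rewrite (le_trans (ler_norm_sum _ _ _))// /mx_norm1 mulr_suml ler_sum// => i _.
  rewrite (le_trans (ler_norm_sum _ _ _))// mulr_suml ler_sum// => j _.
  by rewrite normrM ler_wpM2l// pairing_tail_le.
apply: le_trans le1; rewrite -[leRHS]mul1r ler_wpM2r//.
by lra.
Qed.

Lemma area_le M u v : `|area M u v| <= mx_norm1 M * (2 * pi) * `|u| * `|v|.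
Proof.
have := @area_tail_le M 0 u v (lexx _); rewrite !tail0 subr0 !mulrA; apply.
by rewrite mulr_ge0 ?pi_ge0.
Qed.

Lemma endpointE l (A : l.-tuple 'M[R]_d) u :
  endpoint A u = (Lint u, \row_k area (tnth A k) u u).
Proof.
rewrite /endpoint /trajectory position2pi; congr pair; apply/rowP => k; rewrite !mxE.
congr (_ * _); rewrite Rintegral_mkcond.
have intp i j : mu.-integrable setT (EFin \o (fun s => prim u i s * L2fun u j s)).
  exact: S2M.
have intF i j : mu.-integrable setT
    (EFin \o (fun s => tnth A k i j * (prim u i s * L2fun u j s))).
  exact: integrable_EFinZ.
transitivity (\int[mu]_s (\sum_i \sum_j tnth A k i j * (prim u i s * L2fun u j s))).
  have E s : (position u s *m (tnth A k *m (control u s)^T)) 0 0 =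
      \sum_i \sum_j tnth A k i j * (prim u i s * L2fun u j s).
    rewrite -omegaE; apply: eq_bigr => i _; apply: eq_bigr => j _.
    by rewrite [control _ _ 0 j]mxE.
  have mE : measurable_fun setT
      (fun s => \sum_i \sum_j tnth A k i j * (prim u i s * L2fun u j s)).
    apply: measurable_sum => i; apply: measurable_sum => j.
    by have /measurable_int/measurable_EFinP := intF i j.
  rewrite (_ : (fun s => (position u s *m (tnth A k *m (control u s)^T)) 0 0) =
    (fun s => \sum_i \sum_j tnth A k i j * (prim u i s * L2fun u j s))); last first.
    by apply/funext => s; exact: E.
  apply: eq_Rintegral_ae => //.
    apply/(measurable_restrictT _ (measurable_itv `[0, 2 * pi])).
    exact: measurable_funTS mE.
  apply: filterS (ae_in02pi R) => s s02 _.
  by rewrite patchE mem_setE in_itv/= s02.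
apply: EFin_inj; rewrite -sumEFin fineK; last first.
  apply: integrable_fin_num => //.
  rewrite (_ : (fun s => _) = (fun s => (\sum_i \sum_j (tnth A k i j * (prim u i s * L2fun u j s))%:E)%E)).
    by apply: integrable_sum => // i _; apply: integrable_sum => // j _; exact: intF.
  by apply/funext => s; rewrite -sumEFin; apply: eq_bigr => i _; rewrite -sumEFin.
rewrite (_ : (fun s => _) = (fun s => (\sum_i \sum_j (tnth A k i j * (prim u i s * L2fun u j s))%:E)%E)); last first.
  by apply/funext => s; rewrite -sumEFin; apply: eq_bigr => i _; rewrite -sumEFin.
rewrite integral_sum//; last first.
  by move=> i; apply: integrable_sum => // j _; exact: intF.
apply: eq_bigr => i _; rewrite integral_sum//; last by move=> j; exact: intF.
rewrite -sumEFin; apply: eq_bigr => j _; rewrite -RintegralZl//.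
by rewrite fineK//; apply: integrable_fin_num => //; exact: intF.
Qed.

End Area.

(** * Polygonal controls *)

Section Polygons.
Context (R : realType) (d : nat).
Local Notation mu := (leb02pi R).
Local Notation H := (L2 R d).
Implicit Types (u v : H) (i j : 'I_d) (w x y : 'rV[R]_d) (a b h t s : R).
Implicit Types (M : 'M[R]_d) (ws : seq 'rV[R]_d).
Local Hint Resolve S2_L2fun measurable_L2fun S2_cst S2_prim : core.

Definition tens1 w : H := tens (cst 1) w.

Lemma tens1_is_linear : linear tens1.
Proof. by move=> a w w'; rewrite /tens1 tens_linear. Qed.
HB.instance Definition _ := GRing.isLinear.Build R 'rV[R]_d H _ tens1 tens1_is_linear.

Lemma cutoff_tens1_sqr t i : 0 <= t -> t <= 2 * pi ->
  L2dot (cutoff t (tens1 (delta_mx 0 i))) (tens1 (delta_mx 0 i)) = t.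
Proof.
move=> t0 t2; have pi20 : 0 <= 2 * pi :> R by rewrite mulr_ge0 ?pi_ge0.
have h := tail_cst_sqr i t0 t2; have := tail_cst_sqr i (lexx _) pi20.
rewrite tail_sqr cutoff_le0// L2dotC L2dot0r => h'.
by move: h h'; rewrite tail_sqr; lra.
Qed.

Lemma Lint_tens1 t w : 0 <= t -> t <= 2 * pi -> Lint (cutoff t (tens1 w)) = t *: w.
Proof.
move=> t0 t2; rewrite {1}[w]row_sum_delta !linear_sum [w in RHS]row_sum_delta scaler_sumr.
apply: eq_bigr => i _; rewrite !linearZ/=; congr (_ *: _).
apply/rowP => j; rewrite LintE -/(tens1 _) L2dotC !mxE eqxx/=.
have [->|ji] := eqVneq j i; first by rewrite cutoff_tens1_sqr// mulr1.
rewrite L2dotC L2dotC cutoff_tens// L2dot_tens2//; last exact: S2_restrict.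
rewrite big1 ?mul0r ?mulr0// => k _; rewrite !mxE.
by case: (eqVneq k i) => [->|_]; rewrite ?mul0r// eq_sym (negbTE ji) mulr0.
Qed.

(* Constant speed on [a, b], total displacement w (but 0 if a = b, where the
   inverse is a junk value). *)
Definition segment a b w : H :=
  (b - a)^-1 *: (cutoff b (tens1 w) - cutoff a (tens1 w)).

Section Segment.
Variables (a b : R) (w : 'rV[R]_d).
Hypotheses (a0 : 0 <= a) (ab : a < b) (b2 : b <= 2 * pi).

Lemma cutoff_segment_ge s : b <= s -> cutoff s (segment a b w) = segment a b w.
Proof.
move=> bs; rewrite linearZ/= linearB/= !cutoff_cutoff (min_idPr bs).
by rewrite (min_idPr (le_trans (ltW ab) bs)).
Qed.

Lemma cutoff_segment_le s : s <= a -> cutoff s (segment a b w) = 0.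
Proof.
move=> sa; rewrite linearZ/= linearB/= !cutoff_cutoff (min_idPl sa).
by rewrite (min_idPl (le_trans sa (ltW ab))) subrr scaler0.
Qed.

Lemma Lint_segment : Lint (segment a b w) = w.
Proof.
have ba0 : b - a != 0 by rewrite subr_eq0 gt_eqF.
have b0 : 0 <= b := le_trans a0 (ltW ab).
have a2 : a <= 2 * pi := le_trans (ltW ab) b2.
rewrite linearZ/= linearB/= !Lint_tens1//.
by rewrite -scalerBl scalerA mulVf// scale1r.
Qed.

Lemma area_segment M : M^T = - M -> area M (segment a b w) (segment a b w) = 0.
Proof.
move=> skewM; rewrite /segment areaZl areaZr /tens1 !cutoff_tens//.
set f := _ \_ _; set g := _ \_ _.
have Sf : S2 f by exact: S2_restrict.
have Sg : S2 g by exact: S2_restrict.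
have -> : tens f w - tens g w = tens (f \+ (fun t => - 1 * g t)) w.
  by rewrite tensD// ?tensZ ?scaleN1r//; exact: S2Z.
by rewrite area_tens ?mulr0//; apply: S2D => //; exact: S2Z.
Qed.

End Segment.

Lemma norm_segment_le a b w : 0 <= a -> a <= b -> b <= 2 * pi ->
  `|segment a b w| <= (\sum_i `|w 0 i|) / Num.sqrt (b - a).
Proof.
move=> a0 ab b2; rewrite /segment {1 2}[w]row_sum_delta !linear_sum/= -big_split scaler_sumr.
rewrite (le_trans (ler_norm_sum _ _ _))// mulr_suml ler_sum// => i _.
rewrite /= [tens1 _]linearZ [cutoff b _]linearZ [cutoff a _]linearZ -scalerBr.
rewrite scalerA normrZ normrM [`|_^-1| * _]mulrC -mulrA.
rewrite ler_wpM2l//.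
have -> : `|cutoff b (tens1 (delta_mx 0 i)) - cutoff a (tens1 (delta_mx 0 i))| = Num.sqrt (b - a).
  rewrite -[LHS]ger0_norm// -sqrtr_sqr cutoff_sub_sqr// !cutoff_tens1_sqr//.
  - exact: le_trans b2.
  - exact: le_trans ab.
rewrite ger0_norm ?invr_ge0 ?subr_ge0//.
(* For b = a both sides are 0, the inverse of 0 being 0. *)
have [->|ba] := eqVneq (b - a) 0; first by rewrite sqrtr0 invr0 mulr0.
have s0 : Num.sqrt (b - a) != 0 by rewrite gt_eqF// sqrtr_gt0 lt0r ba subr_ge0.
have q : b - a = Num.sqrt (b - a) ^+ 2 by rewrite sqr_sqrtr ?subr_ge0.
set c := Num.sqrt (b - a) in s0 q *; rewrite q.
by rewrite le_eqVlt; apply/orP; left; apply/eqP; field.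
Qed.

Fixpoint polygon a h ws : H :=
  if ws is w :: ws' then segment a (a + h) w + polygon (a + h) h ws' else 0.

(** The area of the polygon with successive sides ws, by iterating the group law: each side
    contributes half of its [omega] with the sum of the later ones. The time parametrisation does
    not enter. *)
Fixpoint word_area M ws : R :=
  if ws is w :: ws' then
    word_area M ws' + 1 / 2 * omega M w (\sum_(w' <- ws') w')
  else 0.

Lemma cutoff_polygon_le ws a h s : 0 < h -> s <= a -> cutoff s (polygon a h ws) = 0.
Proof.
move=> h0; elim: ws a => [|w ws IH] a sa /=; first by rewrite linear0.
rewrite linearD/= cutoff_segment_le ?ltrDl// add0r IH//.
by rewrite (le_trans sa)// lerDl ltW.
Qed.

Lemma tail_polygon ws a h : 0 < h -> tail a (polygon a h ws) = polygon a h ws.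
Proof. by move=> h0; rewrite /tail cutoff_polygon_le// subr0. Qed.

Let size_cons ws w a h : a + h *+ (size (w :: ws)) = a + h + h *+ size ws.
Proof. by rewrite /= mulrS addrA. Qed.

Lemma Lint_polygon ws a h : 0 <= a -> 0 < h -> a + h *+ size ws <= 2 * pi ->
  Lint (polygon a h ws) = \sum_(w <- ws) w.
Proof.
move=> + h0; elim: ws a => [|w ws IH] a a0 a2 /=; first by rewrite big_nil linear0.
move: a2; rewrite size_cons => a2.
rewrite big_cons linearD/= Lint_segment ?ltrDl//; last first.
  by rewrite (le_trans _ a2)// lerDl mulrn_wge0// ltW.
by rewrite IH// addr_ge0// ltW.
Qed.

Lemma area_polygon M ws a h : M^T = - M -> 0 <= a -> 0 < h ->
  a + h *+ size ws <= 2 * pi ->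
  area M (polygon a h ws) (polygon a h ws) = word_area M ws.
Proof.
move=> skewM + h0; elim: ws a => [|w ws IH] a a0 a2 /=; first by rewrite area0l.
move: a2; rewrite size_cons => a2.
have ah0 : 0 <= a + h by rewrite addr_ge0// ltW.
have ah2 : a + h <= 2 * pi by rewrite (le_trans _ a2)// lerDl mulrn_wge0// ltW.
have aah : a < a + h by rewrite ltrDl.
rewrite -(cutoff_segment_ge w aah (lexx _)) -(tail_polygon ws (a + h) h0).
rewrite area_concat// cutoff_segment_ge// tail_polygon// area_segment// add0r IH//.
by rewrite Lint_segment// Lint_polygon.
Qed.

Lemma norm_polygon_le ws a h : 0 <= a -> 0 <= h -> a + h *+ size ws <= 2 * pi ->
  `|polygon a h ws| <= (\sum_(w <- ws) \sum_i `|w 0 i|) / Num.sqrt h.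
Proof.
move=> + h0; elim: ws a => [|w ws IH] a a0 a2 /=.
  by rewrite normr0 big_nil mul0r.
move: a2; rewrite size_cons => a2.
rewrite big_cons mulrDl (le_trans (ler_normD _ _))// lerD//; last first.
  by rewrite IH// addr_ge0.
have := @norm_segment_le a (a + h) w; rewrite addrAC subrr add0r; apply => //.
  by rewrite lerDl.
by rewrite (le_trans _ a2)// lerDl mulrn_wge0.
Qed.

Lemma word_area_cat M ws ws' : word_area M (ws ++ ws') =
  word_area M ws + word_area M ws' +
  1 / 2 * omega M (\sum_(w <- ws) w) (\sum_(w <- ws') w).
Proof.
elim: ws => [|w ws IH] /=.
  rewrite big_nil (_ : omega _ _ _ = 0) ?mulr0 ?addr0 ?add0r//.
  by rewrite /omega big1// => i _; rewrite big1// => j _; rewrite !mxE mul0r mulr0.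
rewrite IH big_cat/= big_cons omegaDl.
have -> x y : omega M w (x + y) = omega M w x + omega M w y.
  rewrite /omega -big_split; apply: eq_bigr => i _; rewrite -big_split.
  by apply: eq_bigr => j _; rewrite !mxE/=; ring.
by ring.
Qed.

(* A loop whose area form is r (e_i /\ e_j). *)
Definition loop (ij : 'I_d * 'I_d) (r : R) : seq 'rV[R]_d :=
  let e := Num.sqrt r - Num.sqrt (- r) in let f := Num.sqrt `|r| in
  [:: e *: delta_mx 0 ij.1; f *: delta_mx 0 ij.2;
      (- e) *: delta_mx 0 ij.1; (- f) *: delta_mx 0 ij.2].

Lemma loop_sum ij r : \sum_(w <- loop ij r) w = 0.
Proof.
rewrite /loop !big_cons big_nil addr0 !scaleNr addrA [_ + (_ - _)]addrA.
by apply/rowP => k; rewrite !mxE; ring.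
Qed.

Lemma loop_area M ij r : M^T = - M -> word_area M (loop ij r) = r * M ij.1 ij.2.
Proof.
move=> skewM; have skewE i j : M j i = - M i j.
  by have := congr1 (fun N : 'M[R]_d => N i j) skewM; rewrite !mxE.
have diag i : M i i = 0 by have := skewE i i; lra.
(* [Num.sqrt] is 0 on negative numbers, so the first factor is the signed root of r. It is
   continuous through r = 0, as the homotopy requires. *)
have rE : r = (Num.sqrt r - Num.sqrt (- r)) * Num.sqrt `|r|.
  have [r0|r0] := leP 0 r.
    by rewrite (ler0_sqrtr (_ : - r <= 0)) ?oppr_le0// subr0 ger0_norm// -expr2 sqr_sqrtr.
  by rewrite (ler0_sqrtr (ltW r0)) sub0r ltr0_norm// mulNr -expr2 sqr_sqrtr ?oppr_ge0 ?ltW// opprK.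
rewrite [in RHS]rE /loop /=; set e := Num.sqrt r - _; set f := Num.sqrt _.
rewrite !big_cons !big_nil !addr0 omega0r.
have oD w x y : omega M w (x + y) = omega M w x + omega M w y.
  rewrite /omega -big_split; apply: eq_bigr => i _; rewrite -big_split.
  by apply: eq_bigr => j _; rewrite !mxE/=; ring.
rewrite !oD !omega_delta !diag (skewE ij.1 ij.2).
by field.
Qed.

Definition word x (r : 'I_d * 'I_d -> R) : seq 'rV[R]_d :=
  x :: flatten [seq loop ij (r ij) | ij <- enum {: 'I_d * 'I_d}].

Lemma word_sum x r : \sum_(w <- word x r) w = x.
Proof.
rewrite /word big_cons big_flatten/= big_map big1 ?addr0// => ij _.
exact: loop_sum.
Qed.

(** Closed loops have no displacement, so they interact neither with the first side nor with one
    another, and their areas add up. *)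
Lemma word_areaE M x r : M^T = - M ->
  word_area M (word x r) = \sum_ij r ij * M ij.1 ij.2.
Proof.
move=> skewM /=; rewrite big_flatten/= big_map big1 => [|ij _]; last exact: loop_sum.
rewrite omega0r mulr0 addr0.
have -> : \sum_ij r ij * M ij.1 ij.2 =
    \sum_(ij <- enum {: 'I_d * 'I_d}) r ij * M ij.1 ij.2.
  by rewrite big_enum.
elim: (enum _) => [|ij s IH]; first by rewrite big_nil.
rewrite big_cons -[flatten _]/(loop ij (r ij) ++ flatten [seq loop ij (r ij) | ij <- s]).
rewrite word_area_cat IH loop_area// loop_sum omega_skew// omega0r oppr0 mulr0 addr0.
by [].
Qed.

End Polygons.

(** * Continuity of bounded linear and bilinear maps *)

Section BoundedMaps.
Context (R : realType).

Lemma bounded_linear_continuous (E F : normedModType R) (f : {linear E -> F}) (C : R) :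
  (forall x, `|f x| <= C * `|x|) -> continuous f.
Proof.
move=> fC; have C1 : 0 < `|C| + 1 by rewrite ltr_wpDl.
move=> x; apply/cvgrPdist_lt => e e0.
have : \forall y \near x, `|x - y| < e / (`|C| + 1).
  by apply: cvgr_dist_lt; [exact: cvg_id|rewrite divr_gt0].
apply: filterS => y; rewrite ltr_pdivlMr// => xy.
rewrite -linearB (le_lt_trans (fC _))// (le_lt_trans _ xy)// mulrC ler_wpM2l//.
by rewrite (le_trans (ler_norm _))// lerDl.
Qed.

Lemma bounded_bilinear_continuous (E F G : normedModType R) (b : E -> F -> G) (C : R) :
  (forall x x' y, b (x - x') y = b x y - b x' y) ->
  (forall x y y', b x (y - y') = b x y - b x y') ->
  (forall x y, `|b x y| <= C * `|x| * `|y|) ->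
  continuous (fun z : E * F => b z.1 z.2).
Proof.
move=> bl br bC [x y]; apply/cvgrPdist_lt => e e0.
pose K := `|C| * (`|x| + `|y| + 1) + 1.
have K0 : 0 < K by rewrite ltr_wpDl// mulr_ge0// !addr_ge0.
pose dl := Num.min 1 (e / K).
have dl0 : 0 < dl by rewrite lt_min ltr01 divr_gt0.
have nx : \forall z \near (x, y), `|x - z.1| < dl.
  have /cvgrPdist_lt/(_ _ dl0) : (fun z : E * F => z.1) @ (x, y) --> x by exact: cvg_fst.
  by [].
have ny : \forall z \near (x, y), `|y - z.2| < dl.
  have /cvgrPdist_lt/(_ _ dl0) : (fun z : E * F => z.2) @ (x, y) --> y by exact: cvg_snd.
  by [].
apply: filterS2 nx ny => -[x' y'] /= xx yy.
have -> : b x y - b x' y' = b (x - x') y + b x' (y - y').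
  by rewrite bl br addrA subrK.
have x'1 : `|x'| <= `|x| + 1.
  rewrite -lerBlDl (le_trans (lerB_dist _ _))// distrC (le_trans (ltW xx))//.
  by rewrite ge_min lexx.
have xK : `|x - x'| * K < e by rewrite -ltr_pdivlMr// (lt_le_trans xx)// ge_min lexx orbT.
have yK : `|y - y'| * K < e by rewrite -ltr_pdivlMr// (lt_le_trans yy)// ge_min lexx orbT.
have absC (u : E) (v : F) : `|b u v| <= `|C| * `|u| * `|v|.
  by rewrite (le_trans (bC _ _))// ler_wpM2r// ler_wpM2r// ler_norm.
have h1 : `|b (x - x') y| <= `|C| * `|y| * dl.
  by rewrite (le_trans (absC _ _))// [leRHS]mulrAC ler_wpM2r// ler_wpM2l// ltW.
have h2 : `|b x' (y - y')| <= `|C| * (`|x| + 1) * dl.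
  rewrite (le_trans (absC _ _))// ler_pM// ?mulr_ge0//; last exact: ltW.
  by rewrite ler_wpM2l.
rewrite (le_lt_trans (ler_normD _ _))// (le_lt_trans (lerD h1 h2))//.
have -> : `|C| * `|y| * dl + `|C| * (`|x| + 1) * dl = (K - 1) * dl by rewrite /K; ring.
have : K * dl <= e by rewrite mulrC -ler_pdivlMr// /dl ge_min lexx orbT.
by apply: lt_le_trans; rewrite ltr_pM2r// gtrBl.
Qed.

End BoundedMaps.

(** * Continuity of polygonal controls in their parameters *)

Section Contraction.
Context (R : realType) (d : nat).
Local Notation mu := (leb02pi R).
Local Notation H := (L2 R d).
Implicit Types (u v : H) (i j : 'I_d) (w x y : 'rV[R]_d) (a b h t s : R).
Implicit Types (M : 'M[R]_d) (ws : seq 'rV[R]_d).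
Local Hint Resolve S2_L2fun measurable_L2fun S2_cst S2_prim : core.

Lemma L2dotr_continuous u : continuous (L2dot u).
Proof.
have lin_dot : scalar (L2dot u) by move=> a v w; rewrite L2dotDr L2dotZr.
pose f : {linear H -> R} := HB.pack (L2dot u) (GRing.isLinear.Build _ _ _ _ _ lin_dot).
exact: (@bounded_linear_continuous _ _ _ f `|u| (L2dot_le u)).
Qed.

Lemma Lint_coord_continuous i : continuous (fun u : H => Lint u 0 i).
Proof.
rewrite (_ : (fun u => _) = L2dot (tens (cst 1) (delta_mx 0 i))).
  exact: L2dotr_continuous.
by apply/funext => v; rewrite LintE.
Qed.

Lemma area_continuous M : continuous (fun z : H * H => area M z.1 z.2).
Proof.
apply: (@bounded_bilinear_continuous _ _ _ _ (area M) (mx_norm1 M * (2 * pi))).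
- by move=> u v w; rewrite areaDl -scaleN1r areaZl mulN1r.
- by move=> u v w; rewrite areaDr -scaleN1r areaZr mulN1r.
- by move=> u v; exact: area_le.
Qed.

Section AtPoint.
Context (Z : topologicalType) (z0 : Z).

Definition coord_cvg (w : Z -> 'rV[R]_d) := forall i,
  {for z0, continuous (fun z => w z 0 i)}.

Lemma tens1_cvg (w : Z -> 'rV[R]_d) : coord_cvg w ->
  {for z0, continuous (fun z => tens1 (w z))}.
Proof.
move=> cw; rewrite (_ : (fun z => _) = (fun z => \sum_i w z 0 i *: tens1 (delta_mx 0 i))).
  apply: cvg_big => [|i _]; last by apply: cvgZr_tmp; exact: cw.
  by move=> x; exact: add_continuous.
by apply/funext => z; rewrite {1}[w z]row_sum_delta linear_sum; apply: eq_bigr => i _; rewrite linearZ.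
Qed.

Lemma segment_cvg (a b : Z -> R) (w : Z -> 'rV[R]_d) :
  {for z0, continuous a} -> {for z0, continuous b} -> b z0 - a z0 != 0 ->
  coord_cvg w -> {for z0, continuous (fun z => segment (a z) (b z) (w z))}.
Proof.
move=> ca cb ab cw; have ct := tens1_cvg cw.
have cc (c : Z -> R) : {for z0, continuous c} ->
    {for z0, continuous (fun z => cutoff (c z) (tens1 (w z)))}.
  move=> cc; apply: (@continuous_comp _ _ _ (fun z => (tens1 (w z), c z))
    (fun z : H * R => cutoff z.2 z.1)); last exact: cutoff_continuous.
  exact: (cvg_pair ct cc).
apply: continuousZ; last by apply: continuousB; exact: cc.
by apply: continuousV => //; exact: continuousB.
Qed.

(** The number n of sides is constant in z, so the induction follows each side as a function of z;
    [h z0 != 0] keeps the speeds bounded near z0. *)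
Lemma polygon_cvg (ws : Z -> seq 'rV[R]_d) n (a h : Z -> R) :
  {for z0, continuous a} -> {for z0, continuous h} -> h z0 != 0 ->
  (forall z, size (ws z) = n) ->
  (forall m, coord_cvg (fun z => nth 0 (ws z) m)) ->
  {for z0, continuous (fun z => polygon (a z) (h z) (ws z))}.
Proof.
elim: n ws a => [|n IH] ws a ca ch h0 sz cws.
  rewrite (_ : (fun z => _) = cst 0); first exact: cst_continuous.
  by apply/funext => z; move: (sz z); case: (ws z).
rewrite (_ : (fun z => _) = (fun z => segment (a z) (a z + h z) (nth 0 (ws z) 0) +
   polygon (a z + h z) (h z) (behead (ws z)))); last first.
  by apply/funext => z; move: (sz z); case: (ws z).
have cah : {for z0, continuous (fun z => a z + h z)} by exact: continuousD.
apply: continuousD.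
  by apply: segment_cvg => //; rewrite addrAC subrr add0r.
apply: IH => //; first by move=> z; rewrite size_behead sz.
move=> m i; rewrite (_ : (fun z => _) = (fun z => nth 0 (ws z) m.+1 0 i)).
  exact: cws.
by apply/funext => z; rewrite nth_behead.
Qed.

Lemma nth_loop_cvg ij (r : Z -> R) m : {for z0, continuous r} ->
  coord_cvg (fun z => nth 0 (loop ij (r z)) m).
Proof.
move=> cr i.
have cs (f : Z -> R) : {for z0, continuous f} -> {for z0, continuous (fun z => Num.sqrt (f z))}.
  by move=> cf; apply: continuous_comp cf _; exact: sqrt_continuous.
have c1 : {for z0, continuous (fun z => Num.sqrt (r z) - Num.sqrt (- r z))}.
  by apply: continuousB; apply: cs => //; exact: continuousN.
have c2 : {for z0, continuous (fun z => Num.sqrt `|r z|)}.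
  by apply: cs; apply: continuous_comp cr _; exact: norm_continuous.
have cZ (f : Z -> R) (v : 'rV[R]_d) : {for z0, continuous f} ->
    {for z0, continuous (fun z => (f z *: v) 0 i)}.
  move=> cf; rewrite (_ : (fun z => _) = (fun z => f z * v 0 i)).
    by apply: continuousM => //; exact: cst_continuous.
  by apply/funext => z; rewrite mxE.
case: m => [|[|[|[|m]]]] /=; do ?[exact: cZ|apply: cZ; exact: continuousN].
rewrite (_ : (fun z => _) = cst 0); first exact: cst_continuous.
by apply/funext => z; rewrite nth_nil mxE.
Qed.

Lemma nth_word_cvg (x : Z -> 'rV[R]_d) (r : Z -> 'I_d * 'I_d -> R) m :
  coord_cvg x -> (forall ij, {for z0, continuous (r ^~ ij)}) ->
  coord_cvg (fun z => nth 0 (word (x z) (r z)) m).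
Proof.
move=> cx cr; case: m => [|m] //=.
elim: (enum _) m => [|ij s IH] m i /=.
  rewrite (_ : (fun z => _) = cst 0); first exact: cst_continuous.
  by apply/funext => z; rewrite nth_nil mxE.
have [m4|m4] := ltnP m 4.
  rewrite (_ : (fun z => _) = (fun z => nth 0 (loop ij (r z ij)) m 0 i)).
    exact: nth_loop_cvg.
  by apply/funext => z; case: m m4 => [|[|[|[|m]]]].
rewrite (_ : (fun z => _) =
  (fun z => nth 0 (flatten [seq loop ij (r z ij) | ij <- s]) (m - 4) 0 i)).
  exact: IH.
by apply/funext => z; case: m m4 => [|[|[|[|m]]]]//= _; rewrite !subSS subn0.
Qed.

End AtPoint.

End Contraction.

Local Arguments polygon : simpl never.
Local Arguments word : simpl never.

(** * Contraction of the fibres of the end-point map *)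

Section Contract.
Context (R : realType) (d l : nat) (A : l.-tuple 'M[R]_d).
Local Notation H := (L2 R d).
Hypothesis skewA : forall k, (tnth A k)^T = - tnth A k.
(** A linear right inverse of r -> (\sum_ij r_ij (A_k)_ij)_k: it selects loop areas that realise a
    prescribed vertical displacement. *)
Variable c : 'I_d * 'I_d -> 'I_l -> R.
Hypothesis cA : forall (y : 'I_l -> R) k,
  \sum_ij (\sum_m c ij m * y m) * tnth A k ij.1 ij.2 = y k.
Variables (x : 'rV[R]_d) (y : 'rV[R]_l).
Implicit Types (u : H) (t : R).

(** With [yrem], these are the coordinates of gamma_u(t)^-1 p in the group, that is, what the
    polygon has to cover; the term in [omega] comes from the group law. *)
Let xrem u t : 'rV[R]_d := x - Lint (cutoff t u).

Let yrem u t k : R := y 0 k - area (tnth A k) (cutoff t u) (cutoff t u)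
  - 1 / 2 * omega (tnth A k) (Lint (cutoff t u)) (xrem u t).

Let rrem u t (ij : 'I_d * 'I_d) : R := \sum_m c ij m * yrem u t m.

Let N : nat := size (word (0 : 'rV[R]_d) (fun=> 0)).

Let size_word w r : size (word w r : seq 'rV[R]_d) = N.
Proof. by rewrite /N /word /=; congr S; elim: (enum _) => //= ij s ->. Qed.

Let deform u t : H :=
  cutoff t u + polygon t ((2 * pi - t) / N%:R) (word (xrem u t) (rrem u t)).

Let N0 : 0 < N%:R :> R.
Proof. by rewrite ltr0n. Qed.

Let endpoint_deform u t : 0 <= t -> t < 2 * pi -> endpoint A (deform u t) = (x, y).
Proof.
move=> t0 t2; set h := (2 * pi - t) / N%:R; set ws := word (xrem u t) (rrem u t).
have h0 : 0 < h by rewrite divr_gt0// subr_gt0.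
have h2 : t + h *+ size ws <= 2 * pi.
  by rewrite size_word -mulr_natr /h divfK ?gt_eqF// addrC subrK.
rewrite endpointE /deform -/h -/ws; congr pair.
  by rewrite linearD/= Lint_polygon// word_sum /xrem addrC subrK.
apply/rowP => k; rewrite mxE -(tail_polygon ws t h0) area_concat// tail_polygon//.
rewrite area_polygon// Lint_polygon// word_areaE// word_sum.
by rewrite cA /yrem; ring.
Qed.

Let polygon_h0 a (ws : seq 'rV[R]_d) : polygon a 0 ws = 0 :> H.
Proof.
elim: ws a => [|w ws IH] a //.
by rewrite -[LHS]/(segment a (a + 0) w + polygon (a + 0) 0 ws) IH /segment addrAC subrr add0r invr0 scale0r addr0.
Qed.

Let deform_2pi u : deform u (2 * pi) = u.
Proof. by rewrite /deform subrr mul0r polygon_h0 addr0 cutoff_id. Qed.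

Let deform_0 u v : deform u 0 = deform v 0.
Proof. by rewrite /deform /rrem /yrem /xrem !cutoff_le0. Qed.

(** The sum bounds the loop areas relative to (sqrt(2 pi - t) |tail t u|)^2. Adding 1 gives K <=
    K^2, so that K also bounds the square roots. *)
Let K : R := 1 + \sum_ij \sum_m `|c ij m| * mx_norm1 (tnth A m).

Let mx_norm1_ge0 (M : 'M[R]_d) : 0 <= mx_norm1 M.
Proof. by apply: sumr_ge0 => i _; apply: sumr_ge0. Qed.

Let K1 : 1 <= K.
Proof.
rewrite /K lerDl; apply: sumr_ge0 => ij _; apply: sumr_ge0 => m _.
by rewrite mulr_ge0.
Qed.

Let sum_delta (a : R) (j : 'I_d) : \sum_i `|(a *: (delta_mx 0 j : 'rV[R]_d)) 0 i| = `|a|.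
Proof.
rewrite (bigD1 j)//= !mxE !eqxx mulr1 big1 ?addr0// => i ij.
by rewrite !mxE (negbTE ij) andbF mulr0 normr0.
Qed.

Let loop_norm ij (r : R) :
  \sum_(w <- (loop ij r : seq 'rV[R]_d)) \sum_i `|w 0 i| = 4 * Num.sqrt `|r|.
Proof.
rewrite /loop !big_cons big_nil !sum_delta !normrN.
have -> : `|Num.sqrt r - Num.sqrt (- r)| = Num.sqrt `|r|.
  have [r0|r0] := leP 0 r.
    by rewrite (ler0_sqrtr (_ : - r <= 0)) ?oppr_le0// subr0 (ger0_norm (sqrtr_ge0 r)) (ger0_norm r0).
  by rewrite (ler0_sqrtr (ltW r0)) sub0r normrN (ltr0_norm r0) (ger0_norm (sqrtr_ge0 _)).
by rewrite (ger0_norm (sqrtr_ge0 _)); ring.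
Qed.

(** The d coordinates of the displacement, then four sides of length at most a multiple K for each
    loop; the root of N comes from the duration (2 pi - t) / N of a side. *)
Let C : R := (d%:R + #|{: 'I_d * 'I_d}|%:R * (4 * K)) * Num.sqrt N%:R.

(** For u in the fibre, what remains to be covered is the end point of [tail t u] itself. With q =
    sqrt(2 pi - t) and D = |tail t u|, the displacement is O(q D) and the areas are O((q D)^2), so
    all sides are O(q D); dividing by the root q / sqrt N of the duration of a side leaves O(D). *)
Let deform_near u t : endpoint A u = (x, y) -> 0 <= t -> t <= 2 * pi ->
  `|deform u t - cutoff t u| <= C * `|tail t u|.
Proof.
move=> uxy t0 t2; rewrite /deform addrAC subrr add0r.
have C0 : 0 <= C.
  rewrite mulr_ge0 ?sqrtr_ge0// addr_ge0// mulr_ge0// mulr_ge0//.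
  exact: le_trans K1.
move: t2; rewrite le_eqVlt => /predU1P[->|t2].
  by rewrite subrr mul0r polygon_h0 normr0 mulr_ge0.
set D := `|tail t u|; set q := Num.sqrt (2 * pi - t).
have q0 : 0 < q by rewrite sqrtr_gt0 subr_gt0.
have q2 : q ^+ 2 = 2 * pi - t by rewrite sqr_sqrtr// subr_ge0 ltW.
have D0 : 0 <= D by exact: normr_ge0.
have [ux uy] : x = Lint u /\ forall k, y 0 k = area (tnth A k) u u.
  by move: uxy; rewrite endpointE => -[<- <-]; split => // k; rewrite mxE.
have uE : u = cutoff t u + tail t u by rewrite /tail addrC subrK.
have xremE : xrem u t = Lint (tail t u) by rewrite /xrem ux {1}uE linearD/= addrC addKr.
have yremE k : yrem u t k = area (tnth A k) (tail t u) (tail t u).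
  rewrite /yrem xremE uy {1 2}uE -[tail t u in LHS](tail_tail t u) area_concat//.
  by rewrite tail_tail; ring.
have xle i : `|xrem u t 0 i| <= q * D by rewrite xremE Lint_tail_le// ltW.
have rle ij : Num.sqrt `|rrem u t ij| <= K * (q * D).
  have KqD : 0 <= K * (q * D) by rewrite !mulr_ge0// ?(le_trans _ K1)// ltW.
  rewrite -[leRHS](ger0_norm KqD) -[leRHS]sqrtr_sqr ler_wsqrtr//.
  have r1 : `|rrem u t ij| <= K * (q * D) ^+ 2.
    apply: le_trans (_ : (\sum_m `|c ij m| * mx_norm1 (tnth A m)) * (q * D) ^+ 2 <= _); last first.
      rewrite ler_wpM2r ?sqr_ge0// /K (bigD1 ij)//= addrCA lerDl addr_ge0//.
      by apply: sumr_ge0 => ij' _; apply: sumr_ge0 => m _; rewrite mulr_ge0.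
    rewrite (le_trans (ler_norm_sum _ _ _))// mulr_suml ler_sum// => m _.
    rewrite normrM -mulrA ler_wpM2l// yremE (le_trans (area_tail_le _ _ _ t0 (ltW t2)))//.
    by rewrite ler_wpM2l// exprMn q2 expr2 mulrA.
  rewrite (le_trans r1)// [leRHS]exprMn ler_wpM2r ?sqr_ge0// expr2.
  by rewrite ler_peMl// (le_trans _ K1).
have wle : \sum_(w <- word (xrem u t) (rrem u t)) \sum_i `|w 0 i| <=
    (d%:R + #|{: 'I_d * 'I_d}|%:R * (4 * K)) * (q * D).
  rewrite /word big_cons mulrDl; apply: lerD.
    apply: le_trans (_ : \sum_(i < d) q * D <= _); first exact: ler_sum.
    by rewrite sumr_const card_ord mulr_natl.
  rewrite cardE; elim: (enum _) => [|ij s IH] /=; first by rewrite big_nil !mul0r.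
  rewrite -[_ :: _]/(loop ij (rrem u t ij) ++ flatten [seq loop ij (rrem u t ij) | ij <- s]).
  have -> : (size s).+1%:R = 1 + (size s)%:R :> R by rewrite -natr1 addrC.
  rewrite big_cat loop_norm /= (mulrDl 1 _ (4 * K)) mul1r (mulrDl (4 * K)); apply: lerD => //.
  by rewrite -mulrA ler_wpM2l.
have h0 : 0 <= (2 * pi - t) / N%:R by rewrite divr_ge0 ?ltW// subr_gt0.
have h2 : t + (2 * pi - t) / N%:R *+ size (word (xrem u t) (rrem u t)) <= 2 * pi.
  by rewrite size_word -mulr_natr divfK ?gt_eqF// addrC subrK.
rewrite (le_trans (norm_polygon_le t0 h0 h2))//.
have -> : Num.sqrt ((2 * pi - t) / N%:R) = q / Num.sqrt N%:R.
  by rewrite sqrtrM ?subr_ge0 ?(ltW t2)// sqrtrV// ltW.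
rewrite ler_pdivrMr; last by rewrite divr_gt0// sqrtr_gt0.
rewrite (le_trans wle)// /C.
have sN : Num.sqrt N%:R != 0 :> R by rewrite gt_eqF// sqrtr_gt0.
by rewrite le_eqVlt; apply/orP; left; apply/eqP; field.
Qed.

Let deform_continuous u t : t < 2 * pi ->
  {for (u, t), continuous (fun z : H * R => deform z.1 z.2)}.
Proof.
move=> t2; have ccut := @cutoff_continuous R d (u, t).
have csnd : {for (u, t), continuous (fun z : H * R => z.2)} by exact: cvg_snd.
have cL i : {for (u, t), continuous (fun z : H * R => Lint (cutoff z.2 z.1) 0 i)}.
  apply: (@continuous_comp _ _ _ (fun z : H * R => cutoff z.2 z.1) (fun v : H => Lint v 0 i)).
    exact: ccut.
  exact: Lint_coord_continuous.
have cx i : {for (u, t), continuous (fun z : H * R => xrem z.1 z.2 0 i)}.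
  rewrite (_ : (fun z => _) = (fun z : H * R => x 0 i - Lint (cutoff z.2 z.1) 0 i)).
    by apply: continuousB => //; exact: cst_continuous.
  by apply/funext => z; rewrite /xrem !mxE.
have co k : {for (u, t), continuous (fun z : H * R =>
    omega (tnth A k) (Lint (cutoff z.2 z.1)) (xrem z.1 z.2))}.
  apply: cvg_big => [|i _]; first exact: add_continuous.
  apply: cvg_big => [|j _]; first exact: add_continuous.
  apply: cvgM; first exact: cvg_cst.
  by apply: cvgM; [exact: cL|exact: cx].
have ca k : {for (u, t), continuous (fun z : H * R =>
    area (tnth A k) (cutoff z.2 z.1) (cutoff z.2 z.1))}.
  apply: (@continuous_comp _ _ _ (fun z : H * R => (cutoff z.2 z.1, cutoff z.2 z.1))
    (fun z => area (tnth A k) z.1 z.2)); last exact: area_continuous.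
  exact: (cvg_pair ccut ccut).
have cy k : {for (u, t), continuous (fun z : H * R => yrem z.1 z.2 k)}.
  apply: cvgB; first by apply: cvgB; [exact: cvg_cst|exact: ca].
  by apply: cvgM; [exact: cvg_cst|exact: co].
have cr ij : {for (u, t), continuous (fun z : H * R => rrem z.1 z.2 ij)}.
  apply: cvg_big => [|k _]; first exact: add_continuous.
  by apply: cvgM; [exact: cvg_cst|exact: cy].
apply: continuousD; first exact: ccut.
apply: (@polygon_cvg _ _ _ _ (fun z : H * R => word (xrem z.1 z.2) (rrem z.1 z.2)) N
  (fun z => z.2) (fun z => (2 * pi - z.2) / N%:R)) => //.
- apply: continuousM; last exact: cst_continuous.
  by apply: continuousB => //; exact: cst_continuous.
- by rewrite /= mulf_neq0// ?invr_eq0 gt_eqF// subr_gt0.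
- by move=> m; exact: nth_word_cvg.
Qed.

(** Runs time backwards from 2 pi to 0 and is constant outside [0, 1], so that the deformation is
    defined and continuous for every real s. *)
Let clamp (s : R) : R := 2 * pi * (1 - Num.min 1 (Num.max 0 s)).

Let clamp_in s : 0 <= clamp s <= 2 * pi.
Proof.
have p0 : 0 <= 2 * pi :> R by rewrite mulr_ge0 ?pi_ge0.
rewrite /clamp mulr_ge0//=; last by rewrite subr_ge0 ge_min lexx.
by rewrite ler_piMr// gerBl le_min ler01/= le_max lexx.
Qed.

Let clamp_continuous : continuous clamp.
Proof.
move=> s; apply: cvgM; first exact: cvg_cst.
apply: cvgB; first exact: cvg_cst.
apply: (@continuous_min _ _ (cst 1) (fun s : R => Num.max 0 s)).
  exact: cst_continuous.
apply: (@continuous_max _ _ (cst 0) id); first exact: cst_continuous.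
exact: cvg_id.
Qed.

Let clamp_exists : exists f : R -> R, [/\ continuous f,
  forall s, 0 <= f s <= 2 * pi, f 0 = 2 * pi & f 1 = 0].
Proof.
exists clamp; split; [exact: clamp_continuous|exact: clamp_in| |].
  by rewrite /clamp maxxx (min_idPr (@ler01 R)) subr0 mulr1.
by rewrite /clamp (max_idPr (@ler01 R)) minxx subrr mulr0.
Qed.

Local Notation X := (Omega A (x, y)).

Lemma fibre_contraction : exists (x0 : X) (F : X * R -> X),
  [/\ continuous F, forall u : X, F (u, 0) = u & forall u : X, F (u, 1) = x0].
Proof.
have p0 : 0 < 2 * pi :> R by rewrite mulr_gt0// pi_gt0.
have [cl [cl_continuous cl_in cl0 cl1]] := clamp_exists.
have inX (z : X * R) : deform (val z.1) (cl z.2) \in X.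
  rewrite inE /Omega/=; have /andP[c0] := cl_in z.2.
  rewrite le_eqVlt => /predU1P[->|c2]; last exact: endpoint_deform.
  by rewrite deform_2pi; exact: set_mem (valP z.1).
have x0X : deform 0 0 \in X by rewrite inE; apply: endpoint_deform.
exists (SigSub x0X), (fun z => SigSub (inX z)); split; last 2 first.
- move=> u; apply: val_inj.
  by rewrite -[LHS]/(deform (val u) (cl 0)) cl0 deform_2pi.
- move=> u; apply: val_inj.
  by rewrite -[LHS]/(deform (val u) (cl 1)) cl1; exact: deform_0.
apply: (@continuous_comp_initial _ _ _ (set_val : X -> H)) => -[u s].
rewrite -[_ \o _]/(fun z : X * R => deform (val z.1) (cl z.2)).
have cu : (fun z : X * R => val z.1) @ (u, s) --> val u.
  have cval : (set_val : X -> H) @ u --> val u by exact: (@initial_continuous _ _ (set_val : X -> H)).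
  exact: (@cvg_comp _ _ _ fst (set_val : X -> H) _ _ _ cvg_fst cval).
have cs : (fun z : X * R => cl z.2) @ (u, s) --> cl s.
  have cc : cl @ s --> cl s by exact: cl_continuous.
  exact: (@cvg_comp _ _ _ snd cl _ _ _ cvg_snd cc).
have cus : (fun z : X * R => (val z.1, cl z.2)) @ (u, s) --> (val u, cl s) by exact: (cvg_pair cu cs).
(* At time 2 pi the sides have duration 0 and [polygon_cvg] does not apply; there the polygon is
   squeezed to 0 by [deform_near], since the tail of u tends to 0. *)
have /andP[c0] := cl_in s; rewrite le_eqVlt => /predU1P[c2|c2]; last first.
  apply: (@continuous_comp _ _ _ (fun z : X * R => (val z.1, cl z.2))
    (fun z : H * R => deform z.1 z.2)); first exact: cus.
  exact: deform_continuous.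
have ccut : (fun z : X * R => cutoff (cl z.2) (val z.1)) @ (u, s) --> val u.
  have cc := @cutoff_continuous R d (val u, cl s).
  have cE : cutoff (cl s) (val u) = val u by rewrite c2 cutoff_id.
  have h := cvg_comp _ _ cus cc; move: h; rewrite [X in _ --> X]/= cE; exact.
have ctail : (fun z : X * R => C * `|tail (cl z.2) (val z.1)|) @ (u, s) --> 0.
  have t0 : (fun z : X * R => tail (cl z.2) (val z.1)) @ (u, s) --> val u - val u.
    by exact: (cvgB cu ccut).
  have t1 : (fun z : X * R => `|tail (cl z.2) (val z.1)|) @ (u, s) --> `|val u - val u|.
    exact: cvg_norm t0.
  have t2 : (fun z : X * R => C * `|tail (cl z.2) (val z.1)|) @ (u, s) --> C * `|val u - val u|.
    by apply: cvgM; [exact: cvg_cst|exact: t1].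
  by move: t2; rewrite subrr normr0 mulr0.
have E : deform (val u) (cl s) = val u by rewrite c2 deform_2pi.
have cdiff : (fun z : X * R => deform (val z.1) (cl z.2) - cutoff (cl z.2) (val z.1)) @ (u, s) --> 0.
  apply/norm_cvg0P; apply: squeeze_cvgr (cvg_cst 0) ctail.
  near=> z; rewrite normr_ge0/=; have /andP[z0 z2] := cl_in z.2.
  by apply: deform_near => //; exact: set_mem (valP z.1).
have csum : (fun z : X * R => cutoff (cl z.2) (val z.1) +
    (deform (val z.1) (cl z.2) - cutoff (cl z.2) (val z.1))) @ (u, s) --> val u + 0.
  by apply: cvgD.
have {csum} : (fun z : X * R => deform (val z.1) (cl z.2)) @ (u, s) --> val u + 0.
  by move: csum; under eq_fun do rewrite addrC subrK.
by rewrite addr0 -[Y in _ --> Y]E.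
Unshelve. all: by end_near. Qed.

End Contract.

(** * Contractibility of the fibres *)

Section Fibres.
Context (R : realType) (d l : nat).

Lemma free_right_inverse (A : l.-tuple 'M[R]_d) : free A ->
  exists c : 'I_d * 'I_d -> 'I_l -> R, forall (y : 'I_l -> R) k,
    \sum_ij (\sum_m c ij m * y m) * tnth A k ij.1 ij.2 = y k.
Proof.
move=> freeA; pose B := \matrix_k mxvec (tnth A k) : 'M[R]_(l, d * d).
have /row_freeP[C BC] : row_free B.
  apply/inj_row_free => v vB; apply/rowP => k; rewrite mxE.
  move/freeP: freeA => freeA; apply: (freeA (fun k => v 0 k)).
  apply: (can_inj mxvecK); rewrite linear_sum linear0 -[RHS]vB mulmx_sum_row.
  by apply: eq_bigr => i _; rewrite linearZ/= rowK (tnth_nth 0).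
exists (fun ij m => C (mxvec_index ij.1 ij.2) m) => y k.
transitivity (\sum_m (B *m C) k m * y m); last first.
  rewrite BC (bigD1 k)//= mxE eqxx mul1r big1 ?addr0// => m mk.
  by rewrite mxE eq_sym (negbTE mk) mul0r.
under eq_bigr do rewrite mulr_suml.
rewrite exchange_big/=; apply: eq_bigr => m _.
rewrite mxE mulr_suml (reindex _ (curry_mxvec_bij _ _))/=.
by apply: eq_bigr => -[i j] _ /=; rewrite !mxE mxvecE; ring.
Qed.

Lemma contraction_homotopy (X : topologicalType) (x0 : X) (F : X * R -> X) :
  continuous F -> (forall u, F (u, 0) = u) -> (forall u, F (u, 1) = x0) ->
  homotopic R id (cst x0) /\ homotopic R (cst x0) id.
Proof.
move=> cF F0 F1; split.
  by exists F; split => //; exact: continuous_subspaceT.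
exists (fun z => F (z.1, 1 - z.2)); split => [|u|u] /=; last 2 first.
- by rewrite subr0.
- by rewrite subrr.
apply: continuous_subspaceT => -[u t].
have c2 : (fun z : X * R => 1 - z.2) @ (u, t) --> 1 - t.
  by apply: cvgB; [exact: cvg_cst|exact: cvg_snd].
have c1 : (fun z : X * R => z.1) @ (u, t) --> u by exact: cvg_fst.
have c12 : (fun z : X * R => (z.1, 1 - z.2)) @ (u, t) --> (u, 1 - t).
  exact: (cvg_pair c1 c2).
exact: (cvg_comp _ _ c12 (cF (u, 1 - t))).
Qed.

Lemma fibres_contractible (W : {vspace 'M[R]_d}) (A : l.-tuple 'M[R]_d) :
  grassmannian R d l W -> basis_of W A -> forall p : 'rV[R]_d * 'rV[R]_l,
  homotopy_equivalent R (Omega A p) (Omega A (0, 0)) /\ contractible R (Omega A p).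
Proof.
move=> [_ skewW] /andP[/eqP spanA freeA].
have skewA k : (tnth A k)^T = - tnth A k.
  by apply: skewW; rewrite -spanA memv_span// mem_tnth.
have [c cA] := free_right_inverse freeA.
move=> [x y].
have [x0 [F [cF F0 F1]]] := fibre_contraction skewA cA x y.
have [x1 [G [cG G0 G1]]] := fibre_contraction skewA cA 0 0.
have [h1 h1'] := contraction_homotopy cF F0 F1.
have [h2 h2'] := contraction_homotopy cG G0 G1.
split; last by exists x0.
(* Between contractible spaces, constant maps are mutually inverse homotopy equivalences. *)
by exists (cst x1), (cst x0); split => //; exact: cst_continuous.
Qed.

End Fibres.

(** * Completeness of L^2 *)

Section Completeness.
Context (R : realType).
Local Notation mu := (leb02pi R).

Lemma S2B (f g : R -> R) : S2 f -> S2 g -> S2 (fun t => f t - g t).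
Proof.
move=> Sf Sg; have := S2D Sf (S2Z (-1) Sg).
by congr S2; apply/funext => t; rewrite /= mulN1r.
Qed.

Lemma limn_einf_le (u : (\bar R)^nat) (a : \bar R) :
  (forall n, (u n <= a)%E) -> (limn_einf u <= a)%E.
Proof.
move=> ua; rewrite limn_einf_lim; apply: lime_le; first exact: is_cvg_einfs.
apply: nearW => n; apply: le_trans (ua n); apply: ereal_inf_lbound.
by exists n => //=.
Qed.

(* Riesz-Fischer: on a finite measure, fast Cauchy sequences for the norm of
   L^2 converge almost everywhere, since their increments are summable in L^1. *)
Lemma S2_fast_cauchy_ae (f : nat -> R -> R) : (forall n, S2 (f n)) ->
  (forall n, \int[mu]_t (f n.+1 t - f n t) ^+ 2 <= (4 ^-1) ^+ n) ->
  {ae mu, forall t, cvgn (fun n => f n t)}.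
Proof.
move=> Sf fn; pose a n t := f n.+1 t - f n t.
have Sa n : S2 (a n) by exact: S2B.
have ma n : measurable_fun setT (fun t => `|(a n t)%:E|%E).
  by apply: measurableT_comp => //; apply/measurable_EFinP; exact: S2_measurable.
have mu2 : fine (mu setT) <= 2 * pi.
  have p0 : 0 <= 2 * pi :> R by rewrite mulr_ge0 ?pi_ge0.
  have -> : mu setT = mu `[0, 2 * pi]%classic.
    by rewrite /leb02pi/= /mrestr setTI setIid.
  by rewrite leb02pi_sub_itv//= subr0.
(* From |a| <= 2^n a^2 + 2^-n: the first term integrates to at most 2^n 4^-n, the second to at most
   2 pi 2^-n. *)
have inta n : (\int[mu]_t `|(a n t)%:E| <= ((1 + 2 * pi) * (2 ^-1) ^+ n)%:E)%E.
  have ia2 : mu.-integrable setT (EFin \o (fun t => 2 ^+ n * a n t ^+ 2)).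
    by apply: integrable_EFinZ; exact: S2_sqr.
  have ic : mu.-integrable setT (EFin \o (fun t => (2 ^- n : R) * 1)).
    by apply: integrable_EFinZ; exact/S2_integrable/S2_cst.
  have ->: (\int[mu]_t `|(a n t)%:E| = (\int[mu]_t `|a n t|)%:E)%E.
    rewrite fineK//; apply: integrable_fin_num => //.
    exact: (integrable_abse (S2_integrable (Sa n))).
  rewrite lee_fin; apply: le_trans (_ : \int[mu]_t (2 ^+ n * a n t ^+ 2 + 2 ^- n * 1) <= _).
    apply: le_Rintegral => //.
    - exact: (integrable_abse (S2_integrable (Sa n))).
    - have := integrable_EFinB ia2 (integrable_EFinZ (-1) ic).
      by congr integrable; apply/funext => t /=; rewrite mulN1r opprK.
    move=> t _; rewrite mulr1 -(real_normK (num_real (a n t))).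
    have p2 : 0 < 2 ^+ n :> R by exact: exprn_gt0.
    have := sqr_ge0 (2 ^+ n * `|a n t| - 1 / 2).
    rewrite -(@ler_pM2l _ (2 ^+ n)^-1) ?invr_gt0// mulr0.
    have -> : (2 ^+ n)^-1 * (2 ^+ n * `|a n t| - 1 / 2) ^+ 2 =
      2 ^+ n * `|a n t| ^+ 2 - `|a n t| + (2 ^+ n)^-1 / 4 by field; rewrite gt_eqF.
    have : 0 < (2 ^+ n)^-1 :> R by rewrite invr_gt0.
    by lra.
  rewrite RintegralD//= RintegralZl//; last exact: S2_sqr.
  rewrite Rintegral_cst// mulr1 mulrDl mul1r; apply: lerD.
    rewrite -ler_pdivlMl ?exprn_gt0// (le_trans (fn n))//.
    by rewrite -exprVn -exprMn; apply: lerXn2r; rewrite ?nnegrE; lra.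
  rewrite mulrC -exprVn; apply: ler_wpM2r; [by rewrite exprn_ge0|exact: mu2].
have sumlty : (\int[mu]_t (\sum_(n <oo) `|(a n t)%:E|) < +oo)%E.
  rewrite integral_nneseries//; pose r : R := 2 * (1 + 2 * pi).
  have hr := @cvg_geometric_eseries_half R r 0%N.
  apply: le_lt_trans (_ : (\sum_(n <oo) (r / (2 ^ (n + 1))%:R)%:E < +oo)%E).
    apply: lee_nneseries => [n _ _|n _]; first exact: integral_ge0.
    apply: le_trans (inta n) _; rewrite lee_fin /r addn1 natrX [2 ^+ n.+1]exprS exprVn.
    rewrite invfM mulrACA divff ?mul1r//.
  by rewrite (cvg_lim _ hr)//= ltry.
have intsum : mu.-integrable setT (fun t => \sum_(n <oo) `|(a n t)%:E|)%E.
  apply/integrableP; split.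
    by apply: ge0_emeasurable_sum => [n t _ _|n _]; [exact: abse_ge0|exact: ma].
  apply: le_lt_trans sumlty; rewrite le_eqVlt; apply/orP; left; apply/eqP.
  by apply: eq_integral => t _; rewrite gee0_abs// nneseries_ge0.
have := integrable_ae measurableT intsum.
apply: filterS => t /(_ I) sfin.
have cs : cvgn (series (fun n => a n t)).
  apply: normed_cvg; apply: nondecreasing_is_cvgn.
    by apply: nondecreasing_series => n _ _ ; rewrite normr_ge0.
  exists (fine (\sum_(n <oo) `|(a n t)%:E|)%E) => _ [n _ <-].
  rewrite -lee_fin fineK// /normed_series_of /series /= -sumEFin.
  by apply: (@nneseries_lim_ge _ (fun n => `|(a n t)%:E|%E) xpredT 0%N n) => k _ _; exact: abse_ge0.
have -> : (fun n => f n t) = (fun n => f 0%N t + series (fun n => a n t) n).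
  by apply/funext => n; rewrite (eq_sum_telescope (fun n => f n t) n).
by apply: is_cvgD => //; exact: is_cvg_cst.
Qed.

(** The limit is taken as a pointwise upper limit, measurable everywhere and equal to the limit
    almost everywhere; Fatou's lemma then carries the bounds over to it. *)
Lemma S2_complete (f : nat -> R -> R) : (forall n, S2 (f n)) ->
  (forall n m, (n <= m)%N -> \int[mu]_t (f m t - f n t) ^+ 2 <= (4 ^-1) ^+ n) ->
  exists2 g, S2 g & forall n, \int[mu]_t (g t - f n t) ^+ 2 <= (4 ^-1) ^+ n.
Proof.
move=> Sf fmn; have cf := S2_fast_cauchy_ae Sf (fun n => fmn n n.+1 (leqnSn n)).
pose g t := fine (limn_esup (fun n => (f n t)%:E)).
have mg : measurable_fun setT g.
  apply: measurableT_comp => //; apply: measurable_fun_limn_esup => n.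
  by apply/measurable_EFinP; exact: S2_measurable.
have fg : {ae mu, forall t, (fun n => f n t) @ \oo --> g t}.
  apply: filterS cf => t /cvg_ex[x fx].
  have : (fun n => (f n t)%:E) @ \oo --> x%:E by apply: cvg_EFin => //; apply: nearW.
  by move=> /cvg_limn_einf_sup[_]; rewrite /g => ->.
have Sfn m n : S2 (fun t => f m t - f n t) by exact: S2B.
have mgf n : measurable_fun setT (fun t => ((g t - f n t) ^+ 2)%:E).
  apply/measurable_EFinP; apply: measurable_funX; apply: measurable_funB => //.
  exact: S2_measurable.
have bound n : (\int[mu]_t ((g t - f n t) ^+ 2)%:E <= ((4 ^-1) ^+ n)%:E)%E.
  pose F m t := ((f (m + n)%N t - f n t) ^+ 2)%:E.
  have mF m : measurable_fun setT (F m).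
    by apply/measurable_EFinP; apply: measurable_funX; exact: S2_measurable.
  have -> : (\int[mu]_t ((g t - f n t) ^+ 2)%:E = \int[mu]_t limn_einf (F ^~ t))%E.
    apply: ae_eq_integral => //; first exact: mgf.
      rewrite (_ : (fun t => _) = (fun t => - limn_esup (fun m => - F m t))%E).
        apply: (measurableT_comp (@oppe_measurable R setT)).
        apply: measurable_fun_limn_esup => m.
        by apply: (measurableT_comp (@oppe_measurable R setT)); exact: mF.
      by apply/funext => t; rewrite /limn_einf.
    apply: filterS fg => t ft _; apply/esym.
    suff /cvg_limn_einf_sup[->] : (F ^~ t) @ \oo --> ((g t - f n t) ^+ 2)%:E by [].
    apply: cvg_EFin; first by apply: nearW => m.
    rewrite /comp /=.
    have ftn : (fun m => f (m + n)%N t) @ \oo --> g t.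
      by have := cvg_shiftn n (fun m => f m t) (nbhs (g t)) => ->.
    rewrite [X in X @ _ --> _](_ : _ = (fun m => (f (m + n)%N t - f n t) * (f (m + n)%N t - f n t))); last first.
      by apply/funext => m.
    by rewrite expr2; apply: cvgM; apply: cvgB => //; exact: cvg_cst.
  apply: le_trans.
    by apply: (@fatou _ _ _ mu _ measurableT F mF) => m t _; rewrite lee_fin sqr_ge0.
  apply: limn_einf_le => m.
  have -> : (\int[mu]_t F m t = (\int[mu]_t (f (m + n)%N t - f n t) ^+ 2)%:E)%E.
    by rewrite fineK//; apply: integrable_fin_num => //; exact: S2_sqr.
  by rewrite lee_fin fmn// leq_addl.
have Sgf n : S2 (fun t => g t - f n t).
  apply: S2P; first by apply: measurable_funB => //; exact: S2_measurable.
  apply/integrableP; split; first exact: mgf.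
  apply: le_lt_trans (le_lt_trans (bound n) (ltry _)).
  rewrite le_eqVlt; apply/orP; left; apply/eqP; apply: eq_integral => t _.
  by rewrite gee0_abs// lee_fin sqr_ge0.
exists g.
  have := S2D (Sgf 0%N) (Sf 0%N).
  by congr S2; apply/funext => t; rewrite /= subrK.
move=> n; rewrite -lee_fin fineK//; apply: integrable_fin_num => //.
exact: S2_sqr.
Qed.

End Completeness.

Section CompleteL2.
Context (R : realType) (d : nat).
Local Notation mu := (leb02pi R).
Local Notation H := (L2 R d).
Implicit Types (u v : H) (i : 'I_d).
Local Hint Resolve S2_L2fun measurable_L2fun : core.

Lemma L2fun_mkB F u i : (forall j, S2 (F j)) ->
  L2fun (mkL2 F - u) i = (fun t => F i t - L2fun u i t) %[ae mu].
Proof.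
move=> SF; rewrite -scaleN1r.
apply: filterS (filterI (L2funD (mkL2 F) (-1 *: u) i)
  (filterI (L2fun_mk i SF) (L2funZ (-1) u i))) => t [h1 [h2 h3]] Dt.
by rewrite h1//= h2// h3// mulN1r.
Qed.

Lemma L2norm_mkB F u : (forall i, S2 (F i)) ->
  `|mkL2 F - u| ^+ 2 = \sum_i \int[mu]_t (F i t - L2fun u i t) ^+ 2.
Proof.
move=> SF; rewrite L2norm_sqr; apply: eq_bigr => i _.
under eq_Rintegral do rewrite -expr2.
apply: eq_Rintegral_ae.
- by apply: measurable_funX; exact: measurable_L2fun.
- by apply: measurable_funX; apply: S2_measurable; exact: S2B.
by apply: filterS (L2fun_mkB u i SF) => t h Dt; rewrite h.
Qed.

Lemma mkL2_L2fun u : mkL2 (L2fun u) = u.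
Proof. by apply: eq_L2 => i; exact: L2fun_mk. Qed.

(** Centres of balls of radius 2^-(n+1) belonging to F form a sequence with |u_m - u_n| <= 2^-n for
    n <= m, hence with squared distances at most 4^-n, as [S2_complete] expects in each
    coordinate. *)
Lemma L2_cauchy_cvg (F : set_system H) : ProperFilter F -> cauchy F -> cvg F.
Proof.
move=> FF /cauchyP Fc; pose e n : R := 2^-1 ^+ n.+1.
have e_gt0 n : 0 < e n by rewrite exprn_gt0// invr_gt0.
have [u Fu] := choice (fun n => Fc (e n) (e_gt0 n)).
have uB n m : (n <= m)%N -> `|u m - u n| <= 2^-1 ^+ n.
  move=> nm; have [x [xn xm]] := filter_ex (filterI (Fu n) (Fu m)).
  move: xn xm; rewrite -!ball_normE /= => xn xm.
  have enm : e m <= e n by apply: ler_wiXn2l; rewrite ?invr_ge0 ?invf_le1//; lra.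
  have -> : u m - u n = (u m - x) - (u n - x) by rewrite opprB addrA subrK.
  apply: le_trans (ler_normB _ _) _.
  have : 2^-1 ^+ n = e n + e n :> R by rewrite /e exprS; lra.
  by lra.
have cauchy i n m : (n <= m)%N ->
    \int[mu]_t (L2fun (u m) i t - L2fun (u n) i t) ^+ 2 <= (4 ^-1) ^+ n.
  move=> nm; have -> : 4^-1 ^+ n = (2^-1 ^+ n) ^+ 2 :> R.
    by rewrite -!exprM mulnC exprM; congr (_ ^+ _); rewrite expr2 -invfM -natrM.
  apply: le_trans (_ : `|u m - u n| ^+ 2 <= _); last first.
    by apply: lerXn2r; rewrite ?nnegrE ?exprn_ge0 ?invr_ge0 ?uB.
  rewrite -[u m]mkL2_L2fun L2norm_mkB ?mkL2_L2fun// (bigD1 i)//= lerDl.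
  by apply: sumr_ge0 => j _; apply: Rintegral_ge0 => t _; exact: sqr_ge0.
have /choice[g gP] : forall i, exists g, S2 g /\ forall n,
    \int[mu]_t (g t - L2fun (u n) i t) ^+ 2 <= (4 ^-1) ^+ n.
  move=> i; have [g Sg gP] := S2_complete (fun n => S2_L2fun (u n) i) (cauchy i).
  by exists g.
apply/cvg_ex; exists (mkL2 g); apply/cvg_ballP => r r0.
have gu n : `|mkL2 g - u n| <= d.+1%:R * 2^-1 ^+ n.
  rewrite -(@ler_pXn2r _ 2)// ?nnegrE ?mulr_ge0 ?exprn_ge0 ?invr_ge0//.
  rewrite L2norm_mkB => [|i]; last by case: (gP i).
  apply: le_trans (_ : \sum_(i < d) 4^-1 ^+ n <= _).
    by apply: ler_sum => i _; case: (gP i).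
  rewrite sumr_const card_ord -[leLHS]mulr_natl exprMn -exprM mulnC exprM.
  rewrite (_ : 2^-1 ^+ 2 = 4^-1); last by rewrite expr2 -invfM -natrM.
    apply: ler_wpM2r; first by rewrite exprn_ge0// invr_ge0.
  by rewrite -natrX ler_nat (leq_trans (leqnSn d))// -{1}[d.+1]expn1 leq_pexp2l.
pose n := Num.Def.archi_bound ((d.+2)%:R / r).
have hn : (d.+2)%:R * 2^-1 ^+ n < r.
  have h : (d.+2)%:R / r < n%:R by apply: archi_boundP; rewrite divr_ge0// ltW.
  have {}h : (d.+2)%:R / r < 2 ^+ n.
    by apply: lt_le_trans h _; rewrite -natrX ler_nat ltnW// ltn_expl.
  by rewrite exprVn ltr_pdivrMr ?exprn_gt0// mulrC -ltr_pdivrMr.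
apply: filterS (Fu n) => x; rewrite -!ball_normE /= => xn.
have -> : mkL2 g - x = (mkL2 g - u n) + (u n - x) by rewrite addrA subrK.
apply: le_lt_trans (ler_normD _ _) _.
have en : e n <= 2^-1 ^+ n.
  by rewrite /e exprS ler_piMl ?exprn_ge0 ?invr_ge0// invf_le1// ler1n.
have := gu n; move: hn; rewrite -natr1 mulrDl mul1r; lra.
Qed.

End CompleteL2.

(** * Orthogonal complements as Hilbert spaces *)

Section OrthogonalComplement.
Context (R : realType) (d : nat) (I : Type) (g : I -> L2 R d).
Local Notation H := (L2 R d).

Definition perp_pred : {pred H} := fun u => `[< forall i, L2dot (g i) u = 0 >].

Fact perp_submod_closed : submod_closed perp_pred.
Proof.
split; first by apply/asboolP => i; rewrite L2dot0r.
move=> a u v /asboolP u0 /asboolP v0; apply/asboolP => i.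
by rewrite L2dotDr L2dotZr u0 v0 mulr0 addr0.
Qed.
HB.instance Definition _ := GRing.isSubmodClosed.Build R H perp_pred perp_submod_closed.

Record perp := Perp { perp_val :> H; perp_valP : perp_val \in perp_pred }.
HB.instance Definition _ := [isSub for perp_val].
HB.instance Definition _ := [Choice of perp by <:].
HB.instance Definition _ := [SubChoice_isSubLmodule of perp by <:].

Lemma perpP (u : perp) i : L2dot (g i) (val u) = 0.
Proof. by case: u => u /= /asboolP. Qed.

Fact perp_normD (x y : perp) : `|val (x + y)| <= `|val x| + `|val y|.
Proof. by rewrite raddfD ler_normD. Qed.

Fact perp_normZ (a : R) (x : perp) : `|val (a *: x)| = `|a| * `|val x|.
Proof. by rewrite linearZ/= normrZ. Qed.

Fact perp_norm0 (x : perp) : `|val x| = 0 -> x = 0.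
Proof. by move=> /normr0_eq0 x0; apply: val_inj; rewrite x0. Qed.

HB.instance Definition _ := Lmodule_isNormed.Build R perp
  perp_normD perp_normZ perp_norm0.

Lemma perp_normE (x : perp) : `|x| = `|val x|. Proof. by []. Qed.

Fact perp_cauchy_cvg (F : set_system perp) : ProperFilter F -> cauchy F -> cvg F.
Proof.
move=> FF /cauchyP Fc.
have cF : cauchy (val @ F).
  apply/cauchyP => e e0; have [x Fx] := Fc e e0; exists (val x).
  suff : F (val @^-1` ball (val x) e) by [].
  apply: filterS Fx => y; rewrite /preimage -!ball_normE /= => xy.
  by move: xy; rewrite perp_normE raddfB.
have /cvg_ex[u Fu] : cvg (val @ F) by exact: L2_cauchy_cvg.
have pu : u \in perp_pred.
  apply/asboolP => i.
  have c := cvg_comp _ _ Fu (@L2dotr_continuous R d (g i) u).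
  apply: (@cvg_unique _ (@Rhausdorff R) _ _ _ _ c).
  rewrite [X in X @ _](_ : _ = cst 0); last first.
    by apply/funext => x /=; rewrite perpP.
  exact: cvg_cst.
apply/cvg_ex; exists (Perp pu); apply/cvg_ballP => e e0.
have /cvg_ballP/(_ e e0) := Fu.
rewrite /fmap/= => h; apply: filterS h => x; rewrite /preimage -!ball_normE /= => xy.
by rewrite perp_normE raddfB.
Qed.
HB.instance Definition _ := Uniform_isComplete.Build perp perp_cauchy_cvg.

Definition perp_complete : completeNormedModType R := perp.

Lemma perp_hilbertian : hilbertian perp_complete.
Proof.
exists (fun x y => L2dot (val x) (val y)); split.
- by move=> x y; rewrite L2dotC.
- by move=> a x y z; rewrite linearP L2dotDl L2dotZl.
by move=> x; rewrite -L2norm_sqr.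
Qed.

End OrthogonalComplement.

(** * Charts of the fibres *)

Section Projection.
Context (R : realType) (d : nat) (I : finType) (g w : I -> L2 R d).
Hypothesis gw : forall i j, L2dot (g i) (w j) = (i == j)%:R.
Local Notation H := (L2 R d).

Fact perp_proj_subproof (h : H) : h - \sum_i L2dot (g i) h *: w i \in perp_pred g.
Proof.
apply/asboolP => i; rewrite L2dotBr L2dot_sumr (bigD1 i)//= L2dotZr gw eqxx mulr1.
by rewrite big1 ?addr0 ?subrr// => j ji; rewrite L2dotZr gw eq_sym (negbTE ji) mulr0.
Qed.

(** An oblique projection: its image is the orthogonal of the g_i, but its kernel is the span of the
    dual family w, which may depend on the point. *)
Definition perp_proj (h : H) : perp g := Perp (perp_proj_subproof h).

Fact perp_proj_linear : linear perp_proj.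
Proof.
move=> a u v; apply: val_inj; rewrite [RHS]linearP/= scalerBr addrACA -opprD; congr (_ - _).
rewrite scaler_sumr -big_split; apply: eq_bigr => i _ /=.
by rewrite L2dotDr L2dotZr scalerDl scalerA.
Qed.
HB.instance Definition _ := GRing.isLinear.Build R H (perp g) _ perp_proj perp_proj_linear.

Lemma perp_proj_continuous : continuous perp_proj.
Proof.
apply: (@bounded_linear_continuous _ _ _ _ (1 + \sum_i `|g i| * `|w i|)) => h.
rewrite perp_normE /= mulrDl mul1r (le_trans (ler_normB _ _))// lerD2l.
rewrite (le_trans (ler_norm_sum _ _ _))// mulr_suml; apply: ler_sum => i _.
by rewrite normrZ mulrAC ler_wpM2r// L2dot_le.
Qed.

Lemma perp_proj_id (k : perp g) : perp_proj (val k) = k.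
Proof.
apply: val_inj => /=; rewrite big1 ?subr0// => i _.
by have := perpP k i; rewrite /= => ->; rewrite scale0r.
Qed.

Lemma perp_proj_dual j : perp_proj (w j) = 0.
Proof.
apply: val_inj => /=; rewrite (bigD1 j)//= gw eqxx scale1r big1 ?addr0 ?subrr// => i ij.
by rewrite gw (negbTE ij) scale0r.
Qed.

Lemma perp_val_continuous : continuous (\val : perp g -> H).
Proof.
by apply: (@bounded_linear_continuous R (perp g) H \val 1) => k; rewrite mul1r perp_normE.
Qed.

End Projection.

(** * The polar form of the area *)

Section AreaSym.
Context (R : realType) (d : nat) (M : 'M[R]_d).
Local Notation H := (L2 R d).

(** The differential of u -> area M u u, at u in the direction v. *)
Definition area_sym (u v : H) : R := area M u v + area M v u.

Fact area_sym_linear u : linear (area_sym u).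
Proof. by move=> a v w; rewrite /area_sym areaPr areaPl scalerDr addrACA. Qed.
HB.instance Definition _ u :=
  GRing.isLinear.Build R H R _ (area_sym u) (area_sym_linear u).

Lemma area_sym_continuous u : continuous (area_sym u).
Proof.
apply: (@bounded_linear_continuous _ _ _ _ (mx_norm1 M * (2 * pi) * `|u| * 2)) => v.
rewrite (le_trans (ler_normD _ _))//.
have := area_le M u v; have := area_le M v u.
set a := _ * _ * _ * `|u|; set b := _ * _ * _ * `|v|.
rewrite (_ : a = b); last by rewrite /a /b; ring.
rewrite (_ : _ * _ * `|v| = b + b); last by rewrite /b; ring.
by move=> *; exact: lerD.
Qed.

Lemma area_suml (I : Type) (r : seq I) (f : I -> H) v :
  area M (\sum_(i <- r) f i) v = \sum_(i <- r) area M (f i) v.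
Proof. by apply: (big_morph (area M ^~ v)) => [x y|]; rewrite ?areaDl ?area0l. Qed.

Lemma area_sumr (I : Type) (r : seq I) (f : I -> H) v :
  area M v (\sum_(i <- r) f i) = \sum_(i <- r) area M v (f i).
Proof. by apply: (big_morph (area M v)) => [x y|]; rewrite ?areaDr ?area0r. Qed.

Lemma Ck_area k (U : set H) : Ck k U (fun h : H => area M h h).
Proof.
have lin_a : bilinear_for (GRing.Scale.Law.clone _ _ *:%R _)
    (GRing.Scale.Law.clone _ _ *:%R _) (area M).
  by split=> z a w w'; [exact: areaPl|exact: areaPr].
pose b : {bilinear H -> H -> R} := HB.pack (area M)
  (bilinear_isBilinear.Build R H H R _ _ (area M) lin_a).
apply: (@Ck_quad _ _ _ _ b); exact: area_continuous.
Qed.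

Lemma area_sqrD (u v : H) :
  area M (u + v) (u + v) = area M u u + area_sym u v + area M v v.
Proof. by rewrite areaDl !areaDr /area_sym !addrA. Qed.

(* This is what makes the equation of a fibre linear in s, and its charts explicit. *)
Lemma area_isotropic (I : finType) (u : H) (s : I -> R) (v : I -> H) :
  (forall i j, area M (v i) (v j) = 0) ->
  area M (u + \sum_i s i *: v i) (u + \sum_i s i *: v i) =
  area M u u + \sum_i s i * area_sym (v i) u.
Proof.
move=> v0; set S := \sum_i _.
have uS : area M u S = \sum_i s i * area M u (v i).
  by rewrite area_sumr; apply: eq_bigr => i _; rewrite areaZr.
have Su : area M S u = \sum_i s i * area M (v i) u.
  by rewrite area_suml; apply: eq_bigr => i _; rewrite areaZl.
have SS : area M S S = 0.
  rewrite area_suml big1// => i _; rewrite areaZl area_sumr big1 ?mulr0// => j _.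
  by rewrite areaZr v0 mulr0.
clearbody S.
rewrite area_sqrD SS addr0 /area_sym Su uS addrC -big_split/= addrC; congr (_ + _).
by apply: eq_bigr => i _; rewrite /area_sym mulrDr addrC.
Qed.

End AreaSym.

Section Chart.
Context (R : realType) (d l : nat) (A : l.-tuple 'M[R]_d).
Context (g w : 'I_d + 'I_l -> L2 R d) (u0 : L2 R d) (y : 'rV[R]_l).
Local Notation H := (L2 R d).
Local Notation v := (fun j => w (inr j)).
Hypothesis gw : forall i j, L2dot (g i) (w j) = (i == j)%:R.
Hypothesis g_inl : forall i, g (inl i) = tens1 (delta_mx 0 i).
Hypothesis v_isotropic : forall k i j, area (tnth A k) (v i) (v j) = 0.
Hypothesis u0y : endpoint A u0 = (0, y).

(** The differential at u0 + h of the vertical coordinates, restricted to the directions v_j. As y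
    is the value at u0, [chart_col h] is y minus the vertical value at u0 + h. *)
Definition chart_mx (h : H) : 'M[R]_l :=
  \matrix_(i, j) area_sym (tnth A i) (v j) (u0 + h).
Definition chart_col (h : H) : 'cV[R]_l :=
  \col_i (- area_sym (tnth A i) u0 h - area (tnth A i) h h).
Definition chart_sol h : 'cV[R]_l := invmx (chart_mx h) *m chart_col h.
Definition chart_inv h : H := u0 + h + \sum_j chart_sol h j 0 *: v j.

Lemma LintE_dual u i : Lint u 0 i = L2dot (g (inl i)) u.
Proof. by rewrite g_inl LintE. Qed.

Lemma Lint_u0 : Lint u0 = 0.
Proof. by have := u0y; rewrite endpointE => -[]. Qed.

Lemma Lint_isotropic j : Lint (v j) = 0.
Proof. by apply/rowP => i; rewrite LintE_dual gw mxE. Qed.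

Lemma Lint_perp (k : perp g) : Lint (val k) = 0.
Proof. by apply/rowP => i; rewrite LintE_dual perpP mxE. Qed.

Lemma endpoint_chart h (s : 'I_l -> R) : Lint h = 0 ->
  endpoint A (u0 + h + \sum_j s j *: v j) = (0, y) <->
  chart_mx h *m (\col_j s j) = chart_col h.
Proof.
move=> h0; rewrite endpointE.
have -> : Lint (u0 + h + \sum_j s j *: v j) = 0.
  rewrite !linearD/= Lint_u0 h0 linear_sum big1 ?addr0// => j _.
  by rewrite linearZ/= Lint_isotropic scaler0.
have yk k : y 0 k = area (tnth A k) u0 u0.
  by have := u0y; rewrite endpointE => -[_ <-]; rewrite mxE.
have E k : area (tnth A k) (u0 + h + \sum_j s j *: v j) (u0 + h + \sum_j s j *: v j)
    - y 0 k = (chart_mx h *m \col_j s j) k 0 - chart_col h k 0.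
  rewrite (@area_isotropic _ _ _ _ _ s v); last exact: v_isotropic.
  have -> : (chart_mx h *m \col_j s j) k 0 = \sum_j s j * area_sym (tnth A k) (v j) (u0 + h).
    by rewrite mxE; apply: eq_bigr => j _; rewrite !mxE mulrC.
  rewrite yk mxE area_sqrD.
  move: (area _ u0 u0) (area_sym _ u0 h) (area _ h h) (\sum_j _) => a b c e.
  by ring.
split=> [[/rowP hy]|hs].
  apply/colP => k; apply/eqP; rewrite -subr_eq0 -E; have := hy k; rewrite mxE => ->.
  by rewrite subrr.
congr pair; apply/rowP => k; rewrite mxE; apply/eqP; rewrite -subr_eq0 E hs.
by rewrite subrr.
Qed.

Definition chart_dom : set H := [set h | \det (chart_mx h) != 0].

Lemma Ck_chart_mx k U i j : open U -> Ck k U (fun h : H => chart_mx h i j).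
Proof.
move=> oU; rewrite (_ : (fun _ => _) =
  cst (area_sym (tnth A i) (v j) u0) + area_sym (tnth A i) (v j)).
  apply: CkD => //; first exact: Ck_cst.
  by apply: Ck_lin; exact: area_sym_continuous.
by apply/funext => h; rewrite mxE linearD.
Qed.

Lemma Ck_chart_col k U i : open U -> Ck k U (fun h : H => chart_col h i 0).
Proof.
move=> oU; rewrite (_ : (fun _ => _) = cst (-1) *
  (area_sym (tnth A i) u0 + (fun h : H => area (tnth A i) h h))).
  apply: CkM => //; first exact: Ck_cst.
  apply: CkD => //; last exact: Ck_area.
  by apply: Ck_lin; exact: area_sym_continuous.
by apply/funext => h; rewrite mxE -opprD !fctE mulN1r.
Qed.

Lemma open_chart_dom : open chart_dom.
Proof.
rewrite (_ : chart_dom = (fun h => \det (chart_mx h)) @^-1` [set~ 0]).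
  apply: open_comp; last exact: closed_openC.
  move=> h _; have /(_ h I) := @Ck_det R 0 H setT l chart_mx openT
    (fun i j => Ck_chart_mx 0 i j openT).
  by [].
by apply/seteqP; split => h /eqP.
Qed.

Lemma Ck_chart_inv k : Ck k chart_dom chart_inv.
Proof.
have oD := open_chart_dom.
have Cs j : Ck k chart_dom (fun h => chart_sol h j 0).
  rewrite (_ : (fun _ => _) =
    (fun h => \sum_i invmx (chart_mx h) j i * chart_col h i 0)); last first.
    by apply/funext => h; rewrite mxE.
  apply: Ck_sum => // i; apply: CkM => //; last exact: Ck_chart_col.
  apply: Ck_invmx => // [h|a b]; last exact: Ck_chart_mx.
  by rewrite unitmxE unitfE.
have Cv j : Ck k chart_dom (fun h => chart_sol h j 0 *: v j).
  pose f (a : R) : H := a *: v j.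
  have lin_f : linear f by move=> a b c; rewrite /f scalerDl -scalerA.
  pose F : {linear R -> H} := HB.pack f (GRing.isLinear.Build _ _ _ _ _ lin_f).
  apply: (Ck_lin_comp oD (h := F)) (Cs j).
  by apply: (@bounded_linear_continuous _ _ _ F `|v j|) => a; rewrite normrZ mulrC.
rewrite (_ : chart_inv = cst u0 + (idfun + (fun h => \sum_j chart_sol h j 0 *: v j))).
  apply: CkD => //; first exact: Ck_cst.
  apply: CkD => //; last exact: Ck_sum.
  by apply: (@Ck_lin _ _ _ _ _ (idfun : {linear H -> H})) => h; exact: cvg_id.
by apply/funext => h; rewrite /chart_inv addrA.
Qed.

(** The chart is the projection of u - u0 along the dual family. Its source is the whole preimage of
    V, without any bound on s: the equation being linear in s, each h in V has exactly one point of
    the fibre above it. *)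
Lemma fibre_chart : \det (chart_mx 0) != 0 ->
  exists (U : set H) (V : set (perp_complete g)) (phi : H -> perp_complete g)
    (psi : perp_complete g -> H),
  [/\ open U, U u0 & open V] /\
  [/\ smooth_on U phi, smooth_on V psi,
      forall x, (Omega A (0, y) `&` U) x -> V (phi x) /\ psi (phi x) = x
    & forall k, V k -> (Omega A (0, y) `&` U) (psi k) /\ phi (psi k) = k].
Proof.
move=> det0; have cval := @perp_val_continuous R d _ g.
pose V : set (perp_complete g) := \val @^-1` chart_dom.
have oV : open V by apply: open_comp open_chart_dom => k _; exact: cval.
pose phi u : perp_complete g := perp_proj gw (u - u0).
pose psi (k : perp_complete g) : H := chart_inv (val k).
have phiE : phi = cst (- perp_proj gw u0) + perp_proj gw.
  by apply/funext => u; rewrite /phi linearB addrC.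
have Cphi n U : open U -> Ck n U phi.
  move=> oU; rewrite phiE; apply: CkD => //; first exact: Ck_cst.
  by apply: Ck_lin; exact: perp_proj_continuous.
have cphi : continuous phi by move=> u; exact: (Cphi 0%N setT openT).
exists (phi @^-1` V), V, phi, psi; split.
  split; [by apply: open_comp oV => u _; exact: cphi| |exact: oV].
  by rewrite /preimage/= /phi subrr linear0.
have phi_psi k : phi (psi k) = k.
  rewrite /phi /psi /chart_inv [_ - u0]addrC !addrA addNr add0r linearD.
  rewrite [X in X + _]perp_proj_id linear_sum big1 ?addr0// => j _.
  by rewrite linearZ/= perp_proj_dual scaler0.
split.
- by move=> n; apply: Cphi; apply: open_comp oV => u _; exact: cphi.
- move=> n; exact: (@Ck_comp_lin _ n _ _ _ _ _ (\val : {linear perp_complete g -> H})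
    open_chart_dom cval (Ck_chart_inv n)).
- move=> u [uO Vu]; split => //.
  pose s j := L2dot (g (inr j)) (u - u0).
  have uE : u = u0 + val (phi u) + \sum_j s j *: v j.
    (* The components along the [w (inl i)] are the coordinates of Lint (u - u0), which is 0 since u
       and u0 both end over x = 0. *)
    rewrite /= big_sumType /= big1 ?add0r; last first.
      move=> i _; rewrite -LintE_dual linearB/= Lint_u0 subr0.
      by have := uO; rewrite /Omega /= endpointE => -[-> _]; rewrite mxE scale0r.
    by rewrite -/s addrA subrK addrC subrK.
  have := uO; rewrite /Omega /= {1}uE endpoint_chart; last exact: Lint_perp.
  move=> hs; rewrite [RHS]uE /psi /chart_inv; congr (_ + _); apply: eq_bigr => j _.
  rewrite /chart_sol -hs mulKmx ?mxE//.
  by rewrite unitmxE unitfE.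
move=> k Vk; split; last exact: phi_psi.
split; last by rewrite /preimage /= phi_psi.
rewrite /Omega /= /psi endpoint_chart; last exact: Lint_perp.
have -> : \col_j chart_sol (val k) j 0 = chart_sol (val k) by apply/colP => j; rewrite mxE.
by rewrite /chart_sol mulKVmx// unitmxE unitfE.
Qed.

End Chart.

Section Limits.
Context (R : realType) (T : Type) (F : set_system T).
Hypothesis FF : Filter F.

Lemma cvg_sumr (I : Type) (r : seq I) (P : pred I) (f : I -> T -> R) (x : I -> R) :
  (forall i, P i -> f i @ F --> x i) ->
  (fun t => \sum_(i <- r | P i) f i t) @ F --> \sum_(i <- r | P i) x i.
Proof. by apply: cvg_big; exact: add_continuous. Qed.

Lemma cvg_det n (M : T -> 'M[R]_n) (N : 'M[R]_n) :
  (forall i j, (fun t => M t i j) @ F --> N i j) ->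
  (fun t => \det (M t)) @ F --> \det N.
Proof.
move=> MN; apply: cvg_sumr => s _; apply: cvgM; first exact: cvg_cst.
by apply: cvg_big => [|i _]; [exact: mul_continuous|exact: MN].
Qed.

End Limits.

(** * Choice of independent rows at distinct times *)

Section Selection.
Context (R : realType) (d l : nat) (D : set R) (a : R -> 'I_d -> 'rV[R]_l).
Hypothesis oD : open D.
Hypothesis ca : forall m k, continuous (fun t => a t m 0 k).
Hypothesis full : forall eta : 'cV[R]_l, eta != 0 ->
  exists t m, D t /\ (a t m *m eta) 0 0 != 0.

(* As long as the chosen rows do not span, some vector eta is orthogonal to all
   of them but not to a t0 m; by continuity t0 can be moved off the abscissas
   already used. *)
Lemma independent_rows r : (r <= l)%N -> exists s : r.-tuple (R * 'I_d),
  [/\ uniq (map fst s), forall p, p \in (s : seq (R * 'I_d)) -> D p.1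
    & row_free (\matrix_(j < r) a (tnth s j).1 (tnth s j).2)].
Proof.
elim: r => [_|r IH rl].
  exists [tuple]; split => //; rewrite /row_free.
  by rewrite (flatmx0 (\matrix_(j < 0) _)) mxrank0.
have [s [us Ds Bs]] := IH (ltnW rl).
set B := \matrix_(j < r) _ in Bs.
pose eta := (nz_row (kermx B^T))^T.
have eta0 : eta != 0.
  rewrite /eta trmx_eq0 nz_row_eq0 kermx_eq0 /row_free mxrank_tr neq_ltn.
  by rewrite (leq_ltn_trans (rank_leq_row B) rl).
have Beta : B *m eta = 0.
  apply: trmx_inj; rewrite trmx_mul trmxK trmx0; apply/sub_kermxP; exact: nz_row_sub.
have [t0 [m [Dt0 at0]]] := full eta0.
have cval : {for t0, continuous (fun t => (a t m *m eta) 0 0)}.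
  rewrite (_ : (fun t => _) = (fun t => \sum_k a t m 0 k * eta k 0)); last first.
    by apply/funext => t; rewrite mxE.
  have : (fun t => \sum_k a t m 0 k * eta k 0) @ t0 --> \sum_k a t0 m 0 k * eta k 0.
    apply: cvg_sumr => k _; apply: cvgM; [exact: ca|exact: cvg_cst].
  by [].
have n1 : \forall t \near t0^', D t.
  by apply: nbhs_dnbhs; apply: open_nbhs_nbhs.
have n2 : \forall t \near t0^', (a t m *m eta) 0 0 != 0.
  apply: nbhs_dnbhs; exact: (cvgr_neq0 _ cval at0).
have n3 : \forall t \near t0^', t \notin map fst s.
  elim: (map fst s) => [|b bs IHb]; first by apply: nearW.
  have nb : \forall t \near t0^', t != b.
    have [->|tb] := eqVneq b t0; first exact: nbhs_dnbhs_neq.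
    have nb : \forall t \near t0, t - b != 0.
      have c : (fun t => t - b) @ t0 --> t0 - b.
        by apply: cvgB; [exact: cvg_id|exact: cvg_cst].
      by apply: (cvgr_neq0 _ c); rewrite subr_eq0 eq_sym.
    by apply: nbhs_dnbhs; apply: filterS nb => t; rewrite subr_eq0.
  by apply: filterS2 nb IHb => t tb tbs; rewrite in_cons negb_or tb.
have PF : ProperFilter t0^' by exact: Proper_dnbhs_numFieldType.
have /(@filter_ex _ _ PF)[t [[Dt at_neq0] ts]] : \forall t \near t0^', (D t /\ (a t m *m eta) 0 0 != 0) /\ t \notin map fst s.
  exact: filterI (filterI n1 n2) n3.
exists [tuple of (t, m) :: s]; split.
- by rewrite /= ts.
- by move=> p; rewrite in_cons => /orP[/eqP ->//|/Ds].
apply/inj_row_free => v; rewrite mulmx_sum_row big_ord_recl rowK !tnth0 /=.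
set w := \sum_i _ => vB.
pose v2 := \row_j v 0 (lift ord0 j).
have wE : w = v2 *m B.
  rewrite mulmx_sum_row; apply: eq_bigr => j _; rewrite !rowK mxE tnthS.
  by [].
have v0 : v 0 ord0 = 0.
  have := congr1 (fun x : 'rV_l => (x *m eta) 0 0) vB.
  rewrite mulmxDl wE -mulmxA Beta mulmx0 addr0 -scalemxAl mul0mx [LHS]mxE [RHS]mxE.
  by move=> /eqP; rewrite mulf_eq0 (negbTE at_neq0) orbF => /eqP.
have v20 : v2 = 0.
  apply: (row_free_inj Bs); rewrite mul0mx -wE.
  by move: vB; rewrite v0 scale0r add0r.
apply/rowP => j; rewrite mxE; case: (unliftP ord0 j) => [j' ->|-> //].
by have := congr1 (fun x : 'rV_r => x 0 j') v20; rewrite !mxE.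
Qed.

End Selection.

(** * Concentrated controls with nested supports *)

Section Spikes.
Context (R : realType) (d : nat).
Local Notation mu := (leb02pi R).
Local Notation H := (L2 R d).
Implicit Types (u v : H) (i j : 'I_d) (w : 'rV[R]_d) (f : R -> R) (a b c e t : R).
Implicit Types (M : 'M[R]_d).
Local Hint Resolve S2_L2fun measurable_L2fun S2_cst S2_prim : core.

Definition bump a b t : R :=
  (b - a)^-1 * ((cst (1 : R) \_ `[0, b]%classic) t - (cst (1 : R) \_ `[0, a]%classic) t).

Lemma S2_bump a b : S2 (bump a b).
Proof. by apply: S2Z; apply: S2B; exact: S2_restrict. Qed.
Local Hint Resolve S2_bump : core.

Lemma segment_tens a b w : segment a b w = tens (bump a b) w.
Proof.
have Sr t : S2 (cst (1 : R) \_ `[0, t]%classic) by exact: S2_restrict.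
rewrite /segment /tens1 !cutoff_tens// /bump tensZ; last exact: S2B.
congr (_ *: _); rewrite -[in LHS]scaleN1r -tensZ// -tensD//; last exact: S2Z.
by congr (tens _ w); apply/funext => t; rewrite /= mulN1r.
Qed.

Lemma bumpE a b t : 0 <= a -> a < b ->
  bump a b t = if a < t <= b then (b - a)^-1 else 0.
Proof.
move=> a0 ab; rewrite /bump !patchE !mem_setE !in_itv/=.
have [t0|t0] /= := leP 0 t; last by rewrite ltNge (le_trans (ltW t0) a0)/= subrr mulr0.
have [at_|ta] /= := ltP a t.
  by case: (leP t b) => _; rewrite ?subr0 ?mulr1 ?mulr0.
by rewrite (le_trans ta (ltW ab)) subrr mulr0.
Qed.

Lemma Rintegral_bump a b : 0 <= a -> a < b -> b <= 2 * pi ->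
  \int[mu]_t bump a b t = 1.
Proof.
move=> a0 ab b2; have b0 : 0 <= b := le_trans a0 (ltW ab).
have int1 t : 0 <= t -> t <= 2 * pi -> \int[mu]_s (cst (1 : R) \_ `[0, t]%classic) s = t.
  move=> t0 t2; rewrite -Rintegral_mkcond Rintegral_cst// mul1r.
  by rewrite leb02pi_sub_itv//= subr0.
have Sr t : S2 (cst (1 : R) \_ `[0, t]%classic) by exact: S2_restrict.
rewrite /bump RintegralZl//; last by apply: S2_integrable; exact: S2B.
rewrite RintegralB//; [|exact: S2_integrable|exact: S2_integrable].
rewrite !int1// ?mulVf ?subr_eq0 ?gt_eqF//.
by rewrite (le_trans (ltW ab)).
Qed.

Lemma segment_mean f w' w a b c e : S2 f -> 0 <= a -> a < b -> b <= 2 * pi ->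
  (forall t, a <= t <= b -> `|f t - c| <= e) ->
  `|L2dot (tens f w') (segment a b w) - c * \sum_i w' 0 i * w 0 i| <=
    e * `|\sum_i w' 0 i * w 0 i|.
Proof.
move=> Sf a0 ab b2 fc; rewrite segment_tens L2dot_tens2//.
set S := \sum_i _.
have Sfc : S2 (fun t => f t - c) by apply: S2B => //; exact: S2_cst.
have intb : \int[mu]_t (f t * bump a b t) - c = \int[mu]_t ((f t - c) * bump a b t).
  have -> : c = \int[mu]_t (c * bump a b t).
    by rewrite RintegralZl ?Rintegral_bump ?mulr1//; exact: S2_integrable.
  rewrite -RintegralB//; [|exact: S2M|exact/S2_integrable/S2Z].
  by apply: eq_Rintegral => t _; rewrite mulrBl RintegralZl ?Rintegral_bump ?mulr1//; exact: S2_integrable.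
rewrite mulrC -mulrBl intb normrM; apply: ler_wpM2r => //.
have bge t : 0 <= bump a b t.
  by rewrite bumpE//; case: ifP => // _; rewrite invr_ge0 subr_ge0 ltW.
have := @le_normr_Rintegral _ _ _ mu setT (fun t => (f t - c) * bump a b t) measurableT (S2M Sfc (S2_bump a b)).
move=> /le_trans; apply.
have -> : e = \int[mu]_t (e * bump a b t).
  by rewrite RintegralZl ?Rintegral_bump ?mulr1//; exact: S2_integrable.
apply: le_Rintegral => //.
- exact: (integrable_abse (S2M Sfc (S2_bump a b))).
- exact/S2_integrable/S2Z.
move=> t _; rewrite normrM (ger0_norm (bge t)).
have [at_|nat_] := boolP (a < t <= b).
  apply: ler_wpM2r => //; apply: fc.
  by case/andP: at_ => /ltW -> ->.
by rewrite bumpE// (negbTE nat_) !mulr0.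
Qed.

(** A segment of mass w on a shrinking interval tends to a Dirac mass at points of continuity; both
    ends may move, as they do for the spikes near 0. *)
Lemma segment_mean_cvg (T : Type) (F : set_system T) (a b : T -> R) f w' w c :
  Filter F -> S2 f -> {for c, continuous f} ->
  (\forall z \near F, 0 <= a z /\ a z < b z /\ b z <= 2 * pi) ->
  a @ F --> c -> b @ F --> c ->
  (fun z => L2dot (tens f w') (segment (a z) (b z) w)) @ F -->
    f c * \sum_i w' 0 i * w 0 i.
Proof.
move=> FF Sf cf ab ac bc; set S := \sum_i _.
apply/cvgrPdist_le => e e0; have e'0 : 0 < e / (`|S| + 1) by rewrite divr_gt0// ltr_wpDl.
have /cvgrPdist_lt/(_ _ e'0)/nbhs_ballP[r /= r0 fr] := cf.
have /cvgrPdist_lt/(_ _ r0) na := ac; have /cvgrPdist_lt/(_ _ r0) nb := bc.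
apply: filterS (filterI ab (filterI na nb)) => z [[a0 [abt b2]] [nat_ nbt]].
rewrite distrC (le_trans (segment_mean w' w (e := e / (`|S| + 1)) Sf a0 abt b2 _))//; last first.
  rewrite -/S mulrAC -mulrA ler_piMr ?(ltW e0)// ler_pdivrMr ?ltr_wpDl//.
  by rewrite mul1r lerDl.
move=> s /andP[as_ sb]; rewrite distrC; apply: ltW; apply: fr; rewrite -ball_normE /=.
move: nat_ nbt; rewrite !ltr_norml; lra.
Qed.

(** Here u is supported in [p, q] and v outside it. While u acts, the primitive of v is constant and
    u has integral 0; while v acts, the primitive of u is 0. *)
Lemma area_nested M p q u v : 0 <= p -> 0 <= q ->
  cutoff q u = u -> tail p u = u -> Lint u = 0 -> cutoff p v + tail q v = v ->
  area M u v = 0 /\ area M v u = 0.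
Proof.
move=> p0 q0 qu pu u0 <-; split.
  rewrite areaDr -{1}pu area_tail_cutoff// add0r -{1}qu area_cutoff_tail//.
  by rewrite qu u0 /omega big1 ?mulr0// => i _; rewrite big1// => j _; rewrite mxE mul0r mulr0.
rewrite areaDl -{1}pu area_cutoff_tail// pu u0 omega0r mulr0 add0r.
by rewrite -{1}qu area_tail_cutoff.
Qed.

(* A spike of mass w at b, compensated by a spike of mass -w near 0.  The
   supports of two such spikes are nested: the one with the larger b surrounds
   the other. *)
Definition spike b e w : H :=
  segment b (b + e) w - segment (e * (2 * pi - b - e)) (e * (2 * pi - b)) w.

(** The compensating interval is the image of [b, b + e] under the decreasing map t -> e (2 pi - t),
    so that disjoint intervals have disjoint images in the reverse order: this is the nesting. The
    last condition places all these images, contained in [0, 2 pi e], before b. *)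
Definition spike_ok b e := [/\ 0 < e, b + e <= 2 * pi & e * (2 * pi) <= b].

Section Spike.
Variables (b e : R) (w : 'rV[R]_d).
Hypothesis ok : spike_ok b e.

Lemma spike_bounds : [/\ 0 <= e * (2 * pi - b - e),
  e * (2 * pi - b - e) < e * (2 * pi - b), e * (2 * pi - b) <= b & 0 <= b].
Proof.
have [e0 be eb] := ok; have p0 : 0 <= pi :> R := pi_ge0 R.
have b0 : 0 <= b by apply: le_trans eb; rewrite mulr_ge0 ?(ltW e0)// mulr_ge0.
split => //.
- by rewrite mulr_ge0 ?(ltW e0)//; lra.
- by rewrite ltr_pM2l//; lra.
by apply: le_trans eb; rewrite ler_pM2l//; lra.
Qed.

Lemma spike_tens : exists2 f, S2 f & spike b e w = tens f w.
Proof.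
rewrite /spike !segment_tens; exists (bump b (b + e) \+
  (fun t => - 1 * bump (e * (2 * pi - b - e)) (e * (2 * pi - b)) t)).
  by apply: S2D => //; exact: S2Z.
rewrite tensD//; last exact: S2Z.
by rewrite (tensZ (- 1))// scaleN1r.
Qed.

Lemma area_spike M : M^T = - M -> area M (spike b e w) (spike b e w) = 0.
Proof. by move=> skewM; have [f Sf ->] := spike_tens; exact: area_tens. Qed.

Lemma Lint_spike : Lint (spike b e w) = 0.
Proof.
have [e0 be eb] := ok; have [h1 h2 h3 h4] := spike_bounds.
rewrite linearB/= !Lint_segment ?subrr//; last by rewrite ltrDl.
by apply: le_trans h3 _; lra.
Qed.

Lemma cutoff_spike : cutoff (b + e) (spike b e w) = spike b e w.
Proof.
have [e0 be eb] := ok; have [h1 h2 h3 h4] := spike_bounds.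
rewrite linearB/= !cutoff_segment_ge ?ltrDl//.
by apply: le_trans h3 _; rewrite lerDl ltW.
Qed.

Lemma tail_spike : tail (e * (2 * pi - b - e)) (spike b e w) = spike b e w.
Proof.
have [e0 be eb] := ok; have [h1 h2 h3 h4] := spike_bounds.
rewrite /tail linearB/= !cutoff_segment_le ?subr0 ?ltrDl//.
by rewrite (le_trans (ltW h2)).
Qed.

End Spike.

Lemma spike_surround b b' e w : spike_ok b e -> spike_ok b' e -> b + e <= b' ->
  cutoff (e * (2 * pi - b - e)) (spike b' e w) + tail (b + e) (spike b' e w) = spike b' e w.
Proof.
move=> ok ok' bb'; have [e0 be eb] := ok; have [h1 h2 h3 h4] := spike_bounds ok.
have [_ be' eb'] := ok'; have [h1' h2' h3' h4'] := spike_bounds ok'.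
have k1 : e * (2 * pi - b') <= e * (2 * pi - b - e) by rewrite ler_pM2l//; lra.
have k2 : e * (2 * pi - b') <= b + e by lra.
have k3 : e * (2 * pi - b - e) <= b' by lra.
rewrite /tail /spike !linearB/= (cutoff_segment_ge w h2' k1) (cutoff_segment_ge w h2' k2).
rewrite !cutoff_segment_le ?ltrDl// !sub0r opprK.
by rewrite oppr0 add0r subrK addrC.
Qed.

Lemma area_spikes M b b' e w w' : spike_ok b e -> spike_ok b' e -> b + e <= b' ->
  area M (spike b e w) (spike b' e w') = 0 /\ area M (spike b' e w') (spike b e w) = 0.
Proof.
move=> ok ok' bb'; have [h1 h2 h3 h4] := spike_bounds ok.
apply: (@area_nested M (e * (2 * pi - b - e)) (b + e)) => //.
- by have [e0 _ _] := ok; rewrite addr_ge0// ltW.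
- exact: cutoff_spike.
- exact: tail_spike.
- exact: Lint_spike.
- exact: spike_surround.
Qed.

Lemma near_spike_ok b : 0 < b -> b < 2 * pi -> \forall e \near 0^'+, spike_ok b e.
Proof.
move=> b0 b2; have p0 : 0 < 2 * pi :> R by rewrite mulr_gt0// pi_gt0.
have m0 : 0 < Num.min (2 * pi - b) (b / (2 * pi)) by rewrite lt_min subr_gt0 b2 divr_gt0.
near=> e; have e0 : 0 < e by near: e; exact: nbhs_right_gt.
have : e < Num.min (2 * pi - b) (b / (2 * pi)) by near: e; exact: nbhs_right_lt.
by rewrite lt_min ltr_pdivlMr// => /andP[h1 h2]; split => //; lra.
Unshelve. all: by end_near. Qed.

Lemma spike_cvg f w' w b : 0 < b -> b < 2 * pi -> S2 f ->
  {for b, continuous f} -> {for 0, continuous f} ->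
  (fun e => L2dot (tens f w') (spike b e w)) @ 0^'+ -->
    (f b - f 0) * \sum_i w' 0 i * w 0 i.
Proof.
move=> b0 b2 Sf fb f0.
rewrite (_ : (fun e => _) = (fun e => L2dot (tens f w') (segment b (b + e) w) -
  L2dot (tens f w') (segment (e * (2 * pi - b - e)) (e * (2 * pi - b)) w))); last first.
  by apply/funext => e; rewrite L2dotBr.
have id0 : (fun e : R => e) @ 0^'+ --> (0 : R) by by apply: cvg_at_right_filter; exact: cvg_id.
rewrite mulrBl; apply: cvgB; apply: segment_mean_cvg => //.
- apply: filterS (near_spike_ok b0 b2) => e ok; have [e0 be eb] := ok.
  by rewrite ltrDl (ltW b0).
- exact: cvg_cst.
- by rewrite -[b in _ --> b]addr0; apply: cvgD => //; exact: cvg_cst.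
- apply: filterS (near_spike_ok b0 b2) => e ok; have [e0 be eb] := ok.
  by have [h1 h2 h3 h4] := spike_bounds ok; split => //; split => //; lra.
- rewrite -[X in _ --> X](mul0r (2 * pi - b - 0)); apply: cvgM => //.
  by apply: cvgB => //; exact: cvg_cst.
- rewrite -[X in _ --> X](mul0r (2 * pi - b)); apply: cvgM => //.
  exact: cvg_cst.
Qed.

End Spikes.

(** * Regular fibres *)

Section RegularFibres.
Context (R : realType) (d l : nat) (A : l.-tuple 'M[R]_d).
Local Notation mu := (leb02pi R).
Local Notation H := (L2 R d).
Implicit Types (u v : H) (t : R).
Hypothesis skewA : forall k, (tnth A k)^T = - tnth A k.
Local Hint Resolve S2_L2fun measurable_L2fun S2_cst S2_prim : core.

Lemma prim_continuous u i : continuous (prim u i).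
Proof.
rewrite (_ : prim u i = (fun w : H => Lint w 0 i) \o (fun t => cutoff t u)).
  move=> t; apply: continuous_comp; last exact: Lint_coord_continuous.
  apply: (@continuous_comp _ _ _ (fun t => (u, t)) (fun z : H * R => cutoff z.2 z.1)).
    by apply: (@cvg_pair _ _ _ _ (nbhs u) (nbhs t)); [exact: cvg_cst|exact: cvg_id].
  exact: cutoff_continuous.
by apply/funext => t; rewrite /prim positionE.
Qed.

(** For v of mean 0, integration by parts makes the two halves of the polar form equal, so the
    differential in the direction v pairs v with the image of the curve of u under M. *)
Lemma area_symE M u v : Lint v = 0 -> M^T = - M ->
  area_sym M v u = \sum_i \sum_j M i j * pairing i j u v.
Proof.
move=> v0 skewM; rewrite /area_sym area_by_parts// /area -mulrDl.
by rewrite -splitr mul1r.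
Qed.

(** Values at distinct positive times form an invertible Vandermonde-type matrix. The exponents
    start at 1 so that the functions vanish at 0, where the compensating spikes concentrate; [atan]
    makes them bounded on the whole line. *)
Definition atan_pow (k : 'I_l) t : R := atan t ^+ k.+1.

Lemma atan_pow_continuous k : continuous (atan_pow k).
Proof.
move=> t; apply: (@continuous_comp _ _ _ (@atan R) (fun x => x ^+ k.+1)).
  exact: continuous_atan.
exact: exprn_continuous.
Qed.

Lemma S2_atan_pow k : S2 (atan_pow k).
Proof.
apply: (@S2_bounded _ _ ((pi / 2) ^+ k.+1)).
  by apply: continuous_measurable_fun; exact: atan_pow_continuous.
move=> t; rewrite normrX lerXn2r ?nnegrE ?divr_ge0 ?pi_ge0//.
by rewrite ler_norml !ltW// ?atan_gtNpi2 ?atan_ltpi2.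
Qed.
Local Hint Resolve S2_atan_pow : core.

(** The family whose orthogonal is the model space, independent of A and of the point. The vector
    with all entries 1 detects a spike along any coordinate axis. *)
Definition constraint (x : 'I_d + 'I_l) : H :=
  match x with
  | inl i => tens1 (delta_mx 0 i)
  | inr k => tens (atan_pow k) (const_mx 1)
  end.

Section Point.
Variables (u0 : H) (y : 'rV[R]_l).
Hypothesis u0y : endpoint A u0 = (0, y).
Hypothesis regular : forall eta : 'cV[R]_l, eta != 0 -> exists t m,
  (position u0 t *m \sum_k eta k 0 *: tnth A k) 0 m != 0.

(** The limit of the differential of the vertical coordinates at u0 on spikes of direction e_m at
    time t, as their width tends to 0. *)
Let moment t m : 'rV[R]_l := \row_k (position u0 t *m tnth A k) 0 m.

Lemma moment_continuous m k : continuous (fun t => moment t m 0 k).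
Proof.
move=> t; rewrite (_ : (fun t => _) = (fun t => \sum_i prim u0 i t * tnth A k i m)).
  by apply: cvg_sumr => i _; apply: cvgM; [exact: prim_continuous|exact: cvg_cst].
by apply/funext => s; rewrite !mxE.
Qed.

Lemma moment_full (eta : 'cV[R]_l) : eta != 0 -> exists t m,
  (`]0, 2 * pi[%classic t) /\ (moment t m *m eta) 0 0 != 0.
Proof.
move=> /regular[t [m tm]]; exists t, m.
have Lu0 : Lint u0 = 0 by have := u0y; rewrite endpointE => -[].
split; last first.
  move: tm; congr (_ != _); rewrite mulmx_sumr summxE mxE; apply: eq_bigr => k _.
  by rewrite -scalemxAr !mxE mulrC.
rewrite /= in_itv/=; apply/andP; split; rewrite ltNge; apply/negP => tle;
  move: tm; rewrite positionE.
  by rewrite cutoff_le0// linear0 mul0mx mxE eqxx.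
by rewrite cutoff_id// Lu0 mul0mx mxE eqxx.
Qed.

(** Times b_j and axes m_j are chosen so that the moments are independent. As the width e tends to
    0, the two matrices tend to a Vandermonde-type matrix in the atan b_j and to the matrix of
    moments, both invertible; a small e keeps them invertible and separates the supports. *)
Lemma spike_family : exists v : 'I_l -> H,
  [/\ forall j, Lint (v j) = 0,
      forall k i j, area (tnth A k) (v i) (v j) = 0,
      (\matrix_(k, j) L2dot (constraint (inr k)) (v j)) \in unitmx
    & (\matrix_(k, j) area_sym (tnth A k) (v j) u0) \in unitmx].
Proof.
have oD : open (`]0, 2 * pi[%classic : set R) by exact: interval_open.
have [|s [us Ds freeB]] := independent_rows oD moment_continuous _ (leqnn l).
  by move=> eta /moment_full[t [m [tD tm]]]; exists t, m.
pose b j := (tnth s j).1; pose m j := (tnth s j).2.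
have b_bounds j : 0 < b j /\ b j < 2 * pi.
  have := Ds _ (mem_tnth j s); rewrite /= in_itv/= => /andP[]; by split.
have b_inj : injective b.
  have nthb (j : 'I_l) : nth 0 (map fst s) j = b j.
    by rewrite (nth_map (tnth s j)) ?size_tuple// -tnth_nth.
  move=> i j bij; apply/val_inj/eqP.
  have sz : size (map fst s) = l by rewrite size_map size_tuple.
  rewrite -(nth_uniq 0 _ _ us) ?sz ?ltn_ord//.
  by rewrite !nthb bij.
pose v e j := spike (b j) e (delta_mx 0 (m j)).
pose G e := \matrix_(k, j) L2dot (constraint (inr k)) (v e j).
pose G0 := \matrix_(k, j) atan_pow k (b j).
pose M e := \matrix_(k, j) area_sym (tnth A k) (v e j) u0.
pose M0 := \matrix_(k, j) moment (b j) (m j) 0 k.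
have PF : ProperFilter (0 : R)^'+ by exact: at_right_proper_filter.
have FF : Filter (0 : R)^'+ by first [exact: (@filter_filter _ _ PF) | exact _].
have ok : \forall e \near 0^'+, forall j, spike_ok (b j) e.
  have h j : \forall e \near 0^'+, spike_ok (b j) e.
    by have [b0 b2] := b_bounds j; exact: near_spike_ok.
  exact: filter_forall h.
have sep : \forall e \near 0^'+, forall i j, i != j -> e <= `|b i - b j|.
  have h i j : \forall e \near 0^'+, i != j -> e <= `|b i - b j|.
    have [->|ij] := eqVneq i j; first by apply: nearW.
    apply: filterS (nbhs_right_le (x := 0) (z := `|b i - b j|) _) => //.
    by rewrite normr_gt0 subr_eq0 (inj_eq b_inj).
  by apply: filter_forall => i; exact: filter_forall (h i).
have detG0 : \det G0 != 0.
  have -> : G0 = Vandermonde l (\row_j atan (b j)) *m diag_mx (\row_j atan (b j)).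
    by apply/matrixP => k j; rewrite mul_mx_diag !mxE /atan_pow exprSr.
  have atan_inj : injective (@atan R) by exact: can_inj (@atanK R).
  rewrite det_mulmx det_diag det_Vandermonde mulf_neq0//.
    apply/prodf_neq0 => i _; apply/prodf_neq0 => j ij.
    rewrite !mxE subr_eq0 (inj_eq atan_inj) (inj_eq b_inj) eq_sym.
    by rewrite neq_ltn ij.
  apply/prodf_neq0 => j _; rewrite mxE -[X in _ != X]atan0 (inj_eq atan_inj).
  by have [/gt_eqF ->] := b_bounds j.
have detM0 : \det M0 != 0.
  move: freeB; rewrite row_free_unit unitmxE unitfE -det_tr; congr (\det _ != _).
  by apply/matrixP => k j; rewrite !mxE.
have detG : \forall e \near 0^'+, \det (G e) != 0.
  suff c : (fun e => \det (G e)) @ 0^'+ --> \det G0 by exact: cvgr_neq0 c detG0.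
  apply: cvg_det => k j; have [b0 b2] := b_bounds j.
  rewrite [X in X @ _](_ : _ = (fun e => L2dot (tens (atan_pow k) (const_mx 1))
    (spike (b j) e (delta_mx 0 (m j))))); last by apply/funext => e; rewrite mxE.
  have -> : G0 k j = (atan_pow k (b j) - atan_pow k 0) *
      \sum_i (const_mx 1 : 'rV[R]_d) 0 i * (delta_mx 0 (m j) : 'rV[R]_d) 0 i.
    rewrite /atan_pow atan0 expr0n/= subr0 mxE (bigD1 (m j))//= !mxE !eqxx mulr1.
    by rewrite big1 ?addr0 ?mulr1// => i im; rewrite !mxE eqxx (negbTE im) mulr0.
  by apply: spike_cvg => //; exact: atan_pow_continuous.
have detM : \forall e \near 0^'+, \det (M e) != 0.
  suff c : (fun e => \det (M e)) @ 0^'+ --> \det M0 by exact: cvgr_neq0 c detM0.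
  apply: cvg_det => k j; have [b0 b2] := b_bounds j.
  have E : \forall e \near 0^'+, \sum_i \sum_i' tnth A k i i' * pairing i i' u0 (v e j) = M e k j.
    apply: filterS ok => e /(_ j) okj; rewrite mxE area_symE//.
    exact: Lint_spike.
  apply: cvg_trans (near_eq_cvg E) _.
  have -> : M0 k j = \sum_i \sum_i' tnth A k i i' * ((prim u0 i (b j) - prim u0 i 0) *
      \sum_p (delta_mx 0 i' : 'rV[R]_d) 0 p * (delta_mx 0 (m j) : 'rV[R]_d) 0 p).
    rewrite [LHS]mxE [LHS]mxE [LHS]mxE; apply: eq_bigr => i _.
    have -> : prim u0 i 0 = 0 by rewrite /prim positionE cutoff_le0// linear0 mxE.
    have deltaE i' : \sum_p (delta_mx 0 i' : 'rV[R]_d) 0 p * (delta_mx 0 (m j) : 'rV[R]_d) 0 p =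
        (i' == m j)%:R.
      rewrite (bigD1 i')//= !mxE !eqxx mul1r big1 ?addr0// => p pi'.
      by rewrite !mxE (negbTE pi') mul0r.
    under [RHS]eq_bigr do rewrite deltaE subr0.
    rewrite [RHS](bigD1 (m j))//= eqxx mulr1 big1; first by rewrite addr0 mulrC.
    by move=> i' im; rewrite (negbTE im) !mulr0.
  apply: cvg_sumr => i _; apply: cvg_sumr => i' _; apply: cvgM; first exact: cvg_cst.
  rewrite [X in X @ _](_ : _ = (fun e => L2dot (tens (prim u0 i) (delta_mx 0 i'))
    (spike (b j) e (delta_mx 0 (m j))))); last first.
    by apply/funext => e; rewrite pairingE.
  by apply: spike_cvg => //; exact: prim_continuous.
have [e [[oke sepe] [Ge Me]]] := filter_ex (filterI (filterI ok sep) (filterI detG detM)).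
exists (v e); split.
- by move=> j; exact: Lint_spike.
- move=> k i j; have [->|ij] := eqVneq i j; first exact: area_spike.
  have := sepe _ _ ij; have [bij|bji] := leP (b i) (b j).
    rewrite ler0_norm ?subr_le0// opprB lerBrDl => h.
    by rewrite /v; exact: (area_spikes _ _ _ (oke i) (oke j) h).1.
  rewrite gtr0_norm ?subr_gt0// lerBrDl => h.
  by rewrite /v; exact: (area_spikes _ _ _ (oke j) (oke i) h).2.
- by rewrite unitmxE unitfE.
- by rewrite unitmxE unitfE.
Qed.

End Point.
End RegularFibres.

(** * Generic fibres consist of regular points *)

Section HilbertFibres.
Context (R : realType) (d l : nat) (A : l.-tuple 'M[R]_d).
Local Notation mu := (leb02pi R).
Local Notation H := (L2 R d).
Local Notation g := (@constraint R d l).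
Hypothesis skewA : forall k, (tnth A k)^T = - tnth A k.
Local Hint Resolve S2_L2fun measurable_L2fun S2_cst S2_prim : core.

Lemma L2dot_g_inl i (u : H) : L2dot (g (inl i)) u = Lint u 0 i.
Proof. by rewrite LintE. Qed.

(** Applying G^-1 to the v_j makes them dual to the auxiliary controls, and subtracting such
    combinations from constant controls completes the dual family. Isotropy survives linear
    combinations, and [chart_mx] at 0 becomes M G^-1. *)
Lemma dual_family (u0 : H) (v : 'I_l -> H) :
  (forall j, Lint (v j) = 0) ->
  (forall k i j, area (tnth A k) (v i) (v j) = 0) ->
  (\matrix_(k, j) L2dot (g (inr k)) (v j)) \in unitmx ->
  (\matrix_(k, j) area_sym (tnth A k) (v j) u0) \in unitmx ->
  exists w : 'I_d + 'I_l -> H,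
  [/\ forall i j, L2dot (g i) (w j) = (i == j)%:R,
      forall k i j, area (tnth A k) (w (inr i)) (w (inr j)) = 0
    & \det (chart_mx A w u0 0) != 0].
Proof.
move=> v0 vv; set G := \matrix_(k, j) L2dot _ _ => Gu.
set M := \matrix_(k, j) area_sym _ _ _ => Mu.
pose wr j : H := \sum_i invmx G i j *: v i.
have wr0 j : Lint (wr j) = 0.
  by rewrite linear_sum big1// => i _; rewrite linearZ/= v0 scaler0.
have gwr k j : L2dot (g (inr k)) (wr j) = (k == j)%:R.
  have := congr1 (fun N : 'M[R]_l => N k j) (mulmxV Gu); rewrite mxE [RHS]mxE => <-.
  by rewrite L2dot_sumr; apply: eq_bigr => i _; rewrite L2dotZr [G k i]mxE mulrC.
have p0 : 0 < 2 * pi :> R by rewrite mulr_gt0// pi_gt0.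
pose wl j : H := (2 * pi)^-1 *:
  (tens1 (delta_mx 0 j) - \sum_k L2dot (g (inr k)) (tens1 (delta_mx 0 j)) *: wr k).
have wl0 j : Lint (wl j) = delta_mx 0 j.
  rewrite linearZ/= linearB/= linear_sum big1 ?subr0; last first.
    by move=> k _; rewrite linearZ/= wr0 scaler0.
  have := @Lint_tens1 R d (2 * pi) (delta_mx 0 j) (ltW p0) (lexx _).
  by rewrite cutoff_id// => ->; rewrite scalerA mulVf ?scale1r// gt_eqF.
have gwl k j : L2dot (g (inr k)) (wl j) = 0.
  rewrite L2dotZr L2dotBr L2dot_sumr (bigD1 k)//= L2dotZr gwr eqxx mulr1.
  rewrite big1 ?addr0 ?subrr ?mulr0// => k' kk'.
  by rewrite L2dotZr gwr eq_sym (negbTE kk') mulr0.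
pose w (x : 'I_d + 'I_l) : H := match x with inl j => wl j | inr j => wr j end.
exists w; split.
- case=> [i|k] [j|j]; rewrite ?L2dot_g_inl ?wl0 ?wr0 ?gwl ?gwr ?mxE//.
- move=> k i j; rewrite /wr area_suml big1// => i' _; rewrite areaZl area_sumr big1 ?mulr0//.
  by move=> j' _; rewrite areaZr vv mulr0.
rewrite -unitfE -unitmxE; suff -> : chart_mx A w u0 0 = M *m invmx G.
  by rewrite unitmx_mul Mu unitmx_inv.
apply/matrixP => k j; rewrite !mxE addr0 /area_sym /wr area_suml area_sumr -big_split.
apply: eq_bigr => i _ /=; rewrite areaZl areaZr [M k i]mxE /area_sym.
by rewrite -mulrDr mulrC.
Qed.

Lemma regular_fibre_chart (u0 : H) y : endpoint A u0 = (0, y) ->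
  (forall eta : 'cV[R]_l, eta != 0 -> exists t m,
    (position u0 t *m \sum_k eta k 0 *: tnth A k) 0 m != 0) ->
  exists (U : set H) (V : set (perp_complete g)) (phi : H -> perp_complete g)
    (psi : perp_complete g -> H),
  [/\ open U, U u0 & open V] /\
  [/\ smooth_on U phi, smooth_on V psi,
      forall x, (Omega A (0, y) `&` U) x -> V (phi x) /\ psi (phi x) = x
    & forall k, V k -> (Omega A (0, y) `&` U) (psi k) /\ phi (psi k) = k].
Proof.
move=> u0y reg; have [v [v0 vv Gu Mu]] := spike_family skewA u0y reg.
have [w [gw ww detw]] := dual_family v0 vv Gu Mu.
exact: (fibre_chart gw (fun=> erefl) ww u0y detw).
Qed.

Lemma tens_sum (I : Type) (r : seq I) (c : I -> R) (f : I -> R -> R) x :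
  (forall i, S2 (f i)) -> S2 (fun t => \sum_(i <- r) c i * f i t) /\
  tens (fun t => \sum_(i <- r) c i * f i t) x = \sum_(i <- r) c i *: tens (f i) x :> H.
Proof.
move=> Sf; elim: r => [|i r [IHS IHt]].
  rewrite big_nil (_ : (fun t => _) = (fun t => 0 * cst 1 t)); last first.
    by apply/funext => t; rewrite big_nil mul0r.
  by split; [exact: S2Z|rewrite tensZ// scale0r].
rewrite big_cons (_ : (fun t => _) = (fun t => c i * f i t) \+
  (fun t => \sum_(j <- r) c j * f j t)); last by apply/funext => t; rewrite big_cons.
split; first by apply: S2D => //; exact: S2Z.
by rewrite tensD//; [rewrite IHt tensZ|exact: S2Z].
Qed.

(* The differential of the end-point map at u, restricted to controls of mean 0,
   misses the direction eta if and only if \sum_k eta_k A_k annihilates the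
   curve; the matrix S of iterated integrals of u is then annihilated too. *)
Lemma generic_regular : generic id [set: 'rV[R]_l] (fun y => forall u0 : H,
  endpoint A u0 = (0, y) -> forall eta : 'cV[R]_l, eta != 0 -> exists t m,
    (position u0 t *m \sum_k eta k 0 *: tnth A k) 0 m != 0).
Proof.
have [I [B [BI By]]] := generic_not_critical A.
exists I, B; split => // y yT yB u0 u0y eta eta_neq0; apply: contrapT => neg.
have pos0 t m : (position u0 t *m \sum_k eta k 0 *: tnth A k) 0 m = 0.
  by apply/eqP/negPn/negP => tm; apply: neg; exists t, m.
have [Lu0 yE] : Lint u0 = 0 /\ y = \row_k area (tnth A k) u0 u0.
  by have := u0y; rewrite endpointE => -[-> <-].
(* The factor 1/2 makes tr (A_k^T S) equal to the area; S is skew by integration by parts, as the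
   horizontal curve is closed. *)
pose S := \matrix_(i, j) (1 / 2 * pairing i j u0 u0).
have eta0 : eta^T = 0.
  apply: (By y yT yB S eta^T skewA).
  - apply/matrixP => i j; rewrite !mxE -mulrN; congr (_ * _); apply/eqP.
    by rewrite -addr_eq0 pairing_by_parts Lu0 mxE mul0r.
  - move=> k; rewrite yE mxE /area /mxtrace exchange_big mulr_sumr; apply: eq_bigr => j _ /=.
    rewrite mxE mulr_sumr; apply: eq_bigr => i _; rewrite !mxE; ring.
  set E := \sum_k _.
  have skewE : E^T = - E.
    rewrite linear_sum -sumrN; apply: eq_bigr => k _.
    by rewrite linearZ/= skewA scalerN.
  have EE : E = \sum_k eta k 0 *: tnth A k by apply: eq_bigr => k _; rewrite mxE.
  apply/matrixP => m j; rewrite mxE [RHS]mxE.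
  have Epos t : \sum_i E m i * prim u0 i t = 0.
    have := pos0 t m; rewrite -EE mxE => h; apply/eqP; rewrite -oppr_eq0 -[X in _ == X]h.
    rewrite -sumrN; apply/eqP; apply: eq_bigr => i _.
    have := congr1 (fun N : 'M[R]_d => N m i) skewE; rewrite mxE [RHS]mxE => ->.
    by rewrite mulrC /prim; ring.
  have [_ tE] := tens_sum (index_enum 'I_d) (E m) (delta_mx 0 j) (S2_prim u0).
  transitivity (1 / 2 * L2dot (\sum_i E m i *: tens (prim u0 i) (delta_mx 0 j)) u0).
    rewrite L2dotC L2dot_sumr mulr_sumr; apply: eq_bigr => i _.
    by rewrite mxE pairingE L2dotZr L2dotC mulrCA.
  rewrite -tE (_ : (fun t => _) = (fun t => 0 * cst 1 t)); last first.
    by apply/funext => t; rewrite Epos mul0r.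
  by rewrite tensZ// scale0r L2dotC L2dot0r mulr0.
by move: eta_neq0; rewrite -[eta]trmxK eta0 trmx0 eqxx.
Qed.

End HilbertFibres.

Theorem mainTheorem1 (R : realType) (d l : nat) :
  (forall (W : {vspace 'M[R]_d}) (A : l.-tuple 'M[R]_d),
     grassmannian R d l W -> basis_of W A ->
     forall p : 'rV[R]_d * 'rV[R]_l,
       homotopy_equivalent R (Omega A p) (Omega A (0, 0)) /\
       contractible R (Omega A p)) /\
  generic (grassmannian_coord R d) (grassmannian R d l)
    (fun W => forall A : l.-tuple 'M[R]_d, basis_of W A ->
       generic id [set: 'rV[R]_l]
         (fun y => hilbert_manifold (Omega A (0, y)))).
Proof.
split=> [W A|]; first exact: fibres_contractible.
exists set0, (fun=> set0); split=> // W [_ skewW] _ A /andP[/eqP spanA _].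
have skewA k : (tnth A k)^T = - tnth A k.
  by apply: skewW; rewrite -spanA memv_span// mem_tnth.
have [I [B [BI By]]] := generic_regular skewA.
exists I, B; split => // y yT yB.
exists (perp_complete (@constraint R d l)); first exact: perp_hilbertian.
move=> u0 u0y; apply: (regular_fibre_chart skewA u0y).
exact: By y yT yB u0 u0y.
Qed.
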